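(* Let $(X,\Omega,\mathbb{P},\ell)$ be a random length model with Kirchhoff vertex conditions, zero potential, uniformly bounded vertex degrees and independent edge lengths with $C^1$ densities, as specified in the context (constants $d_{\max},\ell_{\min},\ell_{\max},C_h$). Let $u>1$ and $J_u=[1/u,u]$. Then there exists a constant $C>0$, depending only on $u$, $d_{\max}$, $\ell_{\min}$, $\ell_{\max}$ and $C_h$, such that $$\mathbb{E}\big(\mathrm{tr}\,P_\bullet^{\Lambda,\mathrm D}(I)\big)\le C\cdot\boldsymbol\lambda(I)\cdot|E(\Lambda)|$$ for all compact topological subgraphs $\Lambda\subset X$ and all compact intervals $I\subset J_u$, where $\boldsymbol\lambda(I)$ is the Lebesgue measure of $I$ and $|E(\Lambda)|$ is the number of edges of $\Lambda$.
   Context: **Graphs.** A (directed) topological graph $X$ is a CW-complex with countably many $0$-cells (vertices, $V=V(X)$) and $1$-cells labelled by $E=E(X)$, and no higher cells; for $e\in E$ there is a continuous $\Phi_e:[0,1]\to X$ onto the closed $1$-cell, a homeomorphism from $(0,1)$ onto its image, with $\partial_-e=\Phi_e(0)$, $\partial_+e=\Phi_e(1)\in V$. Put $E_v^\pm=\{e:\partial_\pm e=v\}$, $\deg v=|E_v^+|+|E_v^-|<\infty$. A topological subgraph $\Lambda$ is a CW-subcomplex, with boundary $\partial\Lambda=\Lambda\cap\overline{X\setminus\Lambda}\subset V$. Given a length function $\ell:E\to(0,\infty)$, functions on $\Lambda$ are identified with families $\{f_e\}_{e\in E(\Lambda)}$, $f_e$ a function on $[0,\ell(e)]$ (with $f_e(x)=f(\Phi_e(x/\ell(e)))$),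 and $L_2(\Lambda,\ell)=\bigoplus_{e\in E(\Lambda)}L_2([0,\ell(e)])$. **Random model.** The probability space is $\Omega=\prod_{e\in E}[\ell_{\min},\ell_{\max}]$ with $0<\ell_{\min}\le\ell_{\max}$ and product measure $\mathbb{P}=\bigotimes_{e\in E}\mathbb{P}_e$; the edge lengths are $\ell_\omega(e)=\omega_e$. Each $\mathbb{P}_e$ is a probability measure on $[\ell_{\min},\ell_{\max}]$, absolutely continuous with respect to Lebesgue measure with density $h_e\in C^1(\mathbb{R})$, and there is a constant $C_h>0$, independent of $e$, with $\|h_e\|_\infty,\|h_e'\|_\infty\le C_h$ for all $e\in E$. Vertex degrees satisfy $\deg v\le d_{\max}<\infty$ for all $v\in V(X)$. $\mathbb{E}$ is expectation with respect to $\mathbb{P}$. **Operators.** The vertex conditions are (non-random) Kirchhoff conditions at every vertex and the potential is zero. For a compact subgraph $\Lambda$, $\Delta_\omega^{\Lambda,\mathrm D}$ is the self-adjoint operator $(\Delta f)_e=-f_e''$ on $L_2(\Lambda,\ell_\omega)$ with domain the $f$ with $f_e\in H^2([0,\ell_\omega(e)])$ for all $e \in E(\Lambda)$ such that: at each $v\in\partial\Lambda$ all boundary values of $f$ at $v$ vanish (Dirichlet), and at each $v\in V(\Lambda)\setminus\partial\Lambda$, $f$ is continuous and $\sum_{e\in E_v^+}f_e'(\ell_\omega(e))-\sum_{e\in E_v^-}f_e'(0)=0$ (Kirchhoff). $P_\omega^{\Lambda,\mathrm D}(I)$ is its spectral projection onto $I$, and $\mathrm{tr}$ is the trace on $L_2(\Lambda,\ell_\omega)$.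 *)

(* Defs.v *)
From HB Require Import structures.
From mathcomp Require Import all_boot all_order all_algebra.
From mathcomp Require Import finmap complex.
From mathcomp Require Import all_classical all_reals all_analysis.

Set Implicit Arguments.
Unset Strict Implicit.
Unset Printing Implicit Defensive.

Import Order.TTheory GRing.Theory Num.Theory numFieldNormedType.Exports.

Local Open Scope classical_set_scope.
Local Open Scope ring_scope.
Local Open Scope complex_scope.

(* A CW-complex of dimension at most 1 with countably many 0-cells: [tg_vertex]
   is the set of 0-cells and [tg_map e], restricted to [0, 1], the
   characteristic map of the 1-cell with label [e]; its values outside [0, 1]
   are irrelevant.  Closure-finiteness is automatic in dimension 1. *)
Record topological_graph (R : realType) := TopologicalGraph {
  tg_space :> topologicalType ;
  tg_edge : choiceType ;
  tg_vertex : set tg_space ;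
  tg_map : tg_edge -> R -> tg_space ;
  tg_hausdorff : hausdorff_space tg_space ;
  tg_countable : countable tg_vertex ;
  tg_continuous : forall e, {within `[0, 1], continuous (tg_map e)} ;
  tg_injective : forall e, set_inj `]0, 1[ (tg_map e) ;
  tg_open_map : forall e (U : set R), open U -> U `<=` `]0, 1[ ->
    exists2 W : set tg_space, open W &
      tg_map e @` U = W `&` tg_map e @` `]0, 1[ ;
  tg_ends : forall e, tg_vertex (tg_map e 0) /\ tg_vertex (tg_map e 1) ;
  tg_cover : forall x, tg_vertex x \/ exists e, (tg_map e @` `]0, 1[) x ;
  tg_disjoint_vertex : forall e,
    tg_map e @` `]0, 1[ `&` tg_vertex = set0 ;
  tg_disjoint_edge : forall e e', e <> e' ->
    tg_map e @` `]0, 1[ `&` tg_map e' @` `]0, 1[ = set0 ;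
  (* the topology is the weak one *)
  tg_weak : forall A : set tg_space,
    (forall e, closed (`[0, 1] `&` tg_map e @^-1` A)) -> closed A
}.

Section graph.
Variables (R : realType) (X : topological_graph R).
Implicit Types (v : X) (e : tg_edge X) (La : set X).

Definition edges_in v : set (tg_edge X) := [set e | tg_map e 1 = v].
Definition edges_out v : set (tg_edge X) := [set e | tg_map e 0 = v].

(* A loop is counted twice.  [fset_set] is only meaningful on finite sets. *)
Definition degree_le (d : nat) v :=
  [/\ finite_set (edges_in v), finite_set (edges_out v) &
      (#|` fset_set (edges_in v)| + #|` fset_set (edges_out v)| <= d)%N].

(* CW-subcomplexes: unions of cells containing the closure of each of their
   cells. *)
Definition subgraph La := forall e,
  (tg_map e @` `]0, 1[ `&` La) !=set0 -> tg_map e @` `[0, 1] `<=` La.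

Definition sub_edges La : set (tg_edge X) :=
  [set e | tg_map e @` `[0, 1] `<=` La].

Definition sub_vertices La : set X := La `&` @tg_vertex _ X.

Definition boundary La : set X := La `&` closure (~` La).

End graph.

(* Hilbert space notions for the space of classes, modulo the null vectors of
   the semi-inner product [ip], of the elements of [L].  Operators act on
   representatives, and unbounded operators are given by their graphs. *)
Section hilbert.
Variables (R : realType) (H : lmodType R[i]).
Variables (L : set H) (ip : H -> H -> R[i]).

Definition null_vector (f : H) := ip f f = 0.

Definition orthogonal_projection (P : H -> H) :=
  [/\ forall f, L f -> L (P f),
      forall a f g, L f -> L g ->
        null_vector (P (a *: f + g) - (a *: P f + P g)),
      forall f, L f -> null_vector (P (P f) - P f) &
      forall f g, L f -> L g -> ip (P f) g = ip f (P g)].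

(* [E] is the projection-valued measure with A = \int x dE(x): with
   mu_f = <E(.) f, f>, the domain of A consists of the f with
   \int x^2 dmu_f < +oo, and <A f, f> = \int x dmu_f on it (which determines A
   by polarization).  That E is countably additive is expressed by mu_f being a
   measure. *)
Definition spectral_resolution (A : set (H * H)) (E : set R -> H -> H) :=
  [/\ forall B : set (measurableTypeR R), measurable B ->
        orthogonal_projection (E B),
      forall f, L f -> null_vector (E setT f - f) &
      exists mu : H -> {measure set (measurableTypeR R) -> \bar R},
        [/\ forall f B, L f -> measurable B ->
              mu f B = (complex.Re (ip (E B f) f))%:E,
            forall f, L f ->
              ((exists g, A (f, g)) <->
               (mu f).-integrable setT (fun x => (x ^+ 2)%:E)) &
            forall f g, A (f, g) -> ip g f = (\int[mu f]_x x)%:C]].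

(* P(I); by the spectral theorem a self-adjoint [A] has one and only one
   spectral resolution (modulo null vectors). *)
Definition spectral_projection (A : set (H * H)) (I : set R) : H -> H :=
  xget (fun _ _ => 0) [set E | spectral_resolution A E] I.

Definition orthonormal_basis (B : set H) :=
  [/\ B `<=` L,
      forall phi, B phi -> ip phi phi = 1,
      forall phi psi, B phi -> B psi -> phi <> psi -> ip phi psi = 0 &
      forall f, L f -> (forall phi, B phi -> ip f phi = 0) -> null_vector f].

(* Trace of a nonnegative operator, which does not depend on the choice of the
   orthonormal basis. *)
Definition trace (T : H -> H) : \bar R :=
  (\esum_(phi in xget set0 [set B | orthonormal_basis B])
     (complex.Re (ip (T phi) phi))%:E)%E.

End hilbert.

Section interval_functions.
Variable R : realType.
Implicit Types (l : R) (f g : R -> R[i]).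
Notation mu := (@lebesgue_measure R).

Definition square_integrable l f :=
  [/\ measurable_fun `[0, l] (fun x => complex.Re (f x)),
      measurable_fun `[0, l] (fun x => complex.Im (f x)) &
      mu.-integrable `[0, l]
        (fun x => (complex.Re (f x) ^+ 2 + complex.Im (f x) ^+ 2)%:E)].

Definition cintegral l f : R[i] :=
  (\int[mu]_(x in `[0%R, l]) complex.Re (f x)) +i*
  (\int[mu]_(x in `[0%R, l]) complex.Im (f x)).

Definition primitive l f g :=
  forall x, 0 <= x <= l -> f x = f 0 + cintegral x g.

(* The class of [f] is in H^2([0, l]): [f0] is its continuous representative,
   [f1] the absolutely continuous representative of f', and [f2] in L_2([0, l])
   represents f''. *)
Definition H2_derivatives l f (f0 f1 f2 : R -> R[i]) :=
  [/\ {ae mu, forall x, 0 <= x <= l -> f x = f0 x},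
      primitive l f0 f1, primitive l f1 f2 & square_integrable l f2].

End interval_functions.

Section laplacian.
Variables (R : realType) (X : topological_graph R).
Variables (La : set X) (len : tg_edge X -> R).

(* Only the values on [0, len e] for edges e of the subgraph matter. *)
Local Notation edge_functions := (tg_edge X -> R -> R[i]^o).

Implicit Types f g : edge_functions.

Definition L2 : set edge_functions :=
  [set f | forall e, sub_edges La e -> square_integrable (len e) (f e)].

Definition L2_inner f g : R[i] :=
  \sum_(e \in sub_edges La) cintegral (len e) (fun x => f e x * (g e x)^*).

(* [f0] and [f1] are the continuous representatives of f and f'. *)
Definition dirichlet_at (v : X) (f0 : edge_functions) :=
  forall e, sub_edges La e ->
    (edges_in v e -> f0 e (len e) = 0) /\ (edges_out v e -> f0 e 0 = 0).

Definition kirchhoff_at (v : X) (f0 f1 : edge_functions) :=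
  (exists c, (forall e, edges_in v e -> f0 e (len e) = c) /\
             (forall e, edges_out v e -> f0 e 0 = c)) /\
  \sum_(e \in edges_in v) f1 e (len e) - \sum_(e \in edges_out v) f1 e 0 = 0.

Definition dirichlet_laplacian : set (edge_functions * edge_functions) :=
  [set fg | L2 fg.1 /\ L2 fg.2 /\ exists f0 f1 : edge_functions,
    [/\ forall e, sub_edges La e ->
          H2_derivatives (len e) (fg.1 e) (f0 e) (f1 e) (fun x => - fg.2 e x),
        forall v, (sub_vertices La `&` boundary La) v -> dirichlet_at v f0 &
        forall v, (sub_vertices La `\` boundary La) v ->
          kirchhoff_at v f0 f1]].

(* tr P(I) for the Laplacian with Dirichlet conditions on the boundary *)
Definition trace_spectral_projection (I : set R) : \bar R :=
  trace L2 L2_inner (spectral_projection L2 L2_inner dirichlet_laplacian I).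

End laplacian.

Section random_lengths.
Variables (R : realType) (E : choiceType).

Definition cylinders : set (set (E -> R)) :=
  [set A | exists e (B : set (measurableTypeR R)),
     measurable B /\ A = [set w | B (w e)]].

(* R^E with its product sigma-algebra *)
Definition length_space := g_sigma_algebraType cylinders.

Definition admissible_lengths (lmin lmax : R) : set length_space :=
  [set w | forall e, lmin <= w e <= lmax].

Definition product_measure
    (law : E -> probability (measurableTypeR R) R)
    (P : probability length_space R) :=
  forall (F : seq E) (B : E -> set (measurableTypeR R)), uniq F ->
    (forall e, measurable (B e)) ->
    P [set w | forall e, e \in F -> B e (w e)] =
    (\prod_(e <- F) law e (B e))%E.

Definition C1 (h : R -> R) :=
  (forall x, derivable h x 1) /\ continuous (derive1 h).

(* The measures on [lmin, lmax] are viewed as measures on R, so that the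
   product measure lives on R^E and is concentrated on
   [admissible_lengths lmin lmax]. *)
Definition random_lengths (lmin lmax Ch : R)
    (law : E -> probability (measurableTypeR R) R) (h : E -> R -> R)
    (P : probability length_space R) :=
  [/\ forall e, law e `[lmin, lmax]%classic = 1%E,
      forall e, (forall x, 0 <= h e x) /\ forall B, measurable B ->
        law e B = (\int[@lebesgue_measure R]_(x in B) (h e x)%:E)%E,
      forall e, C1 (h e),
      forall e x, `|h e x| <= Ch /\ `|derive1 (h e) x| <= Ch &
      product_measure law P].

End random_lengths.

(* Main.v *)
(* Rescale every edge to [0, 1].  By the min-max principle, the number N(eta) of
   eigenvalues below a of the Laplacian with edge lengths w is the largest
   dimension of a space of test functions on which
   sum_e (|f_e'|^2 / eta_e - eta_e |f_e|^2) is negative definite, where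
   eta = sqrt(a) w: the space of test functions does not depend on w, and the
   energy enters only through a dilation of the lengths.  Hence there are at most
   N(t eta) - N(eta) eigenvalues in [a, b] as soon as t^2 > b / a, and this
   difference is telescoped by stretching one edge at a time.

   N is monotone in each length.  A function vanishing at the points k / M of an
   edge e with eta_e <= M has a nonnegative form on e and may be replaced by 0
   there; therefore changing eta_e alone changes N by at most 2 (M + 1).  For
   given other lengths and a given n, the lengths x of e such that N >= n holds
   for t x but not for x are within a factor t of each other, so that this event
   has probability O(t - 1); only 2 (M + 1) values of n contribute.

   The existence of spectral resolutions is never needed: traces vanish by
   convention in their absence, and the integral is a lower integral. *)
Require Import Defs.
From HB Require Import structures.
From mathcomp Require Import all_boot all_order all_algebra.
From mathcomp Require Import finmap complex ring lra zify.
From mathcomp Require Import all_classical all_reals all_analysis.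
From mathcomp Require Import measurable_realfun.

Set Implicit Arguments.
Unset Strict Implicit.
Unset Printing Implicit Defensive.

Import Order.TTheory GRing.Theory Num.Theory numFieldNormedType.Exports.

Local Open Scope classical_set_scope.
Local Open Scope ring_scope.

(** * Real semi-inner product spaces *)

(** All that is known of P(I) is [spectral_resolution]: projections whose diagonal forms are
    measures, and the diagonal of the operator. Orthogonality of disjoint spectral ranges,
    multiplicativity and one half of the min-max principle are therefore derived from these data by
    polarization. The half in question: if the form at level a has m negative dimensions and a
    partial trace of the projection onto [a, b] is positive, some n at least as large as this
    partial trace gives m + n negative dimensions at every level above b. Operators act on
    representatives, so identities hold modulo null vectors only; they are stated as equalities of
    [s _ k] for [k] in [L], and Cauchy-Schwarz turns null differences into such equalities. The
    scalar product is Re <f, g> on the underlying real space: a complex orthonormal family stays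
    orthonormal, and counting real dimensions can only enlarge an upper bound. Levels above b are
    needed strictly, so the dilation exceeds b / a by a small amount that is absorbed at the very
    end. *)

Record semi_inner (R : realType) (V : lmodType R) (L : set V)
    (s : V -> V -> R) : Prop := SemiInner {
  si0 : L 0 ;
  siP : forall a f g, L f -> L g -> L (a *: f + g) ;
  siC : forall f g, L f -> L g -> s f g = s g f ;
  siDl : forall a f g k, L f -> L g -> L k ->
    s (a *: f + g) k = a * s f k + s g k ;
  si_ge0 : forall f, L f -> 0 <= s f f
}.

Section semi_inner_theory.
Variables (R : realType) (V : lmodType R) (L : set V) (s : V -> V -> R).
Hypothesis sL : semi_inner L s.
Implicit Types (f g k : V) (a : R).

Lemma siZ a f : L f -> L (a *: f).
Proof. by move=> Lf; rewrite -[_ *: _]addr0; apply: (siP sL) => //; exact: si0 sL. Qed.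

Lemma siD f g : L f -> L g -> L (f + g).
Proof. by move=> Lf Lg; rewrite -[f]scale1r; by apply: (siP sL). Qed.

Lemma siN f : L f -> L (- f).
Proof. by move=> Lf; rewrite -scaleN1r; exact: siZ. Qed.

Lemma siB f g : L f -> L g -> L (f - g).
Proof. by move=> Lf Lg; apply: siD => //; exact: siN. Qed.

Lemma si_sum (I : Type) (r : seq I) (P : pred I) (F : I -> V) :
  (forall i, P i -> L (F i)) -> L (\sum_(i <- r | P i) F i).
Proof. by move=> LF; apply: (big_ind L) => //; [exact: si0 sL | exact: siD]. Qed.

Lemma s0l g : L g -> s 0 g = 0.
Proof.
move=> Lg; have L0 := si0 sL.
have := siDl sL (-1) L0 L0 Lg; rewrite scaler0 addr0; lra.
Qed.

Lemma sZl a f g : L f -> L g -> s (a *: f) g = a * s f g.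
Proof.
move=> Lf Lg; rewrite -[_ *: _]addr0 (siDl sL) ?s0l ?addr0//; exact: si0 sL.
Qed.

Lemma sDl f g k : L f -> L g -> L k -> s (f + g) k = s f k + s g k.
Proof. by move=> Lf Lg Lk; rewrite -{1}[f]scale1r (siDl sL)// mul1r. Qed.

Lemma sNl f g : L f -> L g -> s (- f) g = - s f g.
Proof. by move=> Lf Lg; rewrite -scaleN1r sZl// mulN1r. Qed.

Lemma sBl f g k : L f -> L g -> L k -> s (f - g) k = s f k - s g k.
Proof. by move=> Lf Lg Lk; rewrite sDl ?sNl//; exact: siN. Qed.

Lemma s0r g : L g -> s g 0 = 0.
Proof. by move=> Lg; rewrite (siC sL) ?s0l//; exact: si0 sL. Qed.

Lemma sZr a f g : L f -> L g -> s f (a *: g) = a * s f g.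
Proof. by move=> Lf Lg; rewrite (siC sL) ?sZl ?(siC sL Lf Lg)//; exact: siZ. Qed.

Lemma sDr f g k : L f -> L g -> L k -> s k (f + g) = s k f + s k g.
Proof.
move=> Lf Lg Lk; rewrite (siC sL) ?sDl ?(siC sL Lk)//; exact: siD.
Qed.

Lemma sBr f g k : L f -> L g -> L k -> s k (f - g) = s k f - s k g.
Proof.
move=> Lf Lg Lk; rewrite (siC sL) ?sBl ?(siC sL Lk)//; exact: siB.
Qed.

Lemma s_suml (I : Type) (r : seq I) (F : I -> V) k :
  L k -> (forall i, L (F i)) -> s (\sum_(i <- r) F i) k = \sum_(i <- r) s (F i) k.
Proof.
move=> Lk LF; elim: r => [|i r IH]; first by rewrite !big_nil s0l.
by rewrite !big_cons sDl ?IH//; exact: si_sum.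
Qed.

Lemma s_sumr (I : Type) (r : seq I) (F : I -> V) k :
  L k -> (forall i, L (F i)) -> s k (\sum_(i <- r) F i) = \sum_(i <- r) s k (F i).
Proof.
move=> Lk LF; rewrite (siC sL) ?s_suml//; last exact: si_sum.
by apply: eq_bigr => i _; rewrite (siC sL).
Qed.

Lemma cauchy_schwarz f g : L f -> L g -> s f g ^+ 2 <= s f f * s g g.
Proof.
move=> Lf Lg.
have expand a : 0 <= s f f - 2 * a * s f g + a ^+ 2 * s g g.
  have Lag := siZ a Lg.
  have := si_ge0 sL (siB Lf Lag).
  rewrite sBl ?sBr ?sZl ?sZr//; last exact: siB.
  by rewrite (siC sL Lg Lf); lra.
have g0 := si_ge0 sL Lg; have f0 := si_ge0 sL Lf.
have [gz|gz] := eqVneq (s g g) 0.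
  rewrite gz mulr0; have [->|fgz] := eqVneq (s f g) 0; first by rewrite expr0n.
  (* If [g] is null the expansion is affine in [a], and this [a] gives it the value -1. *)
  have := expand ((s f f + 1) / (2 * s f g)); rewrite gz mulr0 addr0.
  have -> : 2 * ((s f f + 1) / (2 * s f g)) * s f g = s f f + 1 by field.
  lra.
have := expand (s f g / s g g).
have -> : s f f - 2 * (s f g / s g g) * s f g + (s f g / s g g) ^+ 2 * s g g
   = s f f - s f g ^+ 2 / s g g by field.
by rewrite subr_ge0 ler_pdivrMr// lt_neqAle eq_sym gz.
Qed.

Lemma s_null f g : L f -> L g -> s f f = 0 -> s f g = 0.
Proof.
move=> Lf Lg f0; apply/eqP; rewrite -sqrf_eq0 eq_le sqr_ge0 andbT.
by rewrite (le_trans (cauchy_schwarz Lf Lg))// f0 mul0r.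
Qed.

Lemma s_equiv f g k : L f -> L g -> L k -> s (f - g) (f - g) = 0 -> s f k = s g k.
Proof.
move=> Lf Lg Lk fg0; apply/eqP; rewrite -subr_eq0 -sBl//.
by rewrite s_null//; exact: siB.
Qed.

Lemma bessel (r : seq V) g : L g -> (forall x, x \in r -> L x) -> uniq r ->
  (forall x, x \in r -> s x x = 1) ->
  (forall x y, x \in r -> y \in r -> x <> y -> s x y = 0) ->
  \sum_(x <- r) s x g ^+ 2 <= s g g.
Proof.
move=> Lg Lr ur r1 r0.
(* The guard keeps [F x] in [L] for every [x], as [s_suml] and [s_sumr] demand. *)
pose F x := if x \in r then s x g *: x else 0.
have LF x : L (F x).
  by rewrite /F; case: ifPn => [xr|_]; [apply: siZ; exact: Lr | exact: si0 sL].
have Fr x : x \in r -> F x = s x g *: x by rewrite /F => ->.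
pose y := \sum_(x <- r) F x.
have Ly : L y by exact: si_sum.
have gy : s g y = \sum_(x <- r) s x g ^+ 2.
  rewrite s_sumr//; apply: eq_big_seq => x xr.
  by rewrite Fr// sZr ?(siC sL Lg) ?expr2//; exact: Lr.
have yy : s y y = \sum_(x <- r) s x g ^+ 2.
  rewrite {1}/y s_suml//; apply: eq_big_seq => x xr; rewrite s_sumr//.
  have Lx := Lr _ xr; rewrite (bigD1_seq x)//=.
  rewrite big_seq_cond big1 ?addr0 => [|z /andP[zr /eqP zx]].
    by rewrite Fr// (sZl _ Lx (siZ _ Lx)) (sZr _ Lx Lx) r1// mulr1 expr2.
  have Lz := Lr _ zr.
  by rewrite !Fr// (sZl _ Lx (siZ _ Lz)) (sZr _ Lx Lz) (r0 _ _ xr zr (nesym zx)) !mulr0.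
have := si_ge0 sL (siB Lg Ly).
rewrite sBl ?sBr//; last exact: siB.
by rewrite gy yy (siC sL Ly Lg) gy; lra.
Qed.

(* The orthonormal family spans [r] modulo null vectors; an inequality is kept
   since it survives the addition of new vectors. *)
Lemma gram_schmidt (M : set V) (r : seq V) : M `<=` L -> M 0 ->
  (forall a f g, M f -> M g -> M (a *: f + g)) -> (forall x, x \in r -> M x) ->
  exists n (psi : 'I_n -> V), [/\ forall i, M (psi i),
    forall i j, s (psi i) (psi j) = (i == j)%:R &
    forall x, x \in r -> s x x <= \sum_i s x (psi i) ^+ 2].
Proof.
move=> ML M0 Mlin; elim: r => [|x r IH] Mr.
  exists 0, (fun _ => 0); split => // [[]//].
have [|n [psi [Mpsi opsi bpsi]]] := IH.
  by move=> y yr; apply: Mr; rewrite inE yr orbT.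
have Mx : M x by apply: Mr; rewrite inE eqxx.
have Lx := ML _ Mx; have Lpsi i := ML _ (Mpsi i).
pose z := \sum_i s x (psi i) *: psi i.
have Mz : M z.
  apply: (big_ind M) => //.
    by move=> f g Mf Mg; rewrite -[f]scale1r; exact: Mlin.
  by move=> i _; rewrite -[_ *: _]addr0; exact: Mlin.
have Lz := ML _ Mz.
pose y := x - z.
have My : M y by rewrite /y addrC -scaleN1r; exact: Mlin.
have Ly := ML _ My.
have zpsi i : s z (psi i) = s x (psi i).
  rewrite s_suml//; last by move=> j; exact: siZ.
  rewrite (bigD1 i)//= sZl// opsi eqxx mulr1 big1 ?addr0// => j /negPf ji.
  by rewrite sZl// opsi ji mulr0.
have ypsi i : s y (psi i) = 0 by rewrite sBl// zpsi subrr.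
have sxz : s x z = \sum_i s x (psi i) ^+ 2.
  rewrite s_sumr//; last by move=> j; exact: siZ.
  by apply: eq_bigr => i _; rewrite sZr// expr2.
have yz : s y z = 0.
  rewrite s_sumr//; last by move=> j; exact: siZ.
  by rewrite big1// => i _; rewrite sZr// ypsi mulr0.
have xy : s x y = s y y by have := sBr Lx Lz Ly; rewrite -/y yz subr0 (siC sL Ly Lx) => ->.
have xx : s x x = s y y + \sum_i s x (psi i) ^+ 2.
  by rewrite -sxz -xy -sDr// subrK.
have [y0|y0] := eqVneq (s y y) 0.
  exists n, psi; split => // x'; rewrite inE => /predU1P[->|/bpsi//].
  by rewrite xx y0 add0r.
have y_gt0 : 0 < s y y by rewrite lt_neqAle eq_sym y0; exact: (si_ge0 sL).
pose c := Num.sqrt (s y y).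
have c0 : c != 0 by rewrite sqrtr_eq0 -ltNge.
have cc : c ^+ 2 = s y y by rewrite sqr_sqrtr// ltW.
pose psi' (i : 'I_n.+1) := oapp psi (c^-1 *: y) (unlift ord0 i).
have Lcy : L (c^-1 *: y) by exact: siZ.
exists n.+1, psi'; split.
- move=> i; rewrite /psi'; case: unliftP => [j _|_] //=.
  by rewrite -[_ *: _]addr0; exact: Mlin.
- move=> i j; rewrite /psi'.
  case: (unliftP ord0 i) => [i' ->|->]; case: (unliftP ord0 j) => [j' ->|->] /=.
  + by rewrite opsi (inj_eq lift_inj).
  + by rewrite sZr// (siC sL)// ypsi mulr0.
  + by rewrite sZl// ypsi mulr0.
  + by rewrite sZl// sZr// -cc; field.
- move=> x' x'r; rewrite big_ord_recl /psi' unlift_none /=.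
  under eq_bigr do rewrite liftK /=.
  move: x'r; rewrite inE => /predU1P[->|/bpsi]; last first.
    by move=> /le_trans; apply; rewrite ler_wpDl// sqr_ge0.
  rewrite sZr// xy; have -> : (c^-1 * s y y) ^+ 2 = s y y by rewrite -cc; field.
  by rewrite xx.
Qed.

(** Take for [psi] a Gram-Schmidt family of the vectors [P x], inside the range of [P]. Then
    [s (P x) x = s (P x) (P x)] is at most the sum over [i] of [s x (psi i) ^+ 2]; after exchanging
    the sums, Bessel's inequality for the orthonormal family [r] bounds the contribution of each
    [psi i] by 1. *)
Lemma trace_le_rank (P : V -> V) (r : seq V) :
  (forall f, L f -> L (P f)) ->
  (forall a f g k, L f -> L g -> L k -> s (P (a *: f + g)) k = a * s (P f) k + s (P g) k) ->
  (forall f k, L f -> L k -> s (P (P f)) k = s (P f) k) ->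
  (forall f g, L f -> L g -> s (P f) g = s f (P g)) ->
  (forall x, x \in r -> L x) -> uniq r ->
  (forall x, x \in r -> s x x = 1) ->
  (forall x y, x \in r -> y \in r -> x <> y -> s x y = 0) ->
  exists n (psi : 'I_n -> V), [/\ forall i, L (psi i),
    forall i j, s (P (psi i)) (P (psi j)) = (i == j)%:R &
    \sum_(x <- r) s (P x) x <= n%:R].
Proof.
move=> LP Plin Pidem Psym Lr ur r1 r0.
pose M : set V := [set f | L f /\ forall k, L k -> s (P f) k = s f k].
have L0 := si0 sL.
have [||||n [psi [Mpsi opsi bpsi]]] := @gram_schmidt M (map P r).
- by move=> f [].
- split => // k Lk; have := Plin 1 0 0 k L0 L0 Lk.
  by rewrite scaler0 addr0 mul1r s0l//; lra.
- move=> a f g [Lf Pf] [Lg Pg]; split; first by apply: (siP sL).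
  by move=> k Lk; rewrite Plin// Pf// Pg// (siDl sL).
- move=> _ /mapP[x xr ->]; split; first by apply: LP; exact: Lr.
  by move=> k Lk; rewrite Pidem//; exact: Lr.
have Lpsi i : L (psi i) by have [] := Mpsi i.
exists n, psi; split => //.
  move=> i j; have [_ ->] := Mpsi i; last exact: LP.
  by rewrite -Psym//; have [_ ->] := Mpsi i => //; exact: opsi.
have -> : n%:R = \sum_(i < n) (1 : R) by rewrite sumr_const card_ord.
apply: (@le_trans _ _ (\sum_(x <- r) \sum_i s x (psi i) ^+ 2)).
  rewrite big_seq [leRHS]big_seq; apply: ler_sum => x xr.
  have Lx := Lr _ xr.
  rewrite -Pidem// Psym//; last exact: LP.
  apply: (le_trans (bpsi (P x) _)); first exact: map_f.
  apply: ler_sum => i _; rewrite Psym// (siC sL) ?LP//.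
  by have [_ ->] := Mpsi i => //; rewrite (siC sL).
  by apply: LP.
rewrite exchange_big; apply: ler_sum => i _ /=.
by rewrite (le_trans (bessel _ _ _ _ _))// opsi eqxx.
Qed.

End semi_inner_theory.

(** * Spectral calculus *)

Section finite_measures_on_the_line.
Variable R : realType.
Implicit Types (nu : {measure set (measurableTypeR R) -> \bar R}) (a b : R).

Lemma measurableTypeR_itv a b : measurable (`[a, b]%classic : set (measurableTypeR R)).
Proof. exact: measurable_itv. Qed.

Lemma supported_integrable nu a b (f : measurableTypeR R -> R) :
  (nu setT < +oo)%E -> nu (~` `[a, b]%classic) = 0%E ->
  measurable_fun setT f -> [bounded f x | x in `[a, b]%classic] ->
  nu.-integrable setT (EFin \o f).
Proof.
move=> nufin nu0 mf bf.
have mI := measurableTypeR_itv a b.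
have mC := measurableC mI.
apply/(negligible_integrable mC measurableT _ nu0); first by exact/measurable_EFinP.
rewrite setTD setCK; apply: measurable_bounded_integrable => //.
  by rewrite (le_lt_trans _ nufin)// le_measure// inE.
exact: measurable_funS mf.
Qed.

Lemma itv_bounded_id a b : [bounded (x : R) | x in `[a, b]%classic].
Proof.
exists (`|a| + `|b|); split; first by rewrite num_real.
move=> M abM x /=; rewrite in_itv/= => /andP[ax xb].
rewrite (le_trans _ (ltW abM))// ler_norml opprD; apply/andP; split.
  by have := ler_norm (- a); have := normr_ge0 b; rewrite normrN; lra.
by have := ler_norm b; have := normr_ge0 a; lra.
Qed.

Lemma supported_Rintegral nu a b :
  (nu setT < +oo)%E -> nu (~` `[a, b]%classic) = 0%E ->
  [/\ nu.-integrable setT (fun x => (x ^+ 2)%:E),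
      nu.-integrable setT (EFin \o id) &
      a * fine (nu setT) <= \int[nu]_x x <= b * fine (nu setT)].
Proof.
move=> nufin nu0.
have mI := measurableTypeR_itv a b.
have mid : measurable_fun setT (id : measurableTypeR R -> R) by exact: measurable_id.
have iid : nu.-integrable setT (EFin \o (id : measurableTypeR R -> R)).
  apply: supported_integrable nufin nu0 mid _; exact: itv_bounded_id.
split => //.
  apply: (@supported_integrable nu a b (fun x => x ^+ 2)) nufin nu0 _ _.
    exact: measurable_funX.
  have [M [_ bM]] := itv_bounded_id a b.
  exists ((`|M| + 1) ^+ 2); split; first by rewrite num_real.
  move=> N hN x /= xab; rewrite (le_trans _ (ltW hN))// normrX.
  rewrite ler_pXn2r ?nnegrE ?addr_ge0//.
  apply: (bM (`|M| + 1)) => //; by rewrite (le_lt_trans (ler_norm M))// ltrDl.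
have nuI : nu `[a, b]%classic = nu setT.
  have := measureU nu mI (measurableC mI) (setICr _).
  by rewrite setUv [X in (_ + X)%E]nu0 adde0 => ->.
have -> : \int[nu]_x x = \int[nu]_(x in `[a, b]%classic) x.
  by rewrite /Rintegral (negligible_integral (measurableC mI) measurableT iid nu0) setTD setCK.
rewrite -nuI -!Rintegral_cst//.
have icst c : nu.-integrable `[a, b]%classic (EFin \o (fun=> c)).
  apply: measurable_bounded_integrable => //; last exact: bounded_cst.
  by rewrite nuI.
have iab : nu.-integrable `[a, b]%classic (EFin \o id).
  exact: integrableS iid.
apply/andP; split; apply: le_Rintegral => // x /=; rewrite in_itv/= => /andP[]//.
Qed.

Lemma finite_measure_tail nu (e : R) : (nu setT < +oo)%E -> 0 < e ->
  exists n : nat, (nu (~` `[(- n%:R)%R, n%:R%R]%classic) < e%:E)%E.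
Proof.
move=> nufin e0.
pose F (n : nat) : set (measurableTypeR R) := ~` `[- n%:R, n%:R]%classic.
have mF n : measurable (F n) by apply: measurableC; exact: measurableTypeR_itv.
have capF : \bigcap_n F n = set0.
  apply/seteqP; split => // x Fx.
  pose n := Num.bound `|x|; have hn : `|x| < n%:R by exact: archi_boundP.
  apply: (Fx n I); rewrite /= in_itv/= -ler_norml.
  exact: ltW.
have nufinF : (nu (F 0%N) < +oo)%E by rewrite (le_lt_trans _ nufin)// le_measure ?inE.
have niF : nonincreasing_seq F.
  move=> m n mn; apply/subsetPset => x Fnx Fmx; apply: Fnx.
  move: Fmx; rewrite /= !in_itv/= => /andP[xm xM].
  have mn' : m%:R <= n%:R :> R by rewrite ler_nat.
  by apply/andP; split; lra.
have mcap : measurable (\bigcap_n F n) by rewrite capF.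
have := nonincreasing_cvg_mu nufinF mF mcap niF.
rewrite capF measure0 => cv.
have /cv : nbhs (0 : \bar R) [set y | (y < e%:E)%E].
  by apply: open_nbhs_nbhs; split; [exact: open_ereal_lt_ereal | rewrite /= lte_fin].
by case=> N _ /(_ N (leqnn N)) ?; exists N.
Qed.

End finite_measures_on_the_line.

(* What [spectral_resolution] says about the real inner product Re <f, g>, with
   equalities modulo null vectors tested against the vectors of [L]. *)
Record real_resolution (R : realType) (V : lmodType R) (L : set V)
    (s : V -> V -> R) (A : set (V * V)) (E : set (measurableTypeR R) -> V -> V)
    (mu : V -> {measure set (measurableTypeR R) -> \bar R}) : Prop :=
  RealResolution {
  rrA : forall f g, A (f, g) -> L f /\ L g ;
  rrAP : forall a f g f' g', A (f, g) -> A (f', g') ->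
    A (a *: f + f', a *: g + g') ;
  rrE : forall B f, measurable B -> L f -> L (E B f) ;
  rrElin : forall B a f g k, measurable B -> L f -> L g -> L k ->
    s (E B (a *: f + g)) k = a * s (E B f) k + s (E B g) k ;
  rrEid : forall B f k, measurable B -> L f -> L k ->
    s (E B (E B f)) k = s (E B f) k ;
  rrEsym : forall B f g, measurable B -> L f -> L g ->
    s (E B f) g = s f (E B g) ;
  rrET : forall f k, L f -> L k -> s (E setT f) k = s f k ;
  rrmu : forall f B, L f -> measurable B -> mu f B = (s (E B f) f)%:E ;
  rrdom : forall f, L f ->
    (mu f).-integrable setT (fun x => (x ^+ 2)%:E) -> exists g, A (f, g) ;
  rrint : forall f g, A (f, g) -> s g f = \int[mu f]_x x
}.

Section spectral_calculus.
Variables (R : realType) (V : lmodType R) (L : set V) (s : V -> V -> R).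
Hypothesis sL : semi_inner L s.
Variables (A : set (V * V)) (E : set (measurableTypeR R) -> V -> V).
Variable (mu : V -> {measure set (measurableTypeR R) -> \bar R}).
Hypothesis rr : real_resolution L s A E mu.
Implicit Types (B C : set (measurableTypeR R)) (f g k : V).

Let LE B f := rrE rr (B := B) (f := f).

Lemma rr_contract B f : measurable B -> L f -> s (E B f) f = s (E B f) (E B f).
Proof.
by move=> mB Lf; rewrite -(rrEsym rr)//; [rewrite (rrEid rr) | exact: LE].
Qed.

(** Additivity is only given on the diagonal, where [mu] is a measure; polarization extends it. *)
Lemma rr_add B C f g : measurable B -> measurable C -> [disjoint B & C] ->
  L f -> L g -> s (E (B `|` C) f) g = s (E B f) g + s (E C f) g.
Proof.
move=> mB mC /disj_setPS BC0 Lf Lg.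
have dBC : B `&` C = set0 by apply/seteqP; split.
have mBC : measurable (B `|` C) by exact: measurableU.
have addm k : L k -> s (E (B `|` C) k) k = s (E B k) k + s (E C k) k.
  move=> Lk; apply: EFin_inj; rewrite EFinD -!(rrmu rr)//.
  exact: measureU.
have polar D : measurable D -> s (E D (1 *: f + g)) (1 *: f + g) =
    s (E D f) f + s (E D g) g + 2 * s (E D f) g.
  move=> mD; rewrite (rrElin rr) ?scale1r//; last exact: siD sL _ _ _ _.
  rewrite !(sDr sL)//; try by exact: LE.
  rewrite (rrEsym rr mD Lg Lf) (siC sL Lg (LE mD Lf)); lra.
have Lfg : L (1 *: f + g) by apply: (siP sL).
have := addm _ Lfg; rewrite !polar// !addm//; lra.
Qed.

(** For x = E(C) f the projection E(C) already exhausts the norm of x, and that of E(B u C) cannot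
    exceed it. By additivity the share of E(B) is nonpositive, so E(B) x is null. *)
Lemma rr_disjoint B C f g : measurable B -> measurable C -> [disjoint B & C] ->
  L f -> L g -> s (E B (E C f)) g = 0.
Proof.
move=> mB mC BC Lf Lg.
set x := E C f; have Lx : L x by exact: LE.
have mBC : measurable (B `|` C) by exact: measurableU.
have LEBx : L (E B x) by exact: LE.
apply: (s_null sL) => //.
have eC : s (E C x) x = s x x by rewrite (rrEid rr).
have eBC := rr_add mB mC BC Lx Lx.
have le1 : s (E (B `|` C) x) x <= s x x.
  have LEx : L (E (B `|` C) x) by exact: LE.
  have := si_ge0 sL (siB sL Lx LEx).
  rewrite (sBl sL) ?(sBr sL)//; last exact: siB sL _ _ _ _.
  by rewrite (siC sL Lx LEx) -!rr_contract//; lra.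
have := si_ge0 sL LEBx; rewrite -rr_contract//; lra.
Qed.

Lemma rr_split B C f g : measurable B -> measurable C -> L f -> L g ->
  s (E B f) g = s (E (B `&` C) f) g + s (E (B `\` C) f) g.
Proof.
move=> mB mC Lf Lg; rewrite -rr_add ?setUIDK//; last 1 first.
- by apply/disj_setPS => x [[_ Cx] [_]].
- exact: measurableI.
- exact: measurableD.
Qed.

Lemma rr_mul B C f g : measurable B -> measurable C -> L f -> L g ->
  s (E B (E C f)) g = s (E (B `&` C) f) g.
Proof.
move=> mB mC Lf Lg.
have mI := measurableI _ _ mB mC.
have mD := measurableD mC mB. have mD' := measurableD mB mC.
have LIf := LE mI Lf; have LIg := LE mI Lg; have LBg := LE mB Lg.
have LDf := LE mD Lf; have LDg := LE mD' Lg.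
rewrite (rrEsym rr mB (LE mC Lf) Lg) (rr_split mC mB Lf LBg).
have -> : s (E (C `\` B) f) (E B g) = 0.
  rewrite (rrEsym rr mD Lf LBg) (siC sL Lf (LE mD LBg)) rr_disjoint//.
  by apply/disj_setPS => x [[_ nBx] Bx].
rewrite addr0 [C `&` B]setIC (siC sL LIf LBg) (rr_split mB mC Lg LIf).
have -> : s (E (B `\` C) g) (E (B `&` C) f) = 0.
  rewrite (rrEsym rr mD' Lg LIf) (siC sL Lg (LE mD' LIf)) rr_disjoint//.
  by apply/disj_setPS => x [[_ nCx] [_ Cx]].
rewrite addr0 (rrEsym rr mI Lg LIf) (siC sL Lg (LE mI LIf)).
exact: (rrEid rr).
Qed.

Lemma mu_setT f : L f -> mu f setT = (s f f)%:E.
Proof. by move=> Lf; rewrite (rrmu rr)// (rrET rr). Qed.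

Lemma mu_fin f : L f -> (mu f setT < +oo)%E.
Proof. by move=> Lf; rewrite mu_setT// ltry. Qed.

Lemma mu_spectral B C f : measurable B -> measurable C -> L f ->
  mu (E B f) C = mu f (C `&` B).
Proof.
move=> mB mC Lf; have LBf := LE mB Lf; have mI := measurableI _ _ mC mB.
rewrite !(rrmu rr)// rr_mul// (rrEsym rr mI Lf LBf) (siC sL Lf (LE mI LBf)).
by rewrite rr_mul// setIAC -setIA setIid.
Qed.

Lemma mu_spectral_supp B a b f : measurable B -> L f -> B `<=` `[a, b]%classic ->
  mu (E B f) (~` `[a, b]%classic) = 0%E.
Proof.
move=> mB Lf Bab; rewrite mu_spectral//; last first.
  by apply: measurableC; exact: measurableTypeR_itv.
rewrite [X in mu f X](_ : _ = set0) ?measure0//.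
by apply/seteqP; split => // x [+ /Bab].
Qed.

(** The function x^2 is integrable for a finite measure carried by [a, b], which puts [f] in the
    domain. This is the only source of elements of the domain. *)
Lemma bounded_spectrum f a b : L f -> mu f (~` `[a, b]%classic) = 0%E ->
  exists2 g, A (f, g) & a * s f f <= s g f <= b * s f f.
Proof.
move=> Lf f0.
have [i2 _ bd] := supported_Rintegral (mu_fin Lf) f0.
have [g Afg] := rrdom rr Lf i2.
by exists g => //; rewrite (rrint rr Afg); move: bd; rewrite mu_setT.
Qed.

Lemma bounded_spectrum_le f g a b : L f -> mu f (~` `[a, b]%classic) = 0%E ->
  A (f, g) -> s g f <= b * s f f.
Proof.
move=> Lf f0 Afg; have [_ _] := supported_Rintegral (mu_fin Lf) f0.
by rewrite (rrint rr Afg) mu_setT//= => /andP[].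
Qed.

Hypothesis Asym : forall f g f' g', A (f, g) -> A (f', g') -> s g f' = s f g'.

(** Since all cross terms vanish, the measure of f + h is the sum of those of f and h. Comparing the
    diagonal integrals gives <g, h> + <k, f> = 0, and by symmetry the two terms are equal. *)
Lemma spectral_cross f g h k a b a' b' : A (f, g) -> A (h, k) ->
  (forall B, measurable B -> s (E B f) h = 0) ->
  mu f (~` `[a, b]%classic) = 0%E -> mu h (~` `[a', b']%classic) = 0%E ->
  s g h = 0.
Proof.
move=> Af Ah fh f0 h0; have [Lf Lg] := rrA rr Af; have [Lh Lk] := rrA rr Ah.
have Afh := rrAP rr 1 Af Ah; rewrite !scale1r in Afh.
have Lfh : L (f + h) by exact: siD sL _ _ _ _.
have mufh B : measurable B -> mu (f + h) B = measure_add (mu f) (mu h) B.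
  move=> mB; rewrite measure_addE !(rrmu rr)// -EFinD; congr (_%:E).
  rewrite -{1}[f]scale1r (rrElin rr)// mul1r.
  have LBf := LE mB Lf; have LBh := LE mB Lh.
  rewrite !(sDr sL)// fh// (rrEsym rr mB Lh Lf) (siC sL Lh LBf) fh//; lra.
have [_ if_ _] := supported_Rintegral (mu_fin Lf) f0.
have [_ ih _] := supported_Rintegral (mu_fin Lh) h0.
have eint : \int[mu (f + h)]_x x = \int[mu f]_x x + \int[mu h]_x x.
  rewrite /Rintegral (eq_measure_integral (measure_add (mu f) (mu h))); last first.
    by move=> B mB _; exact: mufh.
  by rewrite integral_measure_add//; apply: fineD; exact: integrable_fin_num.
have := rrint rr Afh; rewrite eint -(rrint rr Af) -(rrint rr Ah).
rewrite !(sDl sL)// ?(sDr sL)//; try exact: siD sL _ _ _ _.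
rewrite (siC sL Lk Lf) -(Asym Af Ah); lra.
Qed.

(** The operator can be polarized only against vectors of its domain, so [f] is cut at [-n, n]: the
    part in [-n, n] outside [B] is handled by [spectral_cross], and the tail is small. *)
Lemma spectral_commute B f g a b : measurable B -> L f ->
  B `<=` `[a, b]%classic -> A (E B f, g) -> s g f = s g (E B f).
Proof.
move=> mB Lf Bab AB; have LB := LE mB Lf; have [_ Lg] := rrA rr AB.
have Bsupp := mu_spectral_supp mB Lf Bab.
apply/eqP; rewrite -subr_eq0 -sqrf_eq0 eq_le sqr_ge0 andbT.
apply/ler_addgt0Pl => e e0; rewrite addr0.
(* Cauchy-Schwarz bounds the square of the tail term by [s g g * d], which is below [e]; the added 1
   avoids a division by zero. *)
pose d := e / (s g g + 1).
have gg0 := si_ge0 sL Lg.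
have d0 : 0 < d by rewrite divr_gt0// ltr_wpDl.
have [n ntail] := finite_measure_tail (mu_fin Lf) d0.
set I : set (measurableTypeR R) := `[(- n%:R)%R, n%:R%R]%classic in ntail.
have mI : measurable I by exact: measurableTypeR_itv.
pose C := I `\` B; pose D := ~` (B `|` I).
have mC : measurable C by exact: measurableD.
have mD : measurable D by apply: measurableC; exact: measurableU.
have LC := LE mC Lf; have LD := LE mD Lf.
have fBCD k : L k -> s f k = s (E B f) k + s (E C f) k + s (E D f) k.
  move=> Lk; rewrite -(rrET rr Lf Lk) -(setvU (B `|` I)) setUC rr_add//; last first.
  - by apply/disj_setPS => x [].
  - exact: measurableU.
  congr (_ + _); rewrite -rr_add//; last by apply/disj_setPS => x [? []].
  by rewrite setUDr setDv setD0.
have [l Al] : exists l, A (E C f, l).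
  have [||l Al _] := @bounded_spectrum (E C f) (- n%:R) n%:R.
  - exact: LC.
  - by apply: mu_spectral_supp => // x [].
  - by exists l.
have gC : s g (E C f) = 0.
  apply: (spectral_cross AB Al _ Bsupp (@mu_spectral_supp C (- n%:R) n%:R _ _ _ _)) => //.
    move=> S mS; rewrite rr_mul//.
    have mSB := measurableI _ _ mS mB.
    have LS := LE mSB Lf.
    rewrite (siC sL LS LC) (rrEsym rr mC Lf LS) (siC sL Lf (LE mC LS)).
    rewrite rr_disjoint//; apply/disj_setPS => x [[_ nB] [_]]; exact: nB.
  by move=> x [].
have gD : s g f - s g (E B f) = s g (E D f).
  by rewrite !(siC sL Lg)// fBCD// (siC sL LC Lg) gC; lra.
rewrite gD (le_trans (cauchy_schwarz sL Lg LD))//.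
rewrite -rr_contract//.
have le2 : s (E D f) f <= d.
  rewrite -lee_fin -(rrmu rr Lf mD) (le_trans _ (ltW ntail))// le_measure ?inE//.
    exact: measurableC.
  by move=> x /=; apply: contra_not => ?; right.
rewrite (le_trans (ler_wpM2l gg0 le2))// /d mulrCA ler_piMr ?(ltW e0)//.
rewrite ler_pdivrMr ?ltr_wpDl//; lra.
Qed.

End spectral_calculus.

(* Such a tuple is linearly independent. *)
Definition neg_dim (R : realType) (T : lmodType R) (Q : set T) (q : T -> R)
    (n : nat) := exists v : 'I_n -> T,
  (forall i, Q (v i)) /\
  forall c : 'rV[R]_n, c != 0 -> q (\sum_i c 0 i *: v i) < 0.

(** * Spectral subspaces compared with a quadratic form *)

Section form_comparison.
Variables (R : realType) (V : lmodType R) (L : set V) (s : V -> V -> R).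
Hypothesis sL : semi_inner L s.
Variables (A : set (V * V)) (E : set (measurableTypeR R) -> V -> V).
Variable (mu : V -> {measure set (measurableTypeR R) -> \bar R}).
Hypothesis rr : real_resolution L s A E mu.
Variables (T : lmodType R) (Q : set T) (p : T -> T -> R) (J : {linear T -> V}).
Hypothesis pQ : semi_inner Q p.
Hypothesis LJ : forall F, Q F -> L (J F).
Hypothesis weak_form : forall f g, A (f, g) -> exists F,
  [/\ Q F, s (J F - f) (J F - f) = 0 & forall G, Q G -> p F G = s g (J G)].

Let LE B f := rrE rr (B := B) (f := f).

Let rr_0 B k : measurable B -> L k -> s (E B 0) k = 0.
Proof.
move=> mB Lk; have := rrElin rr 1 mB (si0 sL) (si0 sL) Lk.
by rewrite scaler0 addr0 mul1r; lra.
Qed.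

(** Both sides are the value of the symmetric form [p] at the two representing test functions. *)
Lemma weak_form_sym f g f' g' : A (f, g) -> A (f', g') -> s g f' = s f g'.
Proof.
move=> Af Af'; have [Lf Lg] := rrA rr Af; have [Lf' Lg'] := rrA rr Af'.
have [F [QF F0 pF]] := weak_form Af; have [F' [QF' F0' pF']] := weak_form Af'.
have LJF := LJ QF; have LJF' := LJ QF'.
rewrite (siC sL Lg Lf') -(s_equiv sL LJF' Lf' Lg F0') (siC sL LJF' Lg) -pF//.
rewrite -(s_equiv sL LJF Lf Lg' F0) (siC sL LJF Lg') -pF'//.
exact: siC pQ _ _ _ _.
Qed.

Lemma weak_form_bounded f a b : L f -> mu f (~` `[a, b]%classic) = 0%E ->
  exists g F, [/\ A (f, g), Q F, s (J F - f) (J F - f) = 0,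
    forall G, Q G -> p F G = s g (J G) & p F F = s g f] /\
    a * s f f <= s g f <= b * s f f.
Proof.
move=> Lf f0; have [g Ag bd] := bounded_spectrum rr Lf f0.
have [F [QF F0 pF]] := weak_form Ag; have [_ Lg] := rrA rr Ag.
exists g, F; split=> //; split => //.
by rewrite pF// (siC sL Lg (LJ QF)) (s_equiv sL (LJ QF) Lf Lg F0) (siC sL).
Qed.

(** A vector with spectrum in [-n, -1] would have energy at most minus its squared norm, whereas [p]
    is nonnegative. The cut at -1 keeps the set away from 0; the strip up to 0 is counted with the
    low part [-1, a). *)
Lemma no_negative_spectrum f (n : nat) : L f ->
  mu f `[(- n%:R)%R, (- 1)%R]%classic = 0%E.
Proof.
move=> Lf; set B : set (measurableTypeR R) := `[_, _]%classic.
have mB : measurable B by exact: measurableTypeR_itv.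
have LB := LE mB Lf.
have [g [F [[Ag QF _ _ pFF] /andP[_ le]]]] :=
  weak_form_bounded LB (mu_spectral_supp sL rr mB Lf (fun x => id)).
have := si_ge0 pQ QF; have := si_ge0 sL LB.
rewrite (rrmu rr)// (rr_contract rr)//; move: le; rewrite -pFF mulN1r => le le0 F0.
by congr (_%:E); lra.
Qed.

(* With w = E([a, n]) (J v), expand 0 <= p(v - w, v - w) and let n tend to
   infinity. *)
Lemma form_lower_bound v a : 0 < a -> Q v ->
  mu (J v) `[(- 1)%R, a[%classic = 0%E -> a * s (J v) (J v) <= p v v.
Proof.
move=> a0 Qv low; set f := J v in low *; have Lf : L f := LJ Qv.
apply/ler_addgt0Pl => e e0.
pose d := e / a; have d0 : 0 < d by rewrite divr_gt0.
have [n ntail] := finite_measure_tail (mu_fin rr Lf) d0.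
pose B : set (measurableTypeR R) := `[a, n%:R]%classic.
have mB : measurable B by exact: measurableTypeR_itv.
have LB := LE mB Lf.
have [g [F [[Ag QF _ pF pFF] /andP[ge _]]]] :=
  weak_form_bounded LB (mu_spectral_supp sL rr mB Lf (fun x => id)).
have commute : s g f = s g (E B f).
  exact: (spectral_commute sL rr weak_form_sym mB Lf (fun x => id) Ag).
have form_le : s g (E B f) <= p v v.
  have := si_ge0 pQ (siB pQ Qv QF).
  rewrite (sBl pQ) ?(sBr pQ)//; last exact: siB pQ _ _ _ _.
  by rewrite (siC pQ Qv QF) pFF pF// commute; lra.
have cover : (mu f setT <= mu f B + d%:E)%E.
  pose I0 : set (measurableTypeR R) := `[(- 1)%R, a[%classic.
  pose I1 : set (measurableTypeR R) := `[(- n%:R)%R, (- 1)%R]%classic.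
  pose I2 : set (measurableTypeR R) := ~` `[(- n%:R)%R, n%:R%R]%classic.
  have mI0 : measurable I0 by exact: measurable_itv.
  have mI1 : measurable I1 by exact: measurableTypeR_itv.
  have mI2 : measurable I2 by apply: measurableC; exact: measurableTypeR_itv.
  have mU1 := measurableU _ _ mI0 mI1; have mU2 := measurableU _ _ mU1 mI2.
  have mU3 := measurableU _ _ mB mU2.
  apply: (@le_trans _ _ (mu f (B `|` ((I0 `|` I1) `|` I2)))).
    apply: le_measure; rewrite ?inE// => x _; rewrite /B /I0 /I1 /I2 /=.
    rewrite !in_itv/=.
    have [ax|xa] := leP a x.
      have [xn|nx] := leP x n%:R; first by left.
      by right; right; rewrite andbF.
    have [x1|x1] := leP (-1) x; first by right; left; left.
    have [nx|xn] := leP (- n%:R) x; first by right; left; right; rewrite ltW.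
    by right; right.
  apply: (le_trans (measureU2 _ mB mU2)); apply: leeD2l.
  apply: (le_trans (measureU2 _ mU1 mI2)).
  rewrite -[d%:E]add0e; apply: leeD; last exact: ltW.
  apply: (le_trans (measureU2 _ mI0 mI1)).
  by rewrite [X in (X + _)%E]low add0e [leLHS](no_negative_spectrum n Lf).
move: cover; rewrite (mu_setT rr Lf) (rrmu rr Lf mB) (rr_contract rr mB Lf).
rewrite -EFinD lee_fin => cover.
have ad : a * d = e by rewrite /d mulrCA divff ?mulr1// gt_eqF.
have := ler_wpM2l (ltW a0) cover; rewrite mulrDr ad.
by move=> /le_trans; apply; rewrite addrC lerD2l (le_trans ge).
Qed.

(* The images under E([-1, a)) of the given tuple are independent by
   [form_lower_bound], and orthogonal to the range of E([a, b]). *)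
Lemma spectral_subspace_dim a b b' m (r : seq V) :
  0 < a -> a <= b -> b < b' ->
  (forall x, x \in r -> L x) -> uniq r ->
  (forall x, x \in r -> s x x = 1) ->
  (forall x y, x \in r -> y \in r -> x <> y -> s x y = 0) ->
  neg_dim Q (fun F => p F F - a * s (J F) (J F)) m ->
  exists n, \sum_(x <- r) s (E `[a, b]%classic x) x <= n%:R /\
    neg_dim Q (fun F => p F F - b' * s (J F) (J F)) (m + n).
Proof.
move=> a0 ab bb' Lr ur r1 r0 [v [Qv neg]].
pose B0 : set (measurableTypeR R) := `[(- 1)%R, a[%classic.
pose B1 : set (measurableTypeR R) := `[a, b]%classic.
pose Z : set (measurableTypeR R) := ~` `[(- 1)%R, b]%classic.
have mB0 : measurable B0 by exact: measurable_itv.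
have mB1 : measurable B1 by exact: measurableTypeR_itv.
have mZ : measurable Z by apply: measurableC; exact: measurableTypeR_itv.
have B0s : B0 `<=` `[(- 1)%R, b]%classic.
  by move=> x; rewrite /B0 /= !in_itv/= => /andP[-> xa] /=; rewrite ltW// (lt_le_trans xa).
have B1s : B1 `<=` `[(- 1)%R, b]%classic.
  move=> x; rewrite /B1 /= !in_itv/= => /andP[ax ->]; rewrite andbT; lra.
have [n [psi [Lpsi opsi tr]]] : exists n (psi : 'I_n -> V), [/\ forall i, L (psi i),
    forall i j, s (E B1 (psi i)) (E B1 (psi j)) = (i == j)%:R &
    \sum_(x <- r) s (E B1 x) x <= n%:R].
  apply: (trace_le_rank sL) => //.
  - by move=> f; exact: LE.
  - by by move=> c f g k *; apply: (rrElin rr).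
  - by by move=> f k *; apply: (rrEid rr).
  - by by move=> f g *; apply: (rrEsym rr).
exists n; split => //.
(* The [w i] stand for the spectrum below [a] and the [y j] for that in [a, b]. Both have bounded
   spectrum, hence lie in the domain and are represented by test functions. *)
pose w i := E B0 (J (v i)); pose y j := E B1 (psi j).
have Lw i : L (w i) by apply: LE => //; exact: LJ.
have Ly j : L (y j) by apply: LE.
pose x (k : 'I_(m + n)) := match fintype.split k with inl i => w i | inr j => y j end.
have xl i : x (lshift n i) = w i by rewrite /x (unsplitK (inl i)).
have xr j : x (rshift m j) = y j by rewrite /x (unsplitK (inr j)).
have Lx k : L (x k) by rewrite /x; case: fintype.split.
have Zx k : mu (x k) Z = 0%E.
  rewrite /x; case: fintype.split => i.
  - by apply: (mu_spectral_supp sL rr) => //; exact: LJ.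
  - exact: (mu_spectral_supp sL rr).
have {}/choice[gF HgF] : forall k, exists gF : V * T, [/\ A (x k, gF.1), Q gF.2,
    s (J gF.2 - x k) (J gF.2 - x k) = 0 & forall G, Q G -> p gF.2 G = s gF.1 (J G)].
  move=> k; have [g [F [[Ag QF F0 pF _] _]]] := weak_form_bounded (Lx k) (Zx k).
  by exists (g, F).
exists (fun k => (gF k).2); split => [k|c c0]; first by have [] := HgF k.
set F := \sum_k _.
pose Y := \sum_k c 0 k *: x k; pose G := \sum_k c 0 k *: (gF k).1.
have Lg k : L (gF k).1 by have [/(rrA rr)[]] := HgF k.
have QF : Q F by apply: (si_sum pQ) => k _; apply: (siZ pQ); have [] := HgF k.
have LY : L Y by apply: (si_sum sL) => k _; exact: siZ sL _ _ _.
have LG : L G by apply: (si_sum sL) => k _; exact: siZ sL _ _ _.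
have LJF := LJ QF.
have EY B k : measurable B -> L k -> s (E B Y) k = \sum_i c 0 i * s (E B (x i)) k.
  move=> mB Lk; rewrite /Y.
  elim: (index_enum _) => [|i l IH]; first by rewrite !big_nil rr_0.
  rewrite !big_cons (rrElin rr)// ?IH//.
  by apply: (si_sum sL) => j _; exact: siZ sL _ _ _.
have YZ : mu Y Z = 0%E.
  rewrite (rrmu rr)// EY// big1// => i _.
  have LZx := LE mZ (Lx i).
  have ZZ : s (E Z (x i)) (E Z (x i)) = 0.
    by apply: EFin_inj; rewrite -(rr_contract rr)// -(rrmu rr)// Zx.
  by rewrite (s_null sL LZx LY ZZ) mulr0.
have AYG : A (Y, G).
  (* Closure of [A] under combinations says nothing about the empty one: 0 is in the domain because
     its measure vanishes, and subtracting (0, g) from itself leaves (0, 0). *)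
  have [g Ag] : exists g, A (0, g).
    have L0 := si0 sL.
    have [|g Ag _] := @bounded_spectrum _ _ _ _ _ _ _ rr 0 0 0 L0; last by exists g.
    rewrite (rrmu rr)// ?(s0r sL)//; first by apply: LE => //;
      apply: measurableC; exact: measurableTypeR_itv.
    by apply: measurableC; exact: measurableTypeR_itv.
  have A00 : A (0, 0).
    by have := rrAP rr (-1) Ag Ag; rewrite scaler0 addr0 scaleN1r addNr.
  rewrite /Y /G; elim: (index_enum _) => [|i l IH]; first by rewrite !big_nil.
  by rewrite !big_cons; apply: (rrAP rr) => //; have [] := HgF i.
have null : s (J F - Y) (J F - Y) = 0.
  have -> : J F - Y = \sum_k c 0 k *: (J (gF k).2 - x k).
    rewrite /F /Y linear_sum -sumrB; apply: eq_bigr => k _.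
    by rewrite linearZ scalerBr.
  have LN k : L (J (gF k).2 - x k).
    by apply: (siB sL) => //; apply: LJ; have [] := HgF k.
  have LS : L (\sum_k c 0 k *: (J (gF k).2 - x k)).
    by apply: (si_sum sL) => k _; exact: siZ sL _ _ _.
  rewrite (s_suml sL)//; last by move=> k; exact: siZ sL _ _ _.
  rewrite big1// => k _; rewrite (sZl sL)// (s_null sL)// ?mulr0//.
  by have [] := HgF k.
have pFF : p F F = s G (J F).
  rewrite /G (s_suml sL)//; last by move=> k; exact: siZ sL _ _ _.
  rewrite {1}/F (s_suml pQ)//; last by move=> k; apply: (siZ pQ); have [] := HgF k.
  apply: eq_bigr => k _; have [_ QFk _ pk] := HgF k.
  by rewrite (sZl pQ)// (sZl sL)// pk.
have JFY k : L k -> s (J F) k = s Y k by move=> Lk; exact: (s_equiv sL).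
have -> : s (J F) (J F) = s Y Y by rewrite JFY// (siC sL)// JFY.
have pY : p F F <= b * s Y Y.
  rewrite pFF (siC sL)// JFY// (siC sL)//.
  exact: (bounded_spectrum_le rr LY YZ AYG).
(* The strict inequality b < b' makes the form at level b' negative wherever the norm is positive,
   so only independence modulo null vectors is left. *)
suff Y0 : 0 < s Y Y.
  by rewrite subr_lt0 (le_lt_trans pY)// ltr_pM2r.
rewrite lt_neqAle (si_ge0 sL LY) andbT eq_sym; apply: contra_neq c0 => Y0.
pose cl := lsubmx c; pose cr := rsubmx c.
pose W := \sum_i cl 0 i *: w i; pose U := \sum_j cr 0 j *: y j.
have LcW i : L (cl 0 i *: w i) by exact: siZ sL _ _ _.
have LcU i : L (cr 0 i *: y i) by exact: siZ sL _ _ _.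
have LW : L W by exact: (si_sum sL).
have LU : L U by exact: (si_sum sL).
have YWU : Y = W + U.
  rewrite /Y big_split_ord /=; congr (_ + _); apply: eq_bigr => i _.
    by rewrite xl mxE.
  by rewrite xr mxE.
have WU : s W U = 0.
  rewrite (s_suml sL)// big1// => i _; rewrite (s_sumr sL)// big1// => j _.
  rewrite (sZl sL)// (sZr sL)//.
  rewrite -(rrEsym rr mB1 (Lw i) (Lpsi j)) (rr_disjoint sL rr) ?mulr0 ?mulr0//.
    apply/disj_setPS => z []; rewrite /B1 /B0 /= !in_itv/=.
    by move=> /andP[az _] /andP[_ /lt_le_trans/(_ az)]; rewrite ltxx.
  exact: LJ.
have eWU : s W W + s U U = 0.
  have LWU := siD sL LW LU.
  by move: Y0; rewrite YWU (sDl sL)// !(sDr sL)// (siC sL LU LW) WU addr0 add0r.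
have /andP[/eqP sW0 /eqP sU0] : (s W W == 0) && (s U U == 0).
  by rewrite -paddr_eq0 ?eWU//; exact: (si_ge0 sL).
have sU : s U U = \sum_j cr 0 j ^+ 2.
  rewrite {1}/U (s_suml sL)//; apply: eq_bigr => j _.
  rewrite (s_sumr sL)// (bigD1 j)//= big1 ?addr0 => [|k /negPf kj].
    by rewrite (sZl sL)// (sZr sL)// opsi eqxx mulr1 expr2.
  by rewrite (sZl sL)// (sZr sL)// opsi eq_sym kj !mulr0.
have cr0 : cr = 0.
  apply/rowP => j; rewrite [RHS]mxE.
  have : \sum_j cr 0 j ^+ 2 = 0 by rewrite -sU.
  move/eqP; rewrite psumr_eq0 => [/allP /(_ j)|k _]; last exact: sqr_ge0.
  by rewrite mem_index_enum sqrf_eq0 => /(_ isT)/eqP.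
(* If [W] is null, the combination [vc] of the given tuple has no spectrum in [-1, a);
   [form_lower_bound] then makes its form at level [a] nonnegative, against the hypothesis on
   [v]. *)
have cl0 : cl = 0.
  apply/eqP/negPn/negP => /neg; apply/negP; rewrite -leNgt subr_ge0.
  set vc := \sum_i _.
  have Qvc : Q vc by apply: (si_sum pQ) => i _; exact: siZ pQ _ _ _.
  have EvW k : L k -> s (E B0 (J vc)) k = s W k.
    move=> Lk; rewrite /vc /W.
    elim: (index_enum _) => [|i l IH]; first by rewrite !big_nil linear0 (s0l sL)// rr_0.
    have LJl : L (J (\sum_(j <- l) cl 0 j *: v j)).
      by apply: LJ; apply: (si_sum pQ) => j _; exact: siZ pQ _ _ _.
    have LWl : L (\sum_(j <- l) cl 0 j *: w j) by exact: (si_sum sL).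
    by rewrite !big_cons linearP (rrElin rr)// ?IH ?(siDl sL)//; exact: LJ.
  apply: (form_lower_bound a0 Qvc _).
  by rewrite (rrmu rr (LJ Qvc) mB0) (EvW _ (LJ Qvc)) (s_null sL LW (LJ Qvc) sW0).
by rewrite -[c]hsubmxK -/cl -/cr cl0 cr0 row_mx0.
Qed.

End form_comparison.

(** * Quadratic forms on test functions *)

Section negative_dimension.
Variables (R : realType) (T : lmodType R).
Implicit Types (Q : set T) (q : T -> R) (n k : nat).

Definition lin_closed Q := Q 0 /\ forall a F G, Q F -> Q G -> Q (a *: F + G).

Lemma lin_closed_sum Q n (v : 'I_n -> T) (c : 'rV[R]_n) : lin_closed Q ->
  (forall i, Q (v i)) -> Q (\sum_i c 0 i *: v i).
Proof.
move=> [Q0 QP] Qv; elim: (index_enum _) => [|i l IH]; first by rewrite big_nil.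
by rewrite big_cons; exact: QP.
Qed.

(** Each linear condition costs at most one dimension: the coefficient rows killed by all the
    functionals form the kernel of [M], of rank at least n - #|I|, and [N] consists of n'
    independent rows of it. *)
Lemma neg_dim_ker Q q n n' (I : finType) (f : I -> T -> R) : lin_closed Q ->
  (forall j a F G, f j (a *: F + G) = a * f j F + f j G) ->
  (n' + #|I| <= n)%N -> neg_dim Q q n ->
  neg_dim (Q `&` [set F | forall j, f j F = 0]) q n'.
Proof.
move=> Qlin flin nk [v [Qv neg]].
pose k := #|I|; pose l (j : 'I_k) := f (enum_val j).
have llin j a F G : l j (a *: F + G) = a * l j F + l j G by exact: flin.
have l0 j : l j 0 = 0 by have := llin j 1 0 0; rewrite scaler0 addr0; lra.
have lsum j m (u : 'I_m -> T) (c : 'rV[R]_m) :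
    l j (\sum_i c 0 i *: u i) = \sum_i c 0 i * l j (u i).
  elim: (index_enum _) => [|i s IH]; first by rewrite !big_nil.
  by rewrite !big_cons llin IH.
pose M : 'M[R]_(n, k) := \matrix_(i, j) l j (v i).
pose K := row_base (kermx M).
have rk : (n' <= \rank (kermx M))%N.
  by rewrite mxrank_ker (leq_trans _ (leq_sub2l n (rank_leq_col M)))// leq_subRL /k; lia.
pose N : 'M[R]_(n', n) := rowsub (widen_ord rk) K.
have NM : N *m M = 0.
  have KM : K *m M = 0 by apply/sub_kermxP; rewrite eq_row_base.
  by rewrite /N mul_rowsub_mx KM; apply/matrixP => i j; rewrite !mxE.
have Nfree (c : 'rV[R]_n') : c *m N = 0 -> c = 0.
  rewrite /N -[K]mul1mx -mul_rowsub_mx mulmxA => cK.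
  have Kf : row_free K by rewrite row_base_free.
  have {}cK : c *m rowsub (widen_ord rk) 1%:M = 0.
    by apply: (row_free_inj Kf); rewrite cK mul0mx.
  apply/rowP => i; move/rowP/(_ (widen_ord rk i)): cK; rewrite !mxE.
  rewrite (bigD1 i)//= big1 => [|j /negPf ji].
    by rewrite !mxE eqxx mulr1 addr0.
  by rewrite !mxE -(inj_eq val_inj)/= (inj_eq val_inj) ji mulr0.
pose w i := \sum_j N i j *: v j.
have wE i : w i = \sum_j row i N 0 j *: v j.
  by apply: eq_bigr => j _; rewrite [row _ _ _ _]mxE.
exists w; split=> [i|c c0].
  rewrite wE; split; first exact: lin_closed_sum.
  suff lw j : l j (\sum_j row i N 0 j *: v j) = 0.
    by move=> j; have := lw (enum_rank j); rewrite /l enum_rankK.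
  rewrite lsum; move/matrixP: NM => /(_ i j); rewrite [LHS]mxE [RHS]mxE => e; rewrite -[RHS]e.
  by apply: eq_bigr => m _; rewrite [row _ _ _ _]mxE [M _ _]mxE.
have -> : \sum_i c 0 i *: w i = \sum_j (c *m N) 0 j *: v j.
  under [RHS]eq_bigr do rewrite mxE scaler_suml.
  rewrite exchange_big; apply: eq_bigr => i _; rewrite scaler_sumr.
  by apply: eq_bigr => j _; rewrite scalerA.
by apply: neg; apply: contra_neq c0; exact: Nfree.
Qed.

(** Strict negativity on nonzero coefficient rows passes to the images, and with it the independence
    encoded in [neg_dim]. *)
Lemma neg_dim_map Q Q' q q' n (phi : T -> T) : lin_closed Q ->
  (forall a F G, phi (a *: F + G) = a *: phi F + phi G) ->
  (forall F, Q F -> Q' (phi F)) -> (forall F, Q F -> q' (phi F) <= q F) ->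
  neg_dim Q q n -> neg_dim Q' q' n.
Proof.
move=> Qlin philin QQ' qq' [v [Qv neg]].
exists (phi \o v); split=> [i|c c0]; first exact: QQ'.
have phi0 : phi 0 = 0.
  by have := philin (-1) 0 0; rewrite scaler0 addr0 scaleN1r addNr.
have -> : \sum_i c 0 i *: (phi \o v) i = phi (\sum_i c 0 i *: v i).
  elim: (index_enum _) => [|i s IH]; first by rewrite !big_nil.
  by rewrite !big_cons philin IH.
by apply: (le_lt_trans (qq' _ _)) (neg c c0); exact: lin_closed_sum.
Qed.

Lemma neg_dim_le Q q q' n : lin_closed Q -> (forall F, Q F -> q' F <= q F) ->
  neg_dim Q q n -> neg_dim Q q' n.
Proof. by move=> Qlin qq'; apply: (@neg_dim_map Q Q q q' n id). Qed.

Lemma neg_dim_leq Q q n m : lin_closed Q -> (m <= n)%N ->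
  neg_dim Q q n -> neg_dim Q q m.
Proof.
move=> Qlin mn neg; have [||v [Qv] negv] := @neg_dim_ker Q q n m void (fun _ _ => 0) Qlin _ _ neg.
- by move=> [].
- by rewrite card_void addn0.
by exists v; split=> // i; have [] := Qv i.
Qed.

(** With more than #|I| dimensions one negative direction would survive in the common kernel, where
    the form is nonnegative. *)
Lemma neg_dim_bound Q q n (I : finType) (l : I -> T -> R) : lin_closed Q ->
  (forall j a F G, l j (a *: F + G) = a * l j F + l j G) ->
  (forall F, Q F -> (forall j, l j F = 0) -> 0 <= q F) ->
  neg_dim Q q n -> (n <= #|I|)%N.
Proof.
move=> Qlin llin q0 neg; rewrite leqNgt; apply/negP => kn.
have [v [Qv]] := @neg_dim_ker Q q n 1 I l Qlin llin kn neg.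
move=> /(_ (const_mx 1)); rewrite big_ord1 mxE scale1r ltNge.
have [Q0 l0] := Qv ord0; rewrite q0// => /(_ _)/negP; apply => //.
by apply/eqP => /rowP/(_ 0); rewrite !mxE => /eqP; rewrite oner_eq0.
Qed.

Lemma neg_dim0 Q q : neg_dim Q q 0.
Proof.
by exists (fun=> 0); split=> [[]//|c]; rewrite (thinmx0 c) eqxx.
Qed.

End negative_dimension.

(** * Primitives and a Poincare inequality *)

Section primitives.
Variable R : realType.
Notation leb := (@lebesgue_measure R).
Implicit Types (f g : R -> R) (a b l x y : R).

Lemma itv_cont_integrable a b f : {within `[a, b], continuous f} ->
  leb.-integrable `[a, b] (EFin \o f).
Proof. by move=> cf; apply: continuous_compact_integrable => //; exact: segment_compact. Qed.

Lemma sub_itvcc a b x y : a <= x -> y <= b -> `[x, y] `<=` `[a, b].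
Proof.
move=> ax yb z /=; rewrite !in_itv/= => /andP[xz zy].
by rewrite (le_trans ax)// (le_trans zy).
Qed.

Lemma withinM a b f g : {within `[a, b], continuous f} ->
  {within `[a, b], continuous g} -> {within `[a, b], continuous (fun x => f x * g x)}.
Proof. by move=> cf cg x; apply: cvgM; [exact: cf|exact: cg]. Qed.

Lemma withinX2 a b f : {within `[a, b], continuous f} ->
  {within `[a, b], continuous (fun x => f x ^+ 2)}.
Proof. by move=> cf; exact: (withinM cf cf). Qed.

Lemma Rintegral_itv_split a b c f : a <= b -> b <= c ->
  leb.-integrable `[a, c] (EFin \o f) ->
  \int[leb]_(x in `[a, c]) f x =
  \int[leb]_(x in `[a, b]) f x + \int[leb]_(x in `[b, c]) f x.
Proof.
move=> ab bc fi; have := @Rintegral_itvB R f (BLeft a) (BRight c) b fi.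
rewrite !bnd_simp => /(_ ab bc) e.
rewrite -[X in _ = _ + X]Rintegral_itv_obnd_cbnd; first by rewrite -e addrC subrK.
by apply: integrableS fi => //; apply: subset_itvr; rewrite bnd_simp.
Qed.

Lemma fine_leb_itv x y : x <= y -> fine (leb `[x, y]) = y - x.
Proof.
rewrite lebesgue_measure_itv/= lte_fin.
by case: ltgtP => //= ->; rewrite subrr.
Qed.

Variables (l : R) (f0 f1 : R -> R).
Hypothesis if1 : leb.-integrable `[0, l] (EFin \o f1).
Hypothesis prim : forall x, 0 <= x <= l -> f0 x = f0 0 + \int[leb]_(t in `[0, x]) f1 t.

Lemma primitiveB x y : 0 <= x -> x <= y -> y <= l ->
  f0 y - f0 x = \int[leb]_(t in `[x, y]) f1 t.
Proof.
move=> x0 xy yl.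
have px : f0 x = _ := prim (introT andP (conj x0 (le_trans xy yl))).
have py : f0 y = _ := prim (introT andP (conj (le_trans x0 xy) yl)).
rewrite px py.
rewrite (Rintegral_itv_split x0 xy); first by lra.
by apply: integrableS if1 => //; exact: sub_itvcc.
Qed.

Lemma primitive_continuous : 0 <= l -> {within `[0, l], continuous f0}.
Proof.
move=> l0; have cint := @parameterized_integral_continuous R 0 l f1 l0 if1.
apply: (@subspace_eq_continuous _ _ _
  (fun x => f0 0 + parameterized_integral leb 0 x f1)).
  by move=> x; rewrite inE/= in_itv/= => xl; exact/esym/prim.
by move=> x; apply: cvgD; [exact: cvg_cst|exact: cint].
Qed.

End primitives.

Section poincare.
Variables (R : realType) (l : R) (f0 f1 : R -> R).
Notation leb := (@lebesgue_measure R).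
Hypothesis cf1 : {within `[0, l], continuous f1}.
Hypothesis prim : forall x, 0 <= x <= l -> f0 x = f0 0 + \int[leb]_(t in `[0, x]) f1 t.

Let if1 := itv_cont_integrable cf1.

Let integrable_sub (f : R -> R) x y : 0 <= x -> y <= l ->
  {within `[0, l], continuous f} -> leb.-integrable `[x, y] (EFin \o f).
Proof.
by move=> x0 yl cf; apply: itv_cont_integrable; apply: continuous_subspaceW cf; exact: sub_itvcc.
Qed.

Lemma Rintegral_sqr_ge x y : 0 <= x -> x <= y -> y <= l ->
  (f0 y - f0 x) ^+ 2 <= (y - x) * \int[leb]_(t in `[x, y]) f1 t ^+ 2.
Proof.
move=> x0 xy yl; rewrite (primitiveB if1 prim)//.
have [->|nxy] := eqVneq x y; first by rewrite subrr mul0r set_itv1 Rintegral_set1 expr0n.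
have h0 : 0 < y - x by rewrite subr_gt0 lt_neqAle nxy.
have i1 := integrable_sub x0 yl cf1.
have i2 := integrable_sub x0 yl (withinX2 cf1).
set A := \int[leb]_(t in _) f1 t; set B := \int[leb]_(t in _) _.
(* The mean slope: expanding the integral of (f1 - c)^2 yields Cauchy-Schwarz against the constant
   1. *)
pose c := A / (y - x).
have : 0 <= \int[leb]_(t in `[x, y]) (f1 t - c) ^+ 2.
  by apply: Rintegral_ge0 => t _; exact: sqr_ge0.
have icst k : leb.-integrable `[x, y] (EFin \o (fun=> k)).
  by apply: itv_cont_integrable => z; exact: cvg_cst.
have -> : \int[leb]_(t in `[x, y]) (f1 t - c) ^+ 2 =
    \int[leb]_(t in `[x, y]) ((f1 t ^+ 2 - (2 * c) * f1 t) + c ^+ 2).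
  by apply: eq_Rintegral => t _; ring.
have cc : {within `[0, l], continuous (fun t => (2 * c) * f1 t)}.
  by apply: withinM => // z; exact: cvg_cst.
have ic := integrable_sub x0 yl cc.
rewrite RintegralD//; last first.
  apply: integrable_sub => // z; apply: cvgB; last exact: cc.
  exact: (withinX2 cf1).
rewrite RintegralB// RintegralZl// Rintegral_cst// -/A -/B.
have -> : fine (leb `[x, y]) = y - x by exact: fine_leb_itv.
have -> : A = c * (y - x) by rewrite /c divfK// gt_eqF.
have -> : (c * (y - x)) ^+ 2 = (y - x) * (c ^+ 2 * (y - x)) by ring.
rewrite ler_pM2l// => h; rewrite -subr_ge0 (le_trans h)// le_eqVlt.
by apply/orP; left; apply/eqP; ring.
Qed.

(** A crude constant, from the pointwise bound of f0(t)^2 by (y - x) times the energy. On pieces of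
    length 1 / M it already gives the factor M^2 that balances lengths up to M. *)
Lemma poincare_piece x y : 0 <= x -> x <= y -> y <= l -> f0 x = 0 ->
  \int[leb]_(t in `[x, y]) f0 t ^+ 2 <=
  (y - x) ^+ 2 * \int[leb]_(t in `[x, y]) f1 t ^+ 2.
Proof.
move=> x0 xy yl fx.
have l0 : 0 <= l by rewrite (le_trans x0)// (le_trans xy).
have i0 := integrable_sub x0 yl (withinX2 (primitive_continuous if1 prim l0)).
have i2 := integrable_sub x0 yl (withinX2 cf1).
set B := \int[leb]_(t in _) f1 t ^+ 2.
have B0 : 0 <= B by apply: Rintegral_ge0 => t _; exact: sqr_ge0.
have icst : leb.-integrable `[x, y] (EFin \o (fun=> (y - x) * B)).
  by apply: itv_cont_integrable => z; exact: cvg_cst.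
apply: (@le_trans _ _ (\int[leb]_(t in `[x, y]) ((y - x) * B))).
  apply: le_Rintegral => // t /=; rewrite in_itv/= => /andP[xt ty].
  have := Rintegral_sqr_ge x0 xt (le_trans ty yl); rewrite fx subr0 => /le_trans; apply.
  have -> : B = \int[leb]_(t in `[x, t]) f1 t ^+ 2 + \int[leb]_(t in `[t, y]) f1 t ^+ 2.
    by apply: Rintegral_itv_split.
  have I0 : 0 <= \int[leb]_(t in `[x, t]) f1 t ^+ 2.
    by apply: Rintegral_ge0 => z _; exact: sqr_ge0.
  have I1 : 0 <= \int[leb]_(t in `[t, y]) f1 t ^+ 2.
    by apply: Rintegral_ge0 => z _; exact: sqr_ge0.
  by apply: ler_pM => //; [rewrite subr_ge0|rewrite lerD2r|rewrite lerDl].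
rewrite Rintegral_cst//.
have -> : fine (leb `[x, y]) = y - x by exact: fine_leb_itv.
by rewrite le_eqVlt; apply/orP; left; apply/eqP; ring.
Qed.

Lemma poincare (M : nat) : l = 1 -> (0 < M)%N ->
  (forall k, (k <= M)%N -> f0 (k%:R / M%:R) = 0) ->
  M%:R ^+ 2 * \int[leb]_(t in `[0, 1]) f0 t ^+ 2 <= \int[leb]_(t in `[0, 1]) f1 t ^+ 2.
Proof.
move=> l1 M0 fk; have MR : 0 < M%:R :> R by rewrite ltr0n.
have l0 : 0 <= l by rewrite l1.
suff H k : (k <= M)%N -> M%:R ^+ 2 * \int[leb]_(t in `[0, k%:R / M%:R]) f0 t ^+ 2 <=
    \int[leb]_(t in `[0, k%:R / M%:R]) f1 t ^+ 2.
  by have := H M (leqnn M); rewrite divff// gt_eqF.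
elim: k => [_|k IH kM].
  by rewrite mul0r set_itv1 !Rintegral_set1 mulr0.
pose x := k%:R / M%:R : R; pose y := k.+1%:R / M%:R : R.
have x0 : 0 <= x by rewrite divr_ge0.
have xy : x <= y by rewrite ler_pM2r ?invr_gt0// ler_nat.
have yl : y <= l by rewrite l1 ler_pdivrMr// mul1r ler_nat.
have yx : y - x = M%:R^-1 by rewrite /y /x -mulrBl -natrB// subSnn mul1r.
have := poincare_piece x0 xy yl (fk k (ltnW kM)).
rewrite yx exprVn -(ler_pM2l (exprn_gt0 2 MR)) mulrA divff ?expf_neq0 ?gt_eqF// mul1r => piece.
rewrite !(Rintegral_itv_split x0 xy); last 2 first.
- exact: integrable_sub (withinX2 cf1).
- exact: integrable_sub (withinX2 (primitive_continuous if1 prim l0)).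
by rewrite mulrDr lerD// IH// ltnW.
Qed.

End poincare.

(* Pairs (f, f') of complex functions on the edges, reparametrized to [0, 1];
   the boolean selects the real ([false]) or the imaginary ([true]) part. *)
Definition test_pair (R : realType) (E : Type) : lmodType R :=
  ((E -> bool -> R -> R^o) * (E -> bool -> R -> R^o))%type.

Section edge_pairing.
Variable R : realType.
Notation leb := (@lebesgue_measure R).
Implicit Types f g h : bool -> R -> R.

Lemma Rintegral_zero (D : set R) : \int[leb]_(x in D) (0 : R) = 0.
Proof. by rewrite /Rintegral integral0. Qed.

Definition edge_pairing f g : R :=
  \sum_(i : bool) \int[leb]_(x in `[0, 1]) (f i x * g i x).

Definition edge_cont f := forall i, {within `[0, 1], continuous (f i)}.

Lemma edge_pairingC f g : edge_pairing f g = edge_pairing g f.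
Proof.
by apply: eq_bigr => i _; apply: eq_Rintegral => x _; rewrite mulrC.
Qed.

Lemma edge_pairingDl a f g h : edge_cont f -> edge_cont g -> edge_cont h ->
  edge_pairing (fun i x => a * f i x + g i x) h =
  a * edge_pairing f h + edge_pairing g h.
Proof.
move=> cf cg ch; rewrite /edge_pairing mulr_sumr -big_split/=.
apply: eq_bigr => i _.
have ifh := itv_cont_integrable (withinM (cf i) (ch i)).
have igh := itv_cont_integrable (withinM (cg i) (ch i)).
rewrite -RintegralZl// -RintegralD//; last first.
  have cst : {within `[0, 1], continuous (fun _ : R => a)} by move=> z; exact: cvg_cst.
  exact: itv_cont_integrable (withinM cst (withinM (cf i) (ch i))).
by apply: eq_Rintegral => x _; rewrite mulrDl mulrA.
Qed.

Lemma edge_pairing_ge0 f : 0 <= edge_pairing f f.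
Proof.
by apply: sumr_ge0 => i _; apply: Rintegral_ge0 => x _; exact: sqr_ge0.
Qed.

End edge_pairing.

(** * Test functions on rescaled edges *)

Section test_functions.
Variables (R : realType) (E : choiceType) (S : seq E).
Variables (N : Type) (node : E -> bool -> N) (bd : set N).
Notation leb := (@lebesgue_measure R).
Notation T := (test_pair R E).
Implicit Types (F G : T) (e : E) (w q : E -> R).

Lemma test_pair_lin a F G e (i : bool) (x : R) :
  (a *: F + G).1 e i x = a * F.1 e i x + G.1 e i x.
Proof. by simpl; reflexivity. Qed.

Lemma test_pair_lin2 a F G e (i : bool) (x : R) :
  (a *: F + G).2 e i x = a * F.2 e i x + G.2 e i x.
Proof. by simpl; reflexivity. Qed.

(** A core of the form domain. The derivative is required to be continuous, which holds for vectors
    of the domain of the Laplacian since f'' is square integrable. Continuity at vertices and the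
    Dirichlet conditions are imposed; the Kirchhoff condition on derivatives is the natural boundary
    condition of the form. *)
Definition test_functions : set T := [set F |
  [/\ forall e, e \in S -> edge_cont (F.2 e),
      forall e i x, e \in S -> 0 <= x <= 1 ->
        F.1 e i x = F.1 e i 0 + \int[leb]_(t in `[0, x]) F.2 e i t,
      forall e e' b b' i, e \in S -> e' \in S -> node e b = node e' b' ->
        F.1 e i b%:R = F.1 e' i b'%:R &
      forall e b i, e \in S -> bd (node e b) -> F.1 e i b%:R = 0]].

Local Notation Q := test_functions.

Lemma test_functions_cont F e : Q F -> e \in S -> edge_cont (F.1 e).
Proof.
move=> [cF pF _ _] eS i.
apply: (primitive_continuous (itv_cont_integrable (cF e eS i))) => //.
by move=> x; exact: pF.
Qed.

Lemma test_functions_lin : lin_closed Q.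
Proof.
split; first split => //=.
- by move=> e _ i z; exact: cvg_cst.
- move=> e i x _ _; rewrite [X in _ + X](_ : _ = 0) ?addr0//.
  exact: Rintegral_zero.
move=> a F G [cF pF mF dF] [cG pG mG dG]; split => /=.
- move=> e eS i z; apply: cvgD; last exact: (cG e eS i).
  by apply: cvgM; [exact: cvg_cst|exact: (cF e eS i)].
- move=> e i x eS x01; have [x0 x1] := andP x01.
  have iF : leb.-integrable `[0, x] (EFin \o F.2 e i).
    apply: integrableS (itv_cont_integrable (cF e eS i)) => //.
    exact: sub_itvcc.
  have iG : leb.-integrable `[0, x] (EFin \o G.2 e i).
    apply: integrableS (itv_cont_integrable (cG e eS i)) => //.
    exact: sub_itvcc.
  have cst : {within `[0, 1], continuous (fun _ : R => a)} by move=> z; exact: cvg_cst.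
  have iaF : leb.-integrable `[0, x] (EFin \o (fun t => a * F.2 e i t)).
    apply: integrableS (itv_cont_integrable (withinM cst (cF e eS i))) => //.
    exact: sub_itvcc.
  rewrite RintegralD//.
  rewrite RintegralZl//.
  rewrite [LHS](_ : _ = a * F.1 e i x + G.1 e i x)// [RHS](_ : _ = (a * F.1 e i 0 +
    G.1 e i 0) + (a * \int[leb]_(t in `[0, x]) F.2 e i t +
    \int[leb]_(t in `[0, x]) G.2 e i t))//.
  by rewrite (pF e i x eS x01) (pG e i x eS x01); ring.
- move=> e e' b b' i eS e'S h.
  rewrite [LHS](_ : _ = a * F.1 e i b%:R + G.1 e i b%:R)//.
  by rewrite (mF _ _ _ _ _ eS e'S h) (mG _ _ _ _ _ eS e'S h).
- move=> e b i eS h.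
  rewrite [LHS](_ : _ = a * F.1 e i b%:R + G.1 e i b%:R)//.
  by rewrite (dF _ _ _ eS h) (dG _ _ _ eS h) mulr0 addr0.
Qed.

Definition kinetic F G e := edge_pairing (F.2 e) (G.2 e).
Definition mass F G e := edge_pairing (F.1 e) (G.1 e).

(** The weights come from the substitution x = w y: the integral of |f'|^2 acquires the factor 1 /
    w, and that of |f|^2 below the factor w. *)
Definition energy w F G := \sum_(e <- S) (w e)^-1 * kinetic F G e.
Definition inner w F G := \sum_(e <- S) w e * mass F G e.

Lemma energy_semi_inner w : (forall e, e \in S -> 0 < w e) ->
  semi_inner Q (energy w).
Proof.
move=> w0; have [Q0 QP] := test_functions_lin; split => //.
- by move=> F G _ _; apply: eq_bigr => e _; rewrite /kinetic edge_pairingC.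
- move=> a F G K [cF _ _ _] [cG _ _ _] [cK _ _ _].
  rewrite /energy mulr_sumr -big_split/=; apply: eq_big_seq => e eS.
  have -> : kinetic (a *: F + G) K e = a * kinetic F K e + kinetic G K e.
    exact: (edge_pairingDl a (cF e eS) (cG e eS) (cK e eS)).
  by ring.
- move=> F _; rewrite /energy big_seq sumr_ge0// => e eS.
  apply: mulr_ge0; first by rewrite invr_ge0 ltW// w0.
  exact: (edge_pairing_ge0 (F.2 e)).
Qed.

Definition length_form q F := \sum_(e <- S) ((q e)^-1 * kinetic F F e - q e * mass F F e).

Lemma neg_dim_mono q q' n : (forall e, e \in S -> 0 < q e <= q' e) ->
  neg_dim Q (length_form q) n -> neg_dim Q (length_form q') n.
Proof.
move=> qq'.
apply: (@neg_dim_le _ _ Q (length_form q) (length_form q') n test_functions_lin) => F _.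
rewrite /length_form big_seq [leRHS]big_seq; apply: ler_sum => e /qq'/andP[q0 qe].
have k0 : 0 <= kinetic F F e := edge_pairing_ge0 (F.2 e).
have m0 : 0 <= mass F F e := edge_pairing_ge0 (F.1 e).
apply: lerB; last exact: ler_wpM2r.
by apply: ler_wpM2r => //; rewrite lef_pV2// posrE (lt_le_trans q0).
Qed.

Section finite_dimension.
Variable M : nat.
Hypothesis M0 : (0 < M)%N.

Let node_value e (j : bool * 'I_M.+1) F : R := F.1 e j.1 (j.2%:R / M%:R).

Let node_value_lin e j a F G :
  node_value e j (a *: F + G) = a * node_value e j F + node_value e j G.
Proof. exact: test_pair_lin. Qed.

Lemma edge_form_ge0 F e r : Q F -> e \in S -> 0 < r <= M%:R ->
  (forall j, node_value e j F = 0) ->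
  0 <= r^-1 * kinetic F F e - r * mass F F e.
Proof.
move=> [cF pF _ _] eS /andP[r0 rM] F0.
suff le : M%:R ^+ 2 * mass F F e <= kinetic F F e.
  rewrite subr_ge0 -(ler_pM2l r0) !mulrA divff ?gt_eqF// mul1r.
  apply: le_trans le; apply: ler_wpM2r; first exact: (edge_pairing_ge0 (F.1 e)).
  by rewrite -expr2; apply: lerXn2r => //; rewrite nnegrE ?ler0n// ltW.
rewrite /mass /kinetic /edge_pairing mulr_sumr; apply: ler_sum => i _.
have prim x : 0 <= x <= 1 -> F.1 e i x = F.1 e i 0 + \int[leb]_(t in `[0, x]) F.2 e i t.
  by move=> x01; exact: pF.
have zero k : (k <= M)%N -> F.1 e i (k%:R / M%:R) = 0.
  by move=> kM; have := F0 (i, Ordinal (kM : (k < M.+1)%N)).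
exact: (@poincare R 1 _ _ (cF e eS i) prim M erefl M0 zero).
Qed.

(* A function vanishing at the points [k / M] of the edge [e0] has nonnegative
   form there, so that it may be replaced by [0] on this edge, where the length
   then no longer matters. *)
Lemma neg_dim_edge q q' e0 n n' : e0 \in S -> uniq S ->
  (forall e, e \in S -> e != e0 -> q' e = q e) -> 0 < q e0 <= M%:R ->
  (n' + M.+1.*2 <= n)%N ->
  neg_dim Q (length_form q) n -> neg_dim Q (length_form q') n'.
Proof.
move=> e0S uS qq' q0 nn' neg.
have Qlin := test_functions_lin; have [Q0 QP] := Qlin.
have card : #|{: bool * 'I_M.+1}| = M.+1.*2 by rewrite card_prod card_bool card_ord mul2n.
have := neg_dim_ker Qlin (node_value_lin e0) _ neg; rewrite card => /(_ n' nn').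
pose phi F : T := ((fun e => if e == e0 then fun _ _ => 0 else F.1 e),
                   (fun e => if e == e0 then fun _ _ => 0 else F.2 e)).
apply: (@neg_dim_map _ _ _ _ _ _ _ phi).
- split; first by split => // j; have := node_value_lin e0 j 1 0 0; rewrite scaler0 addr0; lra.
  move=> a F G [QF F0] [QG G0]; split; first exact: QP.
  by move=> j; rewrite node_value_lin F0 G0 mulr0 addr0.
- move=> a F G; rewrite [RHS]surjective_pairing; congr (_, _);
    apply/funext => e; apply/funext => i; apply/funext => x.
    rewrite [RHS]test_pair_lin /phi /=; case: eqP => _ //.
    by rewrite mulr0 addr0.
  rewrite [RHS]test_pair_lin2 /phi /=; case: eqP => _ //.
  by rewrite mulr0 addr0.
- move=> F [[cF pF mF dF] F0].
  have Fe0 i (b : bool) : F.1 e0 i b%:R = 0.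
    case: b => /=; last by have := F0 (i, ord0); rewrite /node_value/= mul0r.
    have := F0 (i, ord_max); rewrite /node_value/= divff ?mulr1n//.
    by rewrite pnatr_eq0 -lt0n.
  split => /=.
  + by move=> e eS; case: eqP => _; [move=> i z; exact: cvg_cst|exact: cF].
  + move=> e i x eS x01; case: eqP => _; last exact: pF.
    by rewrite add0r Rintegral_zero.
  + move=> e e' b b' i eS e'S nn; have h := mF _ _ _ _ i eS e'S nn.
    case: eqP => [ee0|_]; case: eqP => [ee0'|_] //.
    * by rewrite -h ee0 Fe0.
    * by rewrite h ee0' Fe0.
  + by move=> e b i eS h; case: eqP => // _; exact: dF.
- move=> F [QF F0].
  rewrite /length_form (bigD1_seq e0)//= [leRHS](bigD1_seq e0)//=.
  apply: lerD.
    have z : edge_pairing (fun _ _ => 0 : R) (fun _ _ => 0) = 0.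
      rewrite /edge_pairing big1// => i _.
      by under eq_Rintegral do rewrite mulr0; exact: Rintegral_zero.
    rewrite /kinetic /mass /phi/= eqxx z !mulr0 subr0.
    exact: edge_form_ge0.
  rewrite big_seq_cond [leRHS]big_seq_cond le_eqVlt; apply/orP; left; apply/eqP.
  apply: eq_bigr => e /andP[eS ne].
  by rewrite qq'// /kinetic /mass /phi/= (negPf ne).
Qed.

(** An a priori bound on the number of eigenvalues. It provides a maximal count and lets finite sums
    over [n] suffice; the final estimate does not depend on it. *)
Lemma neg_dim_size q n : (forall e, e \in S -> 0 < q e <= M%:R) ->
  neg_dim Q (length_form q) n -> (n <= size S * M.+1.*2)%N.
Proof.
move=> qM neg.
have := @neg_dim_bound _ _ _ _ n ('I_(size S) * (bool * 'I_M.+1))%type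
  (fun j => node_value (tnth (in_tuple S) j.1) j.2) test_functions_lin _ _ neg.
rewrite !card_prod card_bool !card_ord mul2n; apply.
  by move=> j a F G; exact: node_value_lin.
move=> F QF F0; rewrite /length_form big_seq sumr_ge0// => e eS.
apply: edge_form_ge0 => //; first exact: qM.
move=> j; have [i ei] := tnthP (in_tuple S) e eS.
by have := F0 (i, j); rewrite /= -ei.
Qed.

End finite_dimension.

End test_functions.

(** * Strict eigenvalue counting and its measurability *)

Section open_counting.
Variables (R : realType) (E : choiceType) (S : seq E).
Variables (N : Type) (node : E -> bool -> N) (bd : set N).
Implicit Types (w q : E -> R).
Local Notation Q := (@test_functions R E S N node bd).

Definition rat_lengths (r : seq rat) : E -> R := fun e => ratr (nth 0 r (index e S)).

(* The largest [n] with [neg_open w n] is the number of eigenvalues below 1 of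
   the Laplacian with edge lengths [w]; the rational lengths in the definition
   make the corresponding events countable unions of boxes. *)
Definition neg_open w n := exists r : seq rat,
  (forall e, e \in S -> 0 < rat_lengths r e < w e) /\
  neg_dim Q (length_form S (rat_lengths r)) n.

Lemma neg_openI w q n : (forall e, e \in S -> 0 < q e < w e) ->
  neg_dim Q (length_form S q) n -> neg_open w n.
Proof.
move=> qw neg.
have rho e : exists r : rat, e \in S -> q e < ratr r < w e.
  have [eS|] := boolP (e \in S); last by exists 0.
  have /andP[_ lt] := qw e eS.
  by have [r] := rat_in_itvoo lt; rewrite in_itv/= => ?; exists r.
have [f Hf] := choice rho.
exists [seq f e | e <- S].
have rE e : e \in S -> rat_lengths [seq f e | e <- S] e = ratr (f e).
  by move=> eS; rewrite /rat_lengths (nth_map e) ?index_mem// nth_index.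
split=> [e eS|].
  have /andP[q0 _] := qw e eS; have /andP[qf fw] := Hf e eS.
  by rewrite rE//; apply/andP; split; [exact: lt_trans qf|exact: fw].
apply: neg_dim_mono neg => e eS; rewrite rE//.
have /andP[q0 _] := qw e eS; have /andP[qf _] := Hf e eS.
by rewrite q0; exact: ltW qf.
Qed.

Lemma neg_open_mono w w' n : (forall e, e \in S -> w e <= w' e) ->
  neg_open w n -> neg_open w' n.
Proof.
move=> ww' [r [rw neg]]; exists r; split=> // e eS.
by have /andP[-> lt] := rw e eS; rewrite (lt_le_trans lt)// ww'.
Qed.

Lemma neg_open_leq w m n : (m <= n)%N -> neg_open w n -> neg_open w m.
Proof.
move=> mn [r [rw neg]]; exists r; split => //.
exact: neg_dim_leq (test_functions_lin _ _ _ _) mn neg.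
Qed.

Lemma neg_open_dim w n : neg_open w n -> neg_dim Q (length_form S w) n.
Proof.
move=> [r [rw]]; apply: neg_dim_mono => e /rw/andP[-> /ltW ->] //.
Qed.

Lemma neg_open0 w : (forall e, e \in S -> 0 < w e) -> neg_open w 0.
Proof.
move=> w0; apply: (@neg_openI _ (fun e => w e / 2)); last exact: neg_dim0.
by move=> e /w0 we; apply/andP; split; lra.
Qed.

Lemma neg_open_edge (M : nat) w w' e0 n n' : (0 < M)%N -> e0 \in S -> uniq S ->
  (forall e, e \in S -> e != e0 -> w' e = w e) -> w e0 <= M%:R -> 0 < w' e0 ->
  (n' + M.+1.*2 <= n)%N -> neg_open w n -> neg_open w' n'.
Proof.
move=> M0 e0S uS ww' wM w'0 nn' [r [rw neg]].
(* Only a positive length strictly below [w' e0] is needed on [e0], whose length no longer matters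
   there. *)
pose q' e := if e == e0 then w' e0 / 2 else rat_lengths r e.
apply: (@neg_openI _ q') => [e eS|].
  rewrite /q'; case: eqP => [->|/eqP ne]; last by rewrite ww'//; exact: rw.
  by apply/andP; split; lra.
apply: (neg_dim_edge M0 e0S uS _ _ nn' neg).
  by move=> e eS ne; rewrite /q' (negPf ne).
by have /andP[-> /ltW lt] := rw _ e0S; rewrite (le_trans lt).
Qed.

Lemma neg_open_size (M : nat) w n : (0 < M)%N ->
  (forall e, e \in S -> w e <= M%:R) -> neg_open w n ->
  (n <= size S * M.+1.*2)%N.
Proof.
move=> M0 wM [r [rw neg]]; apply: (neg_dim_size M0 _ neg) => e eS.
by have /andP[-> /ltW lt] := rw e eS; rewrite (le_trans lt)// wM.
Qed.

Lemma measurable_neg_open d (X : measurableType d) (g : X -> E -> R) n :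
  (forall e, measurable_fun setT (fun x => g x e)) ->
  measurable [set x | neg_open (g x) n].
Proof.
move=> mg.
pose P (r : seq rat) := `[< (forall e, e \in S -> 0 < rat_lengths r e) /\
  neg_dim Q (length_form S (rat_lengths r)) n >].
pose B r : set X := if P r then \big[setI/setT]_(e <- S) [set x | rat_lengths r e < g x e]
  else set0.
have -> : [set x | neg_open (g x) n] = \bigcup_r B r.
  apply/seteqP; split=> [x [r [rg neg]]|x [r _]].
    exists r => //; rewrite /B ifT; last first.
      by apply/asboolP; split=> // e /rg/andP[].
    rewrite -bigcap_seq => e /= /rg/andP[] //.
  rewrite /B; case: ifPn => // /asboolP[r0 neg]; rewrite -bigcap_seq => rg.
  by exists r; split=> // e eS; rewrite r0//; exact: rg.
apply: countable_bigcupT_measurable => [|r]; first exact: countableP.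
 rewrite /B; case: ifP => _ //.
apply: bigsetI_measurable => e _.
have := mg e measurableT `]rat_lengths r e, +oo[%classic (measurable_itv _).
rewrite setTI; congr measurable; apply/seteqP; split=> x /=.
  by rewrite in_itv/= andbT.
by rewrite in_itv/= andbT.
Qed.

End open_counting.

(** * Random edge lengths *)

Section product_measures.
Variables (R : realType) (E : choiceType).
Variables (law : E -> probability (measurableTypeR R) R).
Variable (P : probability (length_space R E) R).
Hypothesis PP : product_measure law P.
Local Notation Omega := (length_space R E).

Definition rectangles : set (set Omega) := [set A |
  exists (F : seq E) (B : E -> set (measurableTypeR R)),
    [/\ uniq F, forall e, measurable (B e) &
        A = [set w | forall e, e \in F -> B e (w e)]]].

Lemma measurable_coordinate e :
  measurable_fun setT ((fun w : Omega => w e) : Omega -> measurableTypeR R).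
Proof.
move=> _ B mB; rewrite setTI; apply: sub_gen_smallest.
by exists e, B.
Qed.

Lemma measurable_rectangle A : rectangles A -> measurable A.
Proof.
move=> [F [B [uF mB ->]]].
rewrite [X in measurable X](_ : _ = \big[setI/setT]_(e <- F) [set w : Omega | B e (w e)]).
  apply: bigsetI_measurable => e _.
  by have := @measurable_coordinate e measurableT _ (mB e); rewrite setTI.
by rewrite -bigcap_seq; apply/seteqP; split.
Qed.

Lemma rectangles_setI : setI_closed rectangles.
Proof.
move=> A A' [F [B [uF mB ->]]] [F' [B' [uF' mB' ->]]].
pose C e := (if e \in F then B e else setT) `&` (if e \in F' then B' e else setT).
exists (undup (F ++ F')), C; split.
- exact: undup_uniq.
- by move=> e; apply: measurableI; case: ifP.
apply/seteqP; split=> [w [wB wB'] e|w wC].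
  by move=> _; split; case: ifP => // /[dup] eF; [move/wB|move/wB'].
split=> e eF; have := wC e; rewrite mem_undup mem_cat eF ?orbT => /(_ isT)[].
  by rewrite eF.
by move=> _; rewrite eF.
Qed.

Lemma rectangles_generate : @measurable _ Omega = <<s rectangles >>.
Proof.
apply/seteqP; split=> A.
  apply: smallest_sub A; first exact: smallest_sigma_algebra.
  move=> A [e [B [mB ->]]].
  apply: sub_gen_smallest; exists [:: e], (fun=> B); split => //.
  apply/seteqP; split=> w /=; first by move=> we e'; rewrite inE => /eqP ->.
  by apply; rewrite inE.
apply: smallest_sub; last by move=> B; exact: measurable_rectangle.
exact: sigma_algebra_measurable.
Qed.

Definition resample e (z : Omega * measurableTypeR R) : Omega :=
  fun e' => if e' == e then z.2 else z.1 e'.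

Lemma measurable_resample e : measurable_fun setT (resample e).
Proof.
apply: (measurability rectangles); first exact: rectangles_generate.
move=> _ [_ [F [B [uF mB ->]]] <-]; rewrite setTI.
rewrite [X in measurable X](_ : _ = \big[setI/setT]_(e' <- F)
    [set z : Omega * measurableTypeR R | B e' (resample e z e')]).
  apply: bigsetI_measurable => e' _.
  rewrite /resample; case: eqP => _.
    by have := @measurable_snd _ _ Omega (measurableTypeR R) measurableT _ (mB e'); rewrite setTI.
  have := measurableT_comp (@measurable_coordinate e')
    (@measurable_fst _ _ Omega (measurableTypeR R)).
  by move=> /(_ measurableT _ (mB e')); rewrite setTI.
by rewrite -bigcap_seq; apply/seteqP; split.
Qed.

(** Independence in the only form that is used: [P] is invariant under replacing one coordinate by
    an independent copy. Both measures agree on the rectangles, a generating family closed under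
    intersections. *)
Lemma resample_measure e A : measurable A ->
  P A = (\int[P]_w law e [set x | A (resample e (w, x))])%E.
Proof.
move=> mA.
pose nu := measure_function_pushforward__canonical__measure_function_Measure
  (P \x law e)%E (measurable_resample e).
suff -> : P A = nu A.
  by rewrite /nu/= /pushforward /product_measure1/=; apply: eq_integral => w _;
    rewrite /xsection/=; congr (law e _); apply/seteqP; split => x /=; rewrite inE.
apply: (measure_unique rectangles (fun=> setT)) => //.
- exact: rectangles_generate.
- exact: rectangles_setI.
- by move=> _; exists [::], (fun=> setT); split => //; apply/seteqP; split.
- by apply/seteqP; split => // w _; exists 0%N.
- move=> _ [F [B [uF mB ->]]]; rewrite [LHS](PP uF mB).
  pose F' := [seq e' <- F | e' != e].
  pose A1 : set Omega := [set w | forall e', e' \in F' -> B e' (w e')].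
  pose A2 : set (measurableTypeR R) := if e \in F then B e else setT.
  have -> : nu [set w : Omega | forall e, e \in F -> B e (w e)] = (P \x law e)%E (A1 `*` A2).
    rewrite /nu/= /pushforward; congr ((P \x law e)%E _).
    apply/seteqP; split=> -[w x] /=; rewrite /resample /A1 /A2/=.
      move=> H; split=> [e'|].
        rewrite mem_filter => /andP[ne eF]; have := H _ eF.
        by rewrite (negPf ne).
      by case: ifP => // eF; have := H _ eF; rewrite eqxx.
    move=> [H1 H2] e' eF; case: eqP => [ee|/eqP ne].
      by move: H2; rewrite -ee eF.
    by apply: H1; rewrite mem_filter ne.
  have mA1 : measurable A1.
    by apply: measurable_rectangle; exists F', B; split => //; exact: filter_uniq.
  have mA2 : measurable A2 by rewrite /A2; case: ifP.
  have PA1 : P A1 = (\prod_(e' <- F') law e' (B e'))%E.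
    exact: PP (filter_uniq _ uF) mB.
  rewrite product_measure1E// [X in (X * _)%E]PA1.
  rewrite big_filter /A2; case: ifPn => eF.
    by rewrite (bigD1_seq e)//= muleC.
  rewrite [X in (_ * X)%E](probability_setT (law e)) mule1 [RHS]big_mkcond.
  apply: eq_big_seq => e' e'F.
  by case: eqP => // ee; move: eF; rewrite -ee e'F.
- by move=> _; rewrite [X in (X < _)%E](probability_setT P) ltry.
Qed.

End product_measures.

(** All solutions lie in a window of length [r] starting at the least one, whatever [K] is. *)
Lemma count_window (p : pred nat) (K r : nat) :
  (forall m n, p m -> p n -> (n < m + r)%N) -> (count p (iota 0 K) <= r)%N.
Proof.
move=> win; have [/hasP[n0 _ pn0]|] := boolP (has p (iota 0 K)); last first.
  by rewrite has_count -leqNgt leqn0 => /eqP ->.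
have ex : exists n, p n by exists n0.
have [n1 pn1 n1min] := ex_minnP ex.
rewrite -size_filter -[leqRHS](size_iota n1 r); apply: uniq_leq_size.
  by rewrite filter_uniq// iota_uniq.
by move=> n; rewrite mem_filter !mem_iota => /andP[pn _]; rewrite n1min// win.
Qed.

(** * Expected effect of stretching random lengths *)

Section random_edge_lengths.
Variables (R : realType) (E : choiceType) (lmin lmax Ch : R).
Variables (law : E -> probability (measurableTypeR R) R) (h : E -> R -> R).
Variable (P : probability (length_space R E) R).
Hypotheses (lmin0 : 0 < lmin) (lminmax : lmin <= lmax) (Ch0 : 0 < Ch).
Hypothesis rl : random_lengths lmin lmax Ch law h P.
Notation leb := (@lebesgue_measure R).
Implicit Types (e : E) (B : set (measurableTypeR R)).

Lemma law_le e B : measurable B -> (law e B <= Ch%:E * leb B)%E.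
Proof.
case: rl => _ dens c1 bd _ mB; have [h0 ->] := dens e; last by [].
rewrite -integral_cst//; apply: ge0_le_integral => //.
- by move=> x _; rewrite lee_fin.
- apply/measurable_EFinP; apply: measurable_funTS.
  apply: continuous_measurable_fun => x.
  by apply: differentiable_continuous; apply/derivable1_diffP; have [] := c1 e.
- by move=> x _; rewrite lee_fin (le_trans (ler_norm _))//; have [] := bd e x.
Qed.

Lemma law_support e B : measurable B ->
  (law e B <= law e (B `&` `[lmin, lmax]%classic))%E.
Proof.
case: rl => supp _ _ _ _ mB.
pose I : set (measurableTypeR R) := `[lmin, lmax]%classic.
have mI : measurable I by exact: measurable_itv.
have mC := measurableC mI.
have lawC : law e (~` I) = 0%E.
  by rewrite probability_setC// [X in (_ - X)%E](supp e) subee.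
have mBI := measurableI _ _ mB mI.
apply: (@le_trans _ _ (law e ((B `&` I) `|` ~` I))).
  apply: le_measure; rewrite ?inE//; first exact: measurableU.
  by move=> x Bx; have [Ix|nIx] := pselect (I x); [left|right].
apply: (le_trans (measureU2 _ mBI mC)).
by rewrite [X in (_ + X)%E]lawC adde0.
Qed.

Variables (S : seq E) (N : Type) (node : E -> bool -> N) (bd : set N).
Hypothesis uS : uniq S.
Variable M : nat.
Hypothesis M0 : (0 < M)%N.
Local Notation neg_open := (@neg_open R E S N node bd).

Let resized (w : E -> R) e0 y : E -> R := fun e => if e == e0 then y else w e.

Let resized_mono w e0 x y n : x <= y ->
  neg_open (resized w e0 x) n -> neg_open (resized w e0 y) n.
Proof.
move=> xy; apply: neg_open_mono => e _; rewrite /resized.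
by case: ifP.
Qed.

(** At most 2(M + 1) values of [n] contribute. For each, the critical lengths lie in some
    [x0 / t, x0 t] with x0 <= lmax, whose measure is at most 2 lmax (t - 1), and the density is at
    most [Ch]. *)
Definition jump_constant : R := M.+1.*2%:R * (Ch * (lmax * 2)).

Lemma one_coordinate (w : E -> R) e0 c t K : e0 \in S -> 0 < c -> 1 <= t ->
  lmax * (c * t) <= M%:R ->
  (\sum_(n < K) law e0 [set x | neg_open (resized w e0 (x * (c * t))%R) n.+1] <=
   \sum_(n < K) law e0 [set x | neg_open (resized w e0 (x * c)%R) n.+1] +
   (jump_constant * (t - 1))%:E)%E.
Proof.
move=> e0S c0 t1 tM.
have t0 : 0 < t by rewrite (lt_le_trans _ t1).
pose X (n : nat) : set (measurableTypeR R) := [set x | neg_open (resized w e0 (x * c)) n.+1].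
pose X' (n : nat) : set (measurableTypeR R) := [set x | neg_open (resized w e0 (x * (c * t))) n.+1].
pose I : set (measurableTypeR R) := `[lmin, lmax]%classic.
pose D n := (X' n `\` X n) `&` I.
have mX n d : measurable [set x : measurableTypeR R | neg_open (resized w e0 (x * d)) n.+1].
  apply: measurable_neg_open => e; rewrite /resized; case: eqP => _ //.
  exact: measurable_funM.
have mXn n : measurable (X n) by exact: mX.
have mXn' n : measurable (X' n) by exact: mX.
have mI : measurable I by exact: measurable_itv.
pose p n := `[< D n !=set0 >].
pose beta := Ch * (lmax * 2) * (t - 1).
have beta0 : 0 <= beta.
  by rewrite !mulr_ge0 ?subr_ge0// ltW// (lt_le_trans lmin0).
have X'x n x y : I x -> X' n x -> 0 < y -> forall m, (m + M.+1.*2 <= n.+1)%N ->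
    neg_open (resized w e0 y) m.
  rewrite /I/= in_itv/= => /andP[x0 xM] X'x y0 m mn.
  apply: (neg_open_edge M0 e0S uS _ _ _ mn X'x).
  - by move=> e _ ne; rewrite /resized (negPf ne).
  - rewrite /resized eqxx (le_trans _ tM)// ler_wpM2r// ltW// mulr_gt0//.
  - by rewrite /resized eqxx.
(* If n exceeded m by 2(M + 1), the n + 1 negative dimensions at [y] would leave m + 1 of them at
   every length of [e0], in particular at [x], which is not in [X m]. *)
have window m n : p m -> p n -> (n < m + M.+1.*2)%N.
  move=> /asboolP[x [[_ nX] Ix]] /asboolP[y [[X'y _] Iy]].
  rewrite ltnNge; apply/negP => mn; apply: nX.
  apply: (X'x n y _ Iy X'y) => //.
  move: Ix; rewrite /I/= in_itv/= => /andP[lx _].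
  by rewrite mulr_gt0// (lt_le_trans lmin0).
have lawD n : (law e0 (X' n) <= law e0 (X n) + (if p n then beta else 0)%:E)%E.
  apply: (@le_trans _ _ (law e0 (X n `|` (X' n `\` X n)))).
    apply: le_measure; rewrite ?inE//.
      by apply: measurableU => //; exact: measurableD.
    by move=> x X'nx; have [Xx|nXx] := pselect (X n x); [left|right].
  have mDX : measurable (X' n `\` X n) by exact: measurableD.
  apply: (le_trans (measureU2 _ (mXn n) mDX)); apply: leeD2l.
  (* Restricting to the support of the law bounds the reference point x0 below by [lmin], hence away
     from 0, and above by [lmax]. *)
  apply: (le_trans (law_support e0 mDX)).
  case: ifPn => [/asboolP[x0 [[X'x0 nXx0] Ix0]]|/asboolPn/set0P/negP]; last first.
    by rewrite negbK => /eqP D0; rewrite -/I -/(D n) D0 measure0.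
  (* Were two points of [D n] more than a factor [t] apart, the smaller one stretched by [t] would
     not exceed the larger one, which would then lie in [X n] by monotonicity. *)
  have D_sub : D n `<=` `[x0 / t, x0 * t]%classic.
    move=> y [[X'y nXy] Iy] /=; rewrite in_itv/=; apply/andP; split.
      rewrite ler_pdivrMr// leNgt; apply/negP => yx; apply: nXx0.
      by apply: resized_mono X'y; rewrite [c * t]mulrC mulrA ler_pM2r// ltW.
    rewrite leNgt; apply/negP => yx; apply: nXy.
    by apply: resized_mono X'x0; rewrite [c * t]mulrC mulrA ler_pM2r// ltW.
  have mJ : measurable (`[x0 / t, x0 * t]%classic : set (measurableTypeR R)).
    exact: measurable_itv.
  apply: (@le_trans _ _ (law e0 `[x0 / t, x0 * t]%classic)).
    by apply: le_measure; rewrite ?inE//; exact: measurableI.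
  apply: (le_trans (law_le e0 mJ)).
  move: Ix0; rewrite /I/= in_itv/= => /andP[lx0 x0l].
  have x00 : 0 < x0 by exact: lt_le_trans lx0.
  have le1 : x0 / t <= x0 * t.
    by rewrite ler_pM2l// (le_trans _ t1)// invf_le1.
  rewrite lebesgue_measure_itv/= lte_fin; case: ifPn => _; last first.
    by rewrite mule0 lee_fin.
  rewrite -EFinD -EFinM lee_fin /beta -mulrA ler_pM2l// -mulrBr -mulrA.
  apply: ler_pM => //; first exact: ltW.
    by rewrite subr_ge0 (le_trans _ t1)// invf_le1.
  have ti : 1 - t^-1 <= t - 1.
    have -> : 1 - t^-1 = (t - 1) * t^-1 by rewrite mulrBl divff ?gt_eqF// mul1r.
    by rewrite ler_piMr ?subr_ge0// invf_le1.
  lra.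
apply: (@le_trans _ _ (\sum_(n < K) (law e0 (X n) + (if p n then beta else 0)%:E))%E).
  by apply: lee_sum => n _; exact: lawD.
rewrite big_split/= leeD2l// sumEFin lee_fin -big_mkcond/= sumr_const -mulr_natr.
rewrite /jump_constant mulrC -mulrA -/beta ler_wpM2r// ler_nat.
apply: leq_trans (count_window K window).
have iotaE : iota 0 K = index_iota 0 K by rewrite /index_iota subn0.
rewrite -sum1_card -sum1_count iotaE big_mkord.
by rewrite leq_eqVlt; apply/orP; left; apply/eqP; apply: eq_bigl.
Qed.

(** At least n + 1 eigenvalues below 1, as the event of at least 0 carries no information. The
    dilation [kappa] may vary with the edge, so that edges can be stretched one at a time. *)
Definition many_eigenvalues (kappa : E -> R) n : set (length_space R E) :=
  [set w | neg_open (fun e => w e * kappa e) n.+1].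

Lemma measurable_many_eigenvalues kappa n : measurable (many_eigenvalues kappa n).
Proof.
apply: measurable_neg_open => e; apply: measurable_funM => //.
exact: measurable_coordinate.
Qed.

Let measurable_section A e : measurable A ->
  measurable_fun setT (fun w => law e [set x | A (resample e (w, x))]).
Proof.
move=> mA; have := @measurable_resample R E e measurableT _ mA; rewrite setTI => mrA.
rewrite (_ : (fun w => _) = law e \o xsection (@resample R E e @^-1` A)).
  exact: measurable_fun_xsection.
apply/funext => w /=; congr (law e _).
by apply/seteqP; split => x; rewrite /xsection/= inE.
Qed.

(** The pointwise bound [one_coordinate] is integrated over the other lengths: [resample_measure]
    turns every probability into the mean of the law of its section along [e0]. *)
Lemma stretch_edge kappa kappa' e0 t K : e0 \in S -> 0 < kappa e0 -> 1 <= t ->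
  (forall e, kappa' e = if e == e0 then kappa e0 * t else kappa e) ->
  lmax * (kappa e0 * t) <= M%:R ->
  (\sum_(n < K) P (many_eigenvalues kappa' n) <=
   \sum_(n < K) P (many_eigenvalues kappa n) + (jump_constant * (t - 1))%:E)%E.
Proof.
move=> e0S k0 t1 kE tM; have PP : product_measure law P by case: rl.
have t0 : 0 < t by rewrite (lt_le_trans _ t1).
have J0 : 0 <= jump_constant * (t - 1).
  by rewrite !mulr_ge0 ?subr_ge0// ltW// (lt_le_trans lmin0).
have mm ka n := measurable_many_eigenvalues ka n.
have PE ka : (\sum_(n < K) P (many_eigenvalues ka n) = \int[P]_w
    \sum_(n < K) law e0 [set x | many_eigenvalues ka n (resample e0 (w, x))])%E.
  rewrite ge0_integral_sum//; last by move=> n; exact: measurable_section.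
  by apply: eq_bigr => n _; rewrite (resample_measure PP e0).
have cstE : ((jump_constant * (t - 1))%:E = \int[P]_w (jump_constant * (t - 1))%:E)%E.
  by rewrite integral_cst// [X in (_ * X)%E](probability_setT P) mule1.
have msum ka : measurable_fun setT (fun w => \sum_(n < K)
    law e0 [set x | many_eigenvalues ka n (resample e0 (w, x))])%E.
  by apply: emeasurable_sum => n; exact: measurable_section.
rewrite !PE [X in (_ <= _ + X)%E]cstE -ge0_integralD//; last first.
  by move=> w _; exact: sume_ge0.
apply: ge0_le_integral => //.
- by move=> w _; exact: sume_ge0.
- by apply: emeasurable_funD.
move=> w _.
have secE ka n : [set x | many_eigenvalues ka n (resample e0 (w, x))] =
    [set x : measurableTypeR R |
      neg_open (resized (fun e => w e * ka e) e0 (x * ka e0)) n.+1].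
  apply/seteqP; split=> x; rewrite /many_eigenvalues/= /resample/=;
    congr (neg_open _ _); apply/funext => e; rewrite /resized;
    by case: eqP => // ->.
under eq_bigr do rewrite secE.
under [X in (_ <= X + _)%E]eq_bigr do rewrite secE.
have -> : kappa' e0 = kappa e0 * t by rewrite kE eqxx.
have resE y : resized (fun e => w e * kappa' e) e0 y = resized (fun e => w e * kappa e) e0 y.
  by apply/funext => e; rewrite /resized kE; case: eqP.
under eq_bigr do under eq_set do rewrite resE.
exact: one_coordinate.
Qed.

(** Induction on the list of edges already stretched. The cost of an edge involves only its own
    length, so every step costs the same. *)
Lemma stretch_all (c t : R) K : 0 < c -> 1 <= t -> lmax * (c * t) <= M%:R ->
  (\sum_(n < K) P (many_eigenvalues (fun=> c * t)%R n) <=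
   \sum_(n < K) P (many_eigenvalues (fun=> c) n) +
   ((size S)%:R * (jump_constant * (t - 1)))%:E)%E.
Proof.
move=> c0 t1 tM.
pose kappa (l : seq E) e := if e \in l then c * t else c.
suff H l : uniq l -> {subset l <= S} -> (\sum_(n < K) P (many_eigenvalues (kappa l) n) <=
   \sum_(n < K) P (many_eigenvalues (fun=> c) n) +
   ((size l)%:R * (jump_constant * (t - 1)))%:E)%E.
  have := H S uS (fun _ => id); congr (_ <= _)%E; apply: eq_bigr => n _; congr (P _).
  apply/seteqP; split=> w; apply: neg_open_mono => e eS; by rewrite /kappa eS.
elim: l => [_ _|e0 l IH /= /andP[e0l ul] sub].
  by rewrite mul0r adde0.
have e0S : e0 \in S by apply: sub; rewrite inE eqxx.
have k0 : kappa l e0 = c by rewrite /kappa (negPf e0l).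
have := @stretch_edge (kappa l) (kappa (e0 :: l)) e0 t K e0S.
rewrite k0 => /(_ c0 t1 _ tM) step.
apply: (le_trans (step _)).
  by move=> e; rewrite /kappa inE; case: eqP.
rewrite -addn1 natrD mulrDl mul1r EFinD addeA leeD2r//.
by apply: IH => // e el; apply: sub; rewrite inE el orbT.
Qed.

Lemma expected_new_eigenvalues (c t : R) K : 0 < c -> 1 <= t -> lmax * (c * t) <= M%:R ->
  (\int[P]_w (\sum_(n < K) (\1_(many_eigenvalues (fun=> c * t)%R n `\`
     many_eigenvalues (fun=> c) n) w)%:E) <=
   ((size S)%:R * (jump_constant * (t - 1)))%:E)%E.
Proof.
move=> c0 t1 tM; have t0 : 0 < t by rewrite (lt_le_trans _ t1).
have mm ka n := measurable_many_eigenvalues ka n.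
rewrite ge0_integral_sum//; last first.
  by move=> n; apply/measurable_EFinP; apply: measurable_indic; exact: measurableD.
have sub n : many_eigenvalues (fun=> c) n `<=` many_eigenvalues (fun=> c * t)%R n.
  move=> w [r [rw neg]]; exists r; split=> // e eS.
  have /andP[r0 rc] := rw e eS; rewrite r0 (lt_le_trans rc)// mulrA.
  by rewrite ler_peMr//; exact: (le_trans (ltW r0) (ltW rc)).
have PE ka n : P (many_eigenvalues ka n) = (fine (P (many_eigenvalues ka n)))%:E.
  by rewrite fineK//; exact: fin_num_measure.
have -> : (\sum_(n < K) \int[P]_w (\1_(many_eigenvalues (fun=> c * t)%R n `\`
     many_eigenvalues (fun=> c) n) w)%:E = \sum_(n < K)
     (fine (P (many_eigenvalues (fun=> c * t)%R n)) -
      fine (P (many_eigenvalues (fun=> c) n)))%R%:E)%E.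
  apply: eq_bigr => n _; rewrite integral_indic//; last exact: measurableD.
  rewrite setIT measureD//; last by rewrite [X in (X < _)%E]PE ltry.
  by rewrite setIidr// [X in (X - _)%E]PE [X in (_ - X)%E]PE -EFinB.
have := stretch_all K c0 t1 tM.
under eq_bigr do rewrite PE.
under [X in (_ <= X + _)%E -> _]eq_bigr do rewrite PE.
by rewrite !sumEFin -EFinD !lee_fin sumrB lerBlDl.
Qed.

End random_edge_lengths.

(** * The Dirichlet Laplacian of a subgraph *)

Section scaling.
Variable R : realType.
Notation leb := (@lebesgue_measure R).
Implicit Types (f : R -> R) (c x : R).

Lemma within_scale f c x : 0 < c -> {within `[0, c * x], continuous f} ->
  {within `[0, x], continuous (fun t => f (c * t))}.
Proof.
move=> c0 /subspace_continuousP cf; apply/subspace_continuousP => t tx.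
have ctx s : `[0, x]%classic s -> `[0, c * x]%classic (c * s).
  rewrite /= !in_itv/= => /andP[s0 sx].
  by rewrite mulr_ge0 ?(ltW c0)//= ler_pM2l.
move=> U /(cf _ (ctx _ tx)) /= nU.
have cM : (fun s => c * s) @ t --> c * t by apply: cvgM; [exact: cvg_cst|exact: cvg_id].
have := cM _ nU; rewrite /nbhs/= => nU'.
by rewrite /within/=; near=> s => /ctx; near: s.
Unshelve. all: by end_near.
Qed.

Lemma Rintegral_scale f c x : 0 < c -> 0 <= x ->
  {within `[0, c * x], continuous f} ->
  \int[leb]_(t in `[0, c * x]) f t = c * \int[leb]_(t in `[0, x]) f (c * t).
Proof.
move=> c0 x0 cf; pose F := fun t : R => c * t.
have dF : F^`()%classic = (fun=> c).
  apply/funext => t; rewrite derive1E (_ : F = c \*: (id : R -> R))// deriveZ//.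
  by rewrite derive_id /GRing.scale/= mulr1.
have cF : continuous F by move=> t; apply: cvgM; [exact: cvg_cst|exact: cvg_id].
have := @integration_by_substitution_increasing R F f 0 x x0.
rewrite dF /F mulr0 => sub.
rewrite -RintegralZl//; last exact: itv_cont_integrable (within_scale c0 cf).
rewrite /Rintegral sub//.
- by congr fine; apply: eq_integral => t _; rewrite mulrC.
- by move=> s t _ _ st; rewrite ltr_pM2l.
- by move=> t _; exact: cvg_cst.
- exact: is_cvg_cst.
- exact: is_cvg_cst.
- split => /=.
  + by move=> t _; exact: derivableZ.
  + by apply: cvg_at_right_filter; exact: cF.
  + by apply: cvg_at_left_filter; exact: cF.
Qed.

End scaling.

Section square_integrable_functions.
Variable R : realType.
Notation leb := (@lebesgue_measure R).
Implicit Types (f g : R -> R) (D : set R).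

Definition real_L2 D f := measurable_fun D f /\
  leb.-integrable D (fun x => (f x ^+ 2)%:E).

Lemma real_L2M D f g : measurable D -> real_L2 D f -> real_L2 D g ->
  leb.-integrable D (fun x => (f x * g x)%:E).
Proof.
move=> mD [mf f2] [mg g2].
apply: (@le_integrable _ _ _ leb D mD _ (fun x => (f x ^+ 2 + g x ^+ 2)%:E)) => //.
- by apply/measurable_EFinP; exact: measurable_funM.
- move=> x _; rewrite !abse_EFin lee_fin normrM.
  have F : `|f x ^+ 2 + g x ^+ 2| = `|f x| ^+ 2 + `|g x| ^+ 2.
    by rewrite ger0_norm ?addr_ge0 ?sqr_ge0// !real_normK ?num_real.
  rewrite F; move: `|f x| `|g x| (normr_ge0 (f x)) (normr_ge0 (g x)) => p q p0 q0.
  nra.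
- rewrite (_ : (fun x => _) = (fun x => (f x ^+ 2)%:E) \+ (fun x => (g x ^+ 2)%:E))%E.
    exact: integrableD.
  by apply/funext => x; rewrite EFinD.
Qed.

Lemma real_L2_lin D (a : R) f g : measurable D -> real_L2 D f -> real_L2 D g ->
  real_L2 D (fun x => a * f x + g x).
Proof.
move=> mD Lf Lg; have fg := real_L2M mD Lf Lg; have [[mf f2] [mg g2]] := (Lf, Lg).
split; first by apply: measurable_funD => //; exact: measurable_funM.
rewrite (_ : (fun x => _) = ((fun x => (a ^+ 2)%:E * (f x ^+ 2)%:E) \+
    ((fun x => (2 * a)%:E * (f x * g x)%:E) \+ (fun x => (g x ^+ 2)%:E)))%E).
  by apply: integrableD => //; [exact: integrableZl|apply: integrableD => //; exact: integrableZl].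
by apply/funext => x; rewrite /= -!EFinM -!EFinD; congr EFin; ring.
Qed.

Lemma real_L2_integrable l f : real_L2 `[0, l] f ->
  leb.-integrable `[0, l] (EFin \o f).
Proof.
move=> Lf; have mI : measurable (`[0, l]%classic : set R) by exact: measurable_itv.
have c1 : {within `[0, l], continuous (fun=> 1 : R)} by move=> z; exact: cvg_cst.
have L1 : real_L2 `[0, l] (fun=> 1).
  by split => //; exact: itv_cont_integrable (withinX2 c1).
have := real_L2M mI Lf L1.
by apply: eq_integrable => // x _; rewrite mulr1.
Qed.

Lemma itv_cont_real_L2 l f : {within `[0, l], continuous f} -> real_L2 `[0, l] f.
Proof.
move=> cf; split; last exact: itv_cont_integrable (withinX2 cf).
by apply: subspace_continuous_measurable_fun.
Qed.

End square_integrable_functions.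

Section integration_by_parts.
Variables (R : realType) (l : R) (h f1 G0 G1 : R -> R).
Notation leb := (@lebesgue_measure R).
Hypothesis l0 : 0 <= l.
Hypothesis ih : leb.-integrable `[0, l] (EFin \o h).
Hypothesis primf : forall x, 0 <= x <= l -> f1 x = f1 0 + \int[leb]_(t in `[0, x]) h t.
Hypothesis cG1 : {within `[0, l], continuous G1}.
Hypothesis primG : forall x, 0 <= x <= l -> G0 x = G0 0 + \int[leb]_(t in `[0, x]) G1 t.

Let iG := itv_cont_integrable cG1.

Let EFin_Rintegral (D : set R) (f : R -> R) : measurable D ->
  leb.-integrable D (EFin \o f) ->
  (\int[leb]_(x in D) (f x)%:E = (\int[leb]_(x in D) f x)%R%:E)%E.
Proof. by move=> mD fi; rewrite /Rintegral fineK//; exact: integrable_fin_num fi. Qed.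

Lemma integrableM_cont (g : R -> R) : {within `[0, l], continuous g} ->
  leb.-integrable `[0, l] (EFin \o (fun x => h x * g x)).
Proof.
move=> cg; apply: (integrableMl _ ih) => //.
  by apply: subspace_continuous_measurable_fun.
have [M [_ mrt]] := compact_bounded (continuous_compact cg (@segment_compact _ 0 l)).
by exists M; split; rewrite ?num_real // => ? ? ? ?; exact: mrt.
Qed.

Let h0 := h \_ `[0, l].
Let g0 := G1 \_ `[0, l].
(** Since [h] is merely integrable, integration by parts is Fubini's theorem for h(t) G1(x) on the
    triangle t <= x: integrating first in x produces G0(l) - G0(t), first in t produces f1(x) -
    f1(0). *)
Let Phi (z : R * R) : \bar R := (h0 z.1 * g0 z.2 * (z.1 <= z.2)%R%:R)%:E.

Let mI : measurable (`[0, l]%classic : set (measurableTypeR R)).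
Proof. exact: measurable_itv. Qed.

Let ih0 : leb.-integrable setT (EFin \o h0).
Proof. by rewrite /h0 -restrict_EFin; apply: (integrable_mkcond _ mI).1. Qed.

Let ig0 : leb.-integrable setT (EFin \o g0).
Proof. by rewrite /g0 -restrict_EFin; apply: (integrable_mkcond _ mI).1. Qed.

Let mPhi : measurable_fun setT Phi.
Proof.
have mh : measurable_fun setT h0 by apply/measurable_EFinP; exact: measurable_int ih0.
have mg : measurable_fun setT g0 by apply/measurable_EFinP; exact: measurable_int ig0.
apply/measurable_EFinP; apply: measurable_funM.
  by apply: measurable_funM; exact: measurableT_comp.
have mle : measurable_fun setT (fun z : R * R => z.1 <= z.2).
  exact: measurable_fun_ler.
have -> : (fun z : R * R => (z.1 <= z.2)%R%:R) = \1_[set z | z.1 <= z.2] :> (R * R -> R).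
  by apply/funext => z; rewrite indicE mem_setE.
apply: measurable_indic.
have := mle measurableT [set true] I; rewrite setTI.
by congr measurable; apply/seteqP; split => z /=; case: (_ <= _).
Qed.

Let iPhi : (leb \x leb)%E.-integrable setT
  (Phi : (measurableTypeR R * measurableTypeR R)%type -> \bar R).
Proof.
apply/integrable12ltyP; first exact: mPhi.
set N := (\int[leb]_x `|(EFin \o g0) x|)%E.
have Nfin : (N < +oo)%E by have /integrableP[] := ig0.
have N0 : (0 <= N)%E by exact: integral_ge0.
apply: (@le_lt_trans _ _ (\int[leb]_t (`|(EFin \o h0) t| * N))%E).
  have mabs : measurable_fun setT (fun x => `|(EFin \o g0) x|%E).
    by apply: measurableT_comp => //; exact: measurable_int ig0.
  apply: ge0_le_integral => //.
  - by move=> t _; exact: integral_ge0.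
  - apply: (@measurable_fun_fubini_tonelli_F _ _ _ _ R leb (abse \o Phi)).
      exact: measurableT_comp.
    by move=> z; exact: abse_ge0.
  - apply: emeasurable_funM => //.
    by apply: measurableT_comp => //; exact: measurable_int ih0.
  - move=> t _; rewrite -ge0_integralZl//.
    apply: ge0_le_integral => //.
    + apply: measurableT_comp => //; apply: (measurableT_comp mPhi).
      exact: measurable_pair1.
    + exact: measurable_funeM.
    + move=> x _; rewrite /Phi/= -EFinM lee_fin !normrM ler_piMr ?mulr_ge0//.
      by case: (t <= x); rewrite ?normr1 ?normr0.
rewrite ge0_integralZr//.
  apply: lte_mul_pinfty => //; first exact: integral_ge0.
  rewrite ge0_fin_numE; first by have /integrableP[_] := ih0.
  exact: integral_ge0.
by apply: measurableT_comp => //; exact: measurable_int ih0.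
Qed.

Let inner_x t : (\int[leb]_x Phi (t, x) =
  ((fun t => (h t * (G0 l - G0 t))%R%:E) \_ `[0%R, l]) t)%E.
Proof.
rewrite patchE; case: ifPn => [|tl]; last first.
  by rewrite integral0_eq// => x _; rewrite /Phi/= /h0 patchE (negPf tl) !mul0r.
rewrite inE/= in_itv/= => /andP[t0 tl].
have cht : {within `[0, l], continuous (fun x => h t * G1 x)}.
  by apply: withinM => // z; exact: cvg_cst.
have itl : leb.-integrable `[t, l] (EFin \o G1).
  by apply: integrableS iG => //; exact: sub_itvcc.
transitivity (\int[leb]_(x in `[t, l]) (h t * G1 x)%:E)%E.
  rewrite [RHS]integral_mkcond; apply: eq_integral => x _.
  rewrite /Phi/= /h0 /g0 !patchE.
  have -> : t \in `[0, l]%classic by rewrite inE/= in_itv/= t0.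
  have [xtl|xtl] := boolP (x \in `[t, l]%classic).
    move: xtl; rewrite inE/= in_itv/= => /andP[tx xl].
    by rewrite tx mem_set ?mulr1//= in_itv/= xl (le_trans t0).
  case: ifPn => [|_]; last by rewrite mulr0 mul0r.
  rewrite inE/= in_itv/= => /andP[x0 xl].
  have [tx|_] := leP t x; last by rewrite mulr0.
  by move: xtl; rewrite notin_setE/= in_itv/= tx xl.
rewrite (@EFin_Rintegral _ (fun x => h t * G1 x))//; last first.
  by apply: integrableS (itv_cont_integrable cht) => //; exact: sub_itvcc.
by rewrite RintegralZl// (primitiveB iG primG)//.
Qed.

Let inner_t x : (\int[leb]_t Phi (t, x) =
  ((fun x => ((f1 x - f1 0) * G1 x)%R%:E) \_ `[0%R, l]) x)%E.
Proof.
rewrite patchE; case: ifPn => [|xl]; last first.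
  by rewrite integral0_eq// => t _; rewrite /Phi/= /g0 patchE (negPf xl) mulr0 mul0r.
rewrite inE/= in_itv/= => /andP[x0 xl].
have i0x : leb.-integrable `[0, x] (EFin \o h).
  by apply: integrableS ih => //; exact: sub_itvcc.
transitivity (\int[leb]_(t in `[0%R, x]) (h t * G1 x)%:E)%E.
  rewrite [RHS]integral_mkcond; apply: eq_integral => t _.
  rewrite /Phi/= /h0 /g0 !patchE.
  have -> : x \in `[0, l]%classic by rewrite inE/= in_itv/= x0.
  have [t0x|t0x] := boolP (t \in `[0, x]%classic).
    move: t0x; rewrite inE/= in_itv/= => /andP[t0 tx].
    by rewrite tx mem_set ?mulr1//= in_itv/= t0 (le_trans tx).
  case: ifPn => [|_]; last by rewrite !mul0r.
  rewrite inE/= in_itv/= => /andP[t0 tl].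
  have [tx|_] := leP t x; last by rewrite mulr0.
  by move: t0x; rewrite notin_setE/= in_itv/= tx t0.
have cst : {within `[0, l], continuous (fun _ : R => G1 x)} by move=> z; exact: cvg_cst.
rewrite (@EFin_Rintegral _ (fun t => h t * G1 x))//; last first.
  by apply: integrableS (integrableM_cont cst) => //; exact: sub_itvcc.
rewrite RintegralZr//; congr (_ * _)%:E.
by rewrite (primitiveB ih primf).
Qed.

Lemma integration_by_parts_ac :
  \int[leb]_(t in `[0, l]) (h t * G0 t) =
  f1 l * G0 l - f1 0 * G0 0 - \int[leb]_(x in `[0, l]) (f1 x * G1 x).
Proof.
have cf1 := primitive_continuous ih primf l0.
have cG0 := primitive_continuous iG primG l0.
have := Fubini iPhi.
under eq_integral do rewrite inner_x.
under [X in _ = X -> _]eq_integral do rewrite inner_t.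
have cst (c : R) : {within `[0, l], continuous (fun _ : R => c)} by move=> z; exact: cvg_cst.
rewrite -!integral_mkcond.
have c2 : {within `[0, l], continuous (fun t => G0 l - G0 t)}.
  by move=> z; apply: cvgB; [exact: cst|exact: cG0].
have c3 : {within `[0, l], continuous (fun x => f1 x - f1 0)}.
  by move=> z; apply: cvgB; [exact: cf1|exact: cst].
have i2 := integrableM_cont c2.
have i3 := itv_cont_integrable (withinM c3 cG1).
rewrite !EFin_Rintegral// => -[].
have -> : \int[leb]_(t in `[0, l]) (h t * (G0 l - G0 t)) =
    \int[leb]_(t in `[0, l]) (h t * G0 l - h t * G0 t).
  by apply: eq_Rintegral => t _; ring.
have -> : \int[leb]_(x in `[0, l]) ((f1 x - f1 0) * G1 x) =
    \int[leb]_(x in `[0, l]) (f1 x * G1 x - f1 0 * G1 x).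
  by apply: eq_Rintegral => t _; ring.
rewrite RintegralB//; [|exact: (integrableM_cont (cst _))|exact: integrableM_cont].
rewrite RintegralB//; [|exact: itv_cont_integrable (withinM cf1 cG1)
                       |exact: itv_cont_integrable (withinM (cst _) cG1)].
rewrite RintegralZr// RintegralZl// -(primitiveB ih primf)// -(primitiveB iG primG)//.
lra.
Qed.

End integration_by_parts.

(** * Topology of compact subgraphs *)

Section graph_topology.
Variables (R : realType) (X : topological_graph R) (La : set X).
Implicit Types (e : tg_edge X) (b : bool).

Definition node e b : X := tg_map e b%:R.

Let midpoint e : X := tg_map e (2^-1 : R).

Let half_itv : (2^-1 : R) \in `]0, 1[.
Proof. by rewrite in_itv/=; apply/andP; split; lra. Qed.

Let midpoint_cell e : (tg_map e @` `]0, 1[%classic) (midpoint e).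
Proof. by exists 2^-1. Qed.

Let map_midpoint e e' (x : R) : x \in `[0, 1] -> tg_map e x = midpoint e' ->
  e = e' /\ x = 2^-1.
Proof.
rewrite in_itv/= => /andP[x0 x1] ex.
have novertex : ~ @tg_vertex _ X (midpoint e').
  move=> V; have : (tg_map e' @` `]0, 1[%classic `&` @tg_vertex _ X) (midpoint e').
    by split => //; exact: midpoint_cell.
  by rewrite tg_disjoint_vertex.
have [E0 E1] := tg_ends e.
have {x0} x0 : 0 < x.
  by rewrite lt_neqAle x0 andbT; apply/eqP => x0'; apply: novertex; rewrite -ex -x0'.
have {x1} x1 : x < 1.
  by rewrite lt_neqAle x1 andbT; apply/eqP => x1'; apply: novertex; rewrite -ex x1'.
have xI : x \in `]0, 1[ by rewrite in_itv/= x0.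
have ee' : e = e'.
  apply: contrapT => /tg_disjoint_edge d.
  have : (tg_map e @` `]0, 1[%classic `&` tg_map e' @` `]0, 1[%classic) (midpoint e').
    by split; [exists x|exact: midpoint_cell].
  by rewrite d.
split=> //; apply: (@tg_injective _ X e); rewrite ?inE//.
by rewrite ex ee'.
Qed.

Let midpoint_inj e e' : midpoint e = midpoint e' -> e = e'.
Proof.
move=> /map_midpoint; case => //.
by rewrite in_itv/=; apply/andP; split; lra.
Qed.

Let closed_midpoints (D : set (tg_edge X)) : closed (midpoint @` D).
Proof.
apply: tg_weak => e; have [De|nDe] := pselect (D e).
  rewrite [X in closed X](_ : _ = [set 2^-1]); first exact: closed_eq.
  apply/seteqP; split=> x /=.
    by move=> [x01 [e' _ /esym/map_midpoint]] => /(_ x01)[].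
  move=> ->; split; last by exists e.
  by rewrite in_itv/=; apply/andP; split; lra.
rewrite [X in closed X](_ : _ = set0); first exact: closed0.
apply/seteqP; split=> x //= [x01 [e' De' /esym/map_midpoint]] => /(_ x01)[ee' _].
by apply: nDe; rewrite ee'.
Qed.

(** In the weak topology every set of midpoints is closed. Were there infinitely many edges, the
    cofinite filter on their midpoints would cluster at some point of [La]; but the midpoints other
    than that point form a closed set that belongs to the filter and misses it. *)
Lemma finite_sub_edges : compact La -> finite_set (sub_edges La).
Proof.
move=> cLa; apply: contrapT => infS.
pose F : set_system X := [set U | finite_set [set e | sub_edges La e /\ ~ U (midpoint e)]].
have FF : ProperFilter F.
  split.
    rewrite /F/= => fin; apply: infS; apply: sub_finite_set fin => e eS.
    by split.
  split.
  - by rewrite /F/= [X in finite_set X](_ : _ = set0)//; apply/seteqP; split => // e [_].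
  - move=> U W FU FW; have FUW : finite_set ([set e | sub_edges La e /\ ~ U (midpoint e)] `|`
        [set e | sub_edges La e /\ ~ W (midpoint e)]) by rewrite finite_setU.
    apply: sub_finite_set FUW => e [eS nUW].
    have [Ue|nUe] := pselect (U (midpoint e)); last by left.
    by right; split => // We; apply: nUW.
  - move=> U W UW FU; apply: sub_finite_set FU => e [eS nW].
    by split => // /UW.
have FLa : F La.
  rewrite /F/= [X in finite_set X](_ : _ = set0)//; apply/seteqP; split => // e [eS].
  apply; apply: eS; exists 2^-1 => //=.
  by rewrite in_itv/=; apply/andP; split; lra.
have [x [Lax clx]] := cLa F FF FLa.
pose D := [set e | sub_edges La e /\ midpoint e <> x].
have nx : nbhs x (~` (midpoint @` D)).
  apply: open_nbhs_nbhs; split; first exact/closed_openC/closed_midpoints.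
  by move=> [e [_ ne] ex].
have FD : F (midpoint @` D).
  rewrite /F/=.
  have sub : [set e | sub_edges La e /\ ~ (midpoint @` D) (midpoint e)] `<=`
      [set e | midpoint e = x].
    move=> e [eS nD] /=; apply: contrapT => ne; apply: nD; exists e => //.
  apply: (sub_finite_set sub).
  have [[e0 e0x]|none] := pselect (exists e0, midpoint e0 = x).
    apply: (sub_finite_set _ (finite_set1 e0)) => e /= ex.
    by apply: midpoint_inj; rewrite ex.
  rewrite [X in finite_set X](_ : _ = set0)//; apply/seteqP; split => // e ex.
  by apply: none; exists e.
by have [y []] := clx _ _ FD nx.
Qed.

Hypothesis sub : subgraph La.

Lemma node_in e b : sub_edges La e -> sub_vertices La (node e b).
Proof.
move=> eS; split; last by have [] := tg_ends e; case: b.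
by apply: eS; exists b%:R => //=; rewrite in_itv/=; case: b => /=; rewrite ?lexx ?ler01.
Qed.

(** Near an interior vertex the open cell of [e] meets [La], so the whole closed edge lies in it.
    Thus the Kirchhoff sums, taken over the edges of the full graph, only involve edges of the
    subgraph. *)
Lemma interior_edges e b : (La `\` boundary La) (node e b) -> sub_edges La e.
Proof.
move=> [Lav nbd].
have nLa : nbhs (node e b) La.
  apply: contrapT => nn; apply: nbd; split => // B nB; apply: contrapT => none.
  apply: nn; apply: filterS nB => y By; apply: contrapT => nLay.
  by apply: none; exists y.
apply: sub.
have bI : `[0, 1]%classic (b%:R : R) by rewrite /= in_itv/=; case: (b) => /=; rewrite ?lexx ?ler01.
have /subspace_continuousP/(_ _ bI) cv := @tg_continuous _ X e.
have /nbhs_ballP[d /= d0 db] := cv _ nLa.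
pose r := Num.min d 1 / 2.
have r0 : 0 < r by rewrite divr_gt0// lt_min d0 ltr01.
have md : Num.min d 1 <= d by rewrite ge_min lexx.
have m1 : Num.min d 1 <= 1 by rewrite ge_min lexx orbT.
have rd : r < d by move: r0; rewrite /r => ?; lra.
have r1 : r < 1 by move: r0; rewrite /r => ?; lra.
pose x : R := if b then 1 - r else r.
have xI : x \in `]0, 1[.
  by rewrite in_itv/= /x; case: (b); apply/andP; split; lra.
exists (tg_map e x); split; first by exists x.
apply: db; last first.
  by move: xI; rewrite /= !in_itv/= => /andP[/ltW -> /ltW ->].
rewrite /ball/= /x; case: (b) => /=.
  by rewrite opprB addrC subrK gtr0_norm.
by rewrite sub0r normrN gtr0_norm.
Qed.

End graph_topology.

(** * Restriction of scalars to the reals *)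

Section real_structure.
Variables (R : realType) (H : lmodType R[i]).

(** A new name, so that the same vectors can carry a real module structure. A complex orthonormal
    basis is only half of a real one, but [trace_le_rank] asks for an orthonormal family only. *)
Definition realified : Type := H.

HB.instance Definition _ := GRing.Zmodule.on realified.

Definition real_scale (a : R) (v : realified) : realified := (a%:C)%C *: (v : H).

Lemma real_scaleA a b v : real_scale a (real_scale b v) = real_scale (a * b) v.
Proof. by rewrite /real_scale scalerA -rmorphM. Qed.

Lemma real_scale1 : left_id 1 real_scale.
Proof. by move=> v; rewrite /real_scale rmorph1 scale1r. Qed.

Lemma real_scaleDr : right_distributive real_scale +%R.
Proof. by move=> a u v; rewrite /real_scale scalerDr. Qed.

Lemma real_scaleDl v : {morph real_scale^~ v : a b / a + b}.
Proof. by move=> a b; rewrite /real_scale rmorphD scalerDl. Qed.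

HB.instance Definition _ := GRing.Zmodule_isLmodule.Build R realified
  real_scaleA real_scale1 real_scaleDr real_scaleDl.

End real_structure.

Section spectral_to_real.
Variables (R : realType) (H : lmodType R[i]) (L : set H) (ip : H -> H -> R[i]).
Local Notation V := (realified H).

Definition real_ip (f g : V) : R := complex.Re (ip f g).

Hypothesis sL : semi_inner (L : set V) real_ip.

Lemma real_resolution_of (A : set (H * H)) (E : set R -> H -> H) :
  (forall f g, A (f, g) -> L f /\ L g) ->
  (forall a (f g f' g' : V), A (f, g) -> A (f', g') ->
    A (a *: f + f', a *: g + g')) ->
  spectral_resolution L ip A E ->
  exists mu, @real_resolution R V L real_ip A E mu.
Proof.
move=> AL Alin [Eproj ET [mu [muE dom int]]].
exists mu; split => //.
- by move=> B f mB Lf; have [LE _ _ _] := Eproj B mB; exact: LE.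
- move=> B a f g k mB Lf Lg Lk; have [LE lin _ _] := Eproj B mB.
  have LEfg : L (E B (a *: f + g)) by apply: LE; apply: (siP sL).
  have LEf := LE f Lf; have LEg := LE g Lg.
  rewrite -(siDl sL)//; apply: (s_equiv sL) => //; first exact: (siP sL).
  have := lin (a%:C)%C f g Lf Lg; rewrite /null_vector /real_ip => n0.
  by rewrite [X in complex.Re X]n0.
- move=> B f k mB Lf Lk; have [LE _ idem _] := Eproj B mB.
  have LEf := LE f Lf; have LEEf := LE _ LEf.
  apply: (s_equiv sL) => //.
  by have := idem f Lf; rewrite /null_vector /real_ip => ->.
- by move=> B f g mB Lf Lg; have [_ _ _ sym] := Eproj B mB; rewrite /real_ip sym.
- move=> f k Lf Lk; have [LE _ _ _] := Eproj setT measurableT.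
  apply: (s_equiv sL) => //; first exact: LE.
  by have := ET f Lf; rewrite /null_vector /real_ip => ->.
- by move=> f Lf i2; exact: (dom f Lf).2 i2.
- by move=> f g Afg; rewrite /real_ip (int f g Afg).
Qed.

End spectral_to_real.

Section complex_components.
Variable R : realType.
Notation leb := (@lebesgue_measure R).
Implicit Types (f g : R -> R[i]) (l : R).

Definition part (i : bool) (z : R[i]) : R := if i then complex.Im z else complex.Re z.

Lemma part_ext (z z' : R[i]) : (forall i, part i z = part i z') -> z = z'.
Proof.
move=> H; have := H false; have := H true; rewrite /part /=.
by case: z {H} => a b; case: z' => c d /= -> ->.
Qed.

Lemma part_lin i (a : R) (z z' : R[i]) : part i ((a%:C)%C * z + z') = a * part i z + part i z'.
Proof. by case: i; case: z => x y; case: z' => x' y'; rewrite /part /=; ring. Qed.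

Lemma partD i (z z' : R[i]) : part i (z + z') = part i z + part i z'.
Proof. by case: i; case: z => x y; case: z' => x' y'. Qed.

Lemma partN i (z : R[i]) : part i (- z) = - part i z.
Proof. by case: i; case: z => x y. Qed.

Lemma part0 i : part i 0 = 0.
Proof. by case: i. Qed.

Lemma part_sum i (I : Type) (r : seq I) (P : pred I) (F : I -> R[i]) :
  part i (\sum_(j <- r | P j) F j) = \sum_(j <- r | P j) part i (F j).
Proof. by apply: (big_morph (part i)); [exact: partD|exact: part0]. Qed.

Lemma part_cintegral i l f : part i (cintegral l f) =
  \int[leb]_(x in `[0, l]) part i (f x).
Proof. by case: i. Qed.

Lemma square_integrableP l f : square_integrable l f <->
  forall i, real_L2 `[0, l] (fun x => part i (f x)).
Proof.
have mI : measurable (`[0, l]%classic : set (measurableTypeR R)) by exact: measurable_itv.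
split=> [[mre mim isum] i|H].
  have mi : measurable_fun `[0, l] (fun x => part i (f x)) by case: i.
  split => //.
  apply: (@le_integrable _ _ _ leb _ mI _ _ _ _ isum).
    by apply/measurable_EFinP; exact: measurable_funX.
  move=> x _; rewrite !abse_EFin lee_fin !ger0_norm ?addr_ge0 ?sqr_ge0//.
  by rewrite /part; case: i {mi}; [rewrite lerDr|rewrite lerDl]; exact: sqr_ge0.
have [mre ire] := H false; have [mim iim] := H true; split => //.
by have := integrableD mI ire iim; apply: eq_integrable => // x _; rewrite EFinD.
Qed.

Lemma H2_derivativesP l f (f0 f1 f2 : R -> R[i]) : H2_derivatives l f f0 f1 f2 <->
  {ae leb, forall x, 0 <= x <= l -> f x = f0 x} /\ forall i,
  [/\ forall x, 0 <= x <= l ->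
        part i (f0 x) = part i (f0 0) + \int[leb]_(t in `[0, x]) part i (f1 t),
      forall x, 0 <= x <= l ->
        part i (f1 x) = part i (f1 0) + \int[leb]_(t in `[0, x]) part i (f2 t) &
      real_L2 `[0, l] (fun x => part i (f2 x))].
Proof.
split=> [[ae p0 p1 /square_integrableP f2L]|[ae H]].
  split => // i; split => // x xl.
    by rewrite (p0 x xl) partD part_cintegral.
  by rewrite (p1 x xl) partD part_cintegral.
split => //.
- move=> x xl; apply: part_ext => i; have [p0 _ _] := H i.
  by rewrite partD part_cintegral p0.
- move=> x xl; apply: part_ext => i; have [_ p1 _] := H i.
  by rewrite partD part_cintegral p1.
- by apply/square_integrableP => i; have [] := H i.
Qed.

End complex_components.

(** * The Laplacian in weak form *)

Section laplacian_on_lengths.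
Variables (R : realType) (X : topological_graph R) (La : set X) (w : tg_edge X -> R).
Hypothesis finS : finite_set (sub_edges La).
Hypothesis w0 : forall e, sub_edges La e -> 0 < w e.
Hypothesis subLa : subgraph La.
Notation leb := (@lebesgue_measure R).
Local Notation H := (tg_edge X -> R -> R[i]^o).
Local Notation V := (realified H).
Local Notation L := (L2 La w : set V).
Local Notation ip := (L2_inner La w).
Local Notation s := (@real_ip R H ip).
Let S : seq (tg_edge X) := enum_fset (fset_set (sub_edges La)).

Let memS e : e \in S -> sub_edges La e.
Proof. by move=> eS; apply: set_mem; rewrite -in_fset_set. Qed.

Let Smem e : sub_edges La e -> e \in S.
Proof.
move=> eS; have : e \in fset_set (sub_edges La) by rewrite in_fset_set// mem_set.
by [].
Qed.

Let uS : uniq S. Proof. exact: fset_uniq. Qed.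

Lemma L2P (f : V) : L f <-> forall e i, sub_edges La e ->
  real_L2 `[0, w e] (fun x => part i (f e x)).
Proof.
split=> [Lf e i eS|Lf e eS]; first by have /square_integrableP := Lf e eS.
by apply/square_integrableP => i; exact: Lf.
Qed.

Let pairL2 (f g : V) e i : L f -> L g -> sub_edges La e ->
  leb.-integrable `[0, w e] (EFin \o (fun x => part i (f e x) * part i (g e x))).
Proof. by move=> Lf Lg eS; apply: real_L2M => //; exact: (L2P _).1. Qed.

Lemma real_ipE (f g : V) : L f -> L g -> s f g =
  \sum_(e <- S) \sum_(i : bool) \int[leb]_(x in `[0, w e]) (part i (f e x) * part i (g e x)).
Proof.
move=> Lf Lg; rewrite /real_ip /L2_inner fsbig_finite//.
rewrite -[complex.Re _]/(part false _) part_sum; apply: eq_big_seq => e /memS eS.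
rewrite part_cintegral big_bool/=.
rewrite -RintegralD; [|exact: measurable_itv|exact: pairL2 true Lf Lg eS|
                       exact: pairL2 false Lf Lg eS].
apply: eq_Rintegral => x _; rewrite /part/=.
by case: (f e x) => a b; case: (g e x) => c d /=; ring.
Qed.

Lemma L2_semi_inner : semi_inner L s.
Proof.
have linL a (f g : V) : L f -> L g -> L (a *: f + g).
  move=> Lf Lg; apply/L2P => e i eS.
  have := real_L2_lin a (measurable_itv _) ((L2P f).1 Lf e i eS) ((L2P g).1 Lg e i eS).
  by congr real_L2; apply/funext => x; rewrite -part_lin.
split => //.
- apply/L2P => e i _; rewrite [X in real_L2 _ X](_ : _ = (fun=> 0)).
    by apply: itv_cont_real_L2 => z; exact: cvg_cst.
  by apply/funext => x; rewrite part0.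
- move=> f g Lf Lg; rewrite !real_ipE//; apply: eq_bigr => e _; apply: eq_bigr => i _.
  by apply: eq_Rintegral => x _; rewrite mulrC.
- move=> a f g k Lf Lg Lk; rewrite !real_ipE//; last exact: linL.
  rewrite mulr_sumr -big_split/=.
  apply: eq_big_seq => e /memS eS; rewrite mulr_sumr -big_split/=.
  apply: eq_bigr => i _.
  have ifk := pairL2 i Lf Lk eS; have igk := pairL2 i Lg Lk eS.
  rewrite -RintegralZl// -RintegralD//; last first.
    have mI : measurable (`[0, w e]%classic : set (measurableTypeR R)) by exact: measurable_itv.
    by have := integrableZl mI a ifk; apply: eq_integrable.
  by apply: eq_Rintegral => x _; rewrite mulrA -mulrDl -part_lin.
- move=> f Lf; rewrite real_ipE//; apply: sumr_ge0 => e _; apply: sumr_ge0 => i _.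
  by apply: Rintegral_ge0 => x _; exact: sqr_ge0.
Qed.

Definition stretch (F : test_pair R (tg_edge X)) : V := fun e x =>
  (F.1 e false ((w e)^-1 * x) +i* F.1 e true ((w e)^-1 * x))%C.

Lemma part_stretch i F e x : part i (stretch F e x) = F.1 e i ((w e)^-1 * x).
Proof. by case: i. Qed.

Lemma stretch_linear : linear stretch.
Proof.
move=> a F G; apply/funext => e; apply/funext => x; apply: part_ext => i.
rewrite [LHS]part_stretch test_pair_lin -!part_stretch.
exact: (esym (part_lin _ _ _ _)).
Qed.

HB.instance Definition _ :=
  GRing.isLinear.Build R (test_pair R (tg_edge X)) V *:%R stretch stretch_linear.

Local Notation Q := (@test_functions R _ S X (@node R X) (boundary La)).

Let unit_length e : sub_edges La e -> (w e)^-1 * w e = 1.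
Proof. by move=> eS; rewrite mulVf// gt_eqF// w0. Qed.

Let cont_stretch F e i : Q F -> sub_edges La e ->
  {within `[0, w e], continuous (fun x => F.1 e i ((w e)^-1 * x))}.
Proof.
move=> QF eS; apply: within_scale; first by rewrite invr_gt0 w0.
by rewrite unit_length//; exact: (test_functions_cont QF (Smem eS)).
Qed.

Lemma L2_stretch F : Q F -> L (stretch F).
Proof.
move=> QF; apply/L2P => e i eS; rewrite [X in real_L2 _ X](_ : _ =
    (fun x => F.1 e i ((w e)^-1 * x))).
  by apply: itv_cont_real_L2; exact: (cont_stretch QF eS).
by apply/funext => x; rewrite part_stretch.
Qed.

Lemma inner_stretch F G : Q F -> Q G -> s (stretch F) (stretch G) = inner S w F G.
Proof.
move=> QF QG; rewrite real_ipE; [|exact: L2_stretch..].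
apply: eq_big_seq => e eS'; have eS := memS eS'; rewrite mulr_sumr; apply: eq_bigr => i _.
have cFG : {within `[0, (w e)^-1 * w e], continuous (fun x => F.1 e i x * G.1 e i x)}.
  by rewrite unit_length//; apply: withinM;
    [exact: (test_functions_cont QF eS')|exact: (test_functions_cont QG eS')].
have we := w0 eS; have iwe : 0 < (w e)^-1 by rewrite invr_gt0.
have := Rintegral_scale iwe (ltW we) cFG; rewrite unit_length// => ->.
rewrite mulrA divff ?gt_eqF// mul1r.
by apply: eq_Rintegral => x _; rewrite !part_stretch.
Qed.

Let edges_seq v : edges_in v `<=` sub_edges La -> edges_out v `<=` sub_edges La ->
  forall F : tg_edge X -> R[i],
  \sum_(e \in edges_in v) F e = \sum_(e <- S | @node R X e true == v) F e /\
  \sum_(e \in edges_out v) F e = \sum_(e <- S | @node R X e false == v) F e.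
Proof.
move=> inS outS F; split; rewrite -[RHS]big_filter [RHS]fsbig_seq ?filter_uniq//;
  congr (\big[_/_]_(e \in _) _); apply/seteqP; split=> e /=; rewrite mem_filter.
- by move=> eS; rewrite Smem ?andbT; [apply/eqP|exact: inS].
- by move=> /andP[/eqP ev _].
- by move=> eS; rewrite Smem ?andbT; [apply/eqP|exact: outS].
- by move=> /andP[/eqP ev _].
Qed.

Let interior_in v : (sub_vertices La `\` boundary La) v ->
  edges_in v `<=` sub_edges La /\ edges_out v `<=` sub_edges La.
Proof.
move=> [[Lav _] nbd]; split=> e ev.
  by apply: (interior_edges subLa (b := true)); rewrite /node /= ev.
by apply: (interior_edges subLa (b := false)); rewrite /node /= ev.
Qed.

(** The boundary terms of all edges are regrouped by vertex. There [G] takes one value [c v]: it is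
    0 at a boundary vertex, and at the others it multiplies a Kirchhoff sum. A loop enters through
    both of its ends. *)
Lemma vertex_sum (a G : tg_edge X -> bool -> R) :
  (forall e e' b b', e \in S -> e' \in S -> @node R X e b = @node R X e' b' -> G e b = G e' b') ->
  (forall e b, e \in S -> boundary La (@node R X e b) -> G e b = 0) ->
  (forall v, (sub_vertices La `\` boundary La) v ->
    \sum_(e <- S | @node R X e true == v) a e true -
    \sum_(e <- S | @node R X e false == v) a e false = 0) ->
  \sum_(e <- S) (a e true * G e true - a e false * G e false) = 0.
Proof.
move=> match_G bd_G kir.
have /choice[c cP] : forall v, exists c, forall e b, e \in S -> @node R X e b = v -> G e b = c.
  move=> v; have [[e0 [b0 [e0S e0v]]]|none] :=
    pselect (exists e0 b0, e0 \in S /\ @node R X e0 b0 = v).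
    by exists (G e0 b0) => e b eS ev; apply: match_G => //; rewrite ev.
  by exists 0 => e b eS ev; case: none; exists e, b.
pose W := undup ([seq @node R X e true | e <- S] ++ [seq @node R X e false | e <- S]).
have nodeW e b : e \in S -> @node R X e b \in W.
  move=> eS; rewrite mem_undup mem_cat; apply/orP.
  by case: b; [left|right]; apply/mapP; exists e.
have group b : \sum_(e <- S) a e b * G e b =
    \sum_(v <- W) c v * \sum_(e <- S | @node R X e b == v) a e b.
  under [RHS]eq_bigr do rewrite mulr_sumr big_mkcond.
  rewrite exchange_big/=; apply: eq_big_seq => e eS.
  rewrite (bigD1_seq (@node R X e b)) ?undup_uniq ?nodeW//= eqxx big1 ?addr0.
    by rewrite mulrC (cP _ e b eS erefl).
  by move=> v /negPf nv; rewrite eq_sym nv.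
rewrite sumrB !group -sumrB big_seq big1// => v vW.
have [e [b [eS ev]]] : exists e b, e \in S /\ @node R X e b = v.
  move: vW; rewrite mem_undup mem_cat => /orP[]/mapP[e eS ->].
    by exists e, true.
  by exists e, false.
rewrite -mulrBr; have [bv|nbv] := pselect (boundary La v).
  by rewrite -(cP v e b eS ev) bd_G ?mul0r// ev.
rewrite kir ?mulr0//; split => //; rewrite -ev; apply: node_in; exact: memS.
Qed.

Let part_sum_in (F : tg_edge X -> R[i]) v i : (sub_vertices La `\` boundary La) v ->
  part i (\sum_(e \in edges_in v) F e) = \sum_(e <- S | @node R X e true == v) part i (F e).
Proof. by move=> /interior_in[iS oS]; have [-> _] := edges_seq iS oS F; rewrite part_sum. Qed.

Let part_sum_out (F : tg_edge X -> R[i]) v i : (sub_vertices La `\` boundary La) v ->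
  part i (\sum_(e \in edges_out v) F e) = \sum_(e <- S | @node R X e false == v) part i (F e).
Proof. by move=> /interior_in[iS oS]; have [_ ->] := edges_seq iS oS F; rewrite part_sum. Qed.

Local Notation A := (dirichlet_laplacian La w : set (V * V)).

Lemma laplacian_L2 (f g : V) : A (f, g) -> L f /\ L g.
Proof. by move=> [? [? _]]. Qed.

Lemma laplacian_lin a (f g f' g' : V) : A (f, g) -> A (f', g') ->
  A (a *: f + f', a *: g + g').
Proof.
move=> [/= Lf [Lg [f0 [f1 [d bd kir]]]]] [/= Lf' [Lg' [f0' [f1' [d' bd' kir']]]]].
have sL := L2_semi_inner.
split; [exact: (siP sL)|split; first exact: (siP sL)].
pose lc (u v : tg_edge X -> R -> R[i]^o) e x : R[i]^o := (a%:C)%C * u e x + v e x.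
exists (lc f0 f0'), (lc f1 f1'); split.
- move=> e eS; have /H2_derivativesP[ae dp] := d e eS; have /H2_derivativesP[ae' dp'] := d' e eS.
  apply/H2_derivativesP; split.
    move: ae ae'; apply: filterS2; first exact: (ae_filter_ringOfSetsType leb).
    by move=> x h h' x01; rewrite /lc -h// -h'.
  move=> i; have [p0 p1 p2] := dp i; have [p0' p1' p2'] := dp' i.
  have l0 := ltW (w0 eS).
  have i2 := real_L2_integrable p2; have i2' := real_L2_integrable p2'.
  have i1 := itv_cont_integrable (primitive_continuous i2 p1 l0).
  have i1' := itv_cont_integrable (primitive_continuous i2' p1' l0).
  have lin (u v : R -> R) x : 0 <= x <= w e ->
      leb.-integrable `[0, w e] (EFin \o u) -> leb.-integrable `[0, w e] (EFin \o v) ->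
      \int[leb]_(t in `[0, x]) (a * u t + v t) =
      a * \int[leb]_(t in `[0, x]) u t + \int[leb]_(t in `[0, x]) v t.
    move=> /andP[x0 xl] iu iv.
    have mx : measurable (`[0, x]%classic : set (measurableTypeR R)) by exact: measurable_itv.
    have sub : `[0, x]%classic `<=` `[0, w e]%classic by exact: sub_itvcc.
    have iux : leb.-integrable `[0, x] (EFin \o u) by apply: integrableS iu.
    have ivx : leb.-integrable `[0, x] (EFin \o v) by apply: integrableS iv.
    rewrite -RintegralZl// -RintegralD//.
    by have := integrableZl mx a iux; apply: eq_integrable.
  split.
  + move=> x xl; rewrite /lc !part_lin (p0 x xl) (p0' x xl).
    rewrite [X in _ = _ + X](_ : _ = a * \int[leb]_(t in `[0, x]) part i (f1 e t) +
      \int[leb]_(t in `[0, x]) part i (f1' e t)); first by ring.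
    by rewrite -lin//; apply: eq_Rintegral => t _; rewrite part_lin.
  + move=> x xl; rewrite /lc !part_lin (p1 x xl) (p1' x xl).
    rewrite [X in _ = _ + X](_ : _ = a * \int[leb]_(t in `[0, x]) part i (- g e t) +
      \int[leb]_(t in `[0, x]) part i (- g' e t)); first by ring.
    rewrite -lin//; apply: eq_Rintegral => t _; rewrite !partN mulrN -opprD.
    by congr (- _); exact: part_lin.
  + have := real_L2_lin a (measurable_itv _) p2 p2'.
    congr real_L2; apply/funext => x; rewrite !partN mulrN -opprD; congr (- _).
    exact: (esym (part_lin _ _ _ _)).
- move=> v vbd e eS; have [i1 o1] := bd v vbd e eS; have [i2 o2] := bd' v vbd e eS.
  by split=> ev; rewrite /lc; [rewrite i1// i2//|rewrite o1// o2//]; rewrite mulr0 addr0.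
- move=> v vint; have [[c [ci co]] k] := kir v vint; have [[c' [ci' co']] k'] := kir' v vint.
  split.
    exists ((a%:C)%C * c + c'); split=> e ev; rewrite /lc.
      by rewrite ci// ci'.
    by rewrite co// co'.
  have [iS oS] := interior_in vint.
  have sumlin (u u' : tg_edge X -> R[i]) (r : seq (tg_edge X)) (P : pred (tg_edge X)) :
      \sum_(e <- r | P e) ((a%:C)%C * u e + u' e) =
      (a%:C)%C * \sum_(e <- r | P e) u e + \sum_(e <- r | P e) u' e.
    by rewrite big_split/= mulr_sumr.
  move: k k'.
  have [-> _] := edges_seq iS oS (fun e => f1 e (w e)).
  have [_ ->] := edges_seq iS oS (fun e => f1 e 0).
  have [-> _] := edges_seq iS oS (fun e => f1' e (w e)).
  have [_ ->] := edges_seq iS oS (fun e => f1' e 0).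
  have [-> _] := edges_seq iS oS (fun e => lc f1 f1' e (w e)).
  have [_ ->] := edges_seq iS oS (fun e => lc f1 f1' e 0).
  move=> k k'; rewrite !sumlin opprD addrACA -mulrBr k k' mulr0 addr0//.
Qed.

Lemma edge_green l (h f1 G0 G1 : R -> R) : 0 < l ->
  leb.-integrable `[0, l] (EFin \o h) ->
  (forall x, 0 <= x <= l -> f1 x = f1 0 + \int[leb]_(t in `[0, x]) h t) ->
  {within `[0, 1], continuous G1} ->
  (forall x, 0 <= x <= 1 -> G0 x = G0 0 + \int[leb]_(t in `[0, x]) G1 t) ->
  l^-1 * \int[leb]_(x in `[0, 1]) (l * f1 (l * x) * G1 x) =
  f1 l * G0 1 - f1 0 * G0 0 - \int[leb]_(x in `[0, l]) (h x * G0 (l^-1 * x)).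
Proof.
move=> l0 ih pf cG1 pG; have il0 : 0 < l^-1 by rewrite invr_gt0.
have ll : l^-1 * l = 1 by rewrite mulVf// gt_eqF.
have ln0 : l != 0 by rewrite gt_eqF.
have cf1 := primitive_continuous ih pf (ltW l0).
have cst (c : R) b : {within `[0, b], continuous (fun _ : R => c)} by move=> z; exact: cvg_cst.
have cG1' : {within `[0, l], continuous (fun x => l^-1 * G1 (l^-1 * x))}.
  by apply: withinM; [exact: cst|apply: within_scale; rewrite ?ll].
have pG' x : 0 <= x <= l -> G0 (l^-1 * x) = G0 (l^-1 * 0) +
    \int[leb]_(t in `[0, x]) (l^-1 * G1 (l^-1 * t)).
  move=> /andP[x0 xl]; rewrite mulr0 pG; last first.
    by rewrite mulr_ge0 ?(ltW il0)//= mulrC ler_pdivrMr ?mul1r.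
  congr (_ + _).
  have sub : `[0, l^-1 * x]%classic `<=` `[0, 1]%classic.
    by apply: sub_itvcc => //; rewrite mulrC ler_pdivrMr ?mul1r.
  have cx : {within `[0, l^-1 * x], continuous G1} by exact: continuous_subspaceW cG1.
  rewrite Rintegral_scale// RintegralZl//; apply: itv_cont_integrable.
  exact: within_scale.
have := integration_by_parts_ac (ltW l0) ih pf cG1' pG'.
rewrite ll mulr0 => ->.
have ck : {within `[0, l^-1 * l], continuous (fun s => f1 (l * s) * G1 s)}.
  by rewrite ll; apply: withinM => //; apply: within_scale; rewrite ?mulr1.
have -> : \int[leb]_(x in `[0, l]) (f1 x * (l^-1 * G1 (l^-1 * x))) =
    \int[leb]_(x in `[0, 1]) (f1 (l * x) * G1 x).
  have := Rintegral_scale il0 (ltW l0) ck; rewrite ll => ->.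
  rewrite -RintegralZl//; last exact: itv_cont_integrable (within_scale il0 ck).
  apply: eq_Rintegral => x _; have -> : l * (l^-1 * x) = x by rewrite mulrA mulfV// mul1r.
  by ring.
rewrite -[X in _ = X]/(_ - (_ - _)) opprB addrC subrK.
rewrite -RintegralZl; [|exact: measurable_itv|].
  by apply: eq_Rintegral => x _; rewrite !mulrA ll mul1r.
apply: itv_cont_integrable; apply: withinM => //; apply: withinM; first exact: cst.
by apply: within_scale; rewrite ?mulr1.
Qed.

(** Integration by parts on each edge leaves endpoint terms [T e], which cancel by [vertex_sum]
    applied separately to real and imaginary parts. *)
Lemma laplacian_weak_form (f g : V) : A (f, g) -> exists F,
  [/\ Q F, s (stretch F - f) (stretch F - f) = 0 &
    forall G, Q G -> energy S w F G = s g (stretch G)].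
Proof.
move=> [/= Lf [Lg [f0 [f1 [d bd kir]]]]].
have sL := L2_semi_inner.
have dP e i (eS : sub_edges La e) := ((H2_derivativesP _ _ _ _ _).1 (d e eS)).2 i.
have ih e i : sub_edges La e -> leb.-integrable `[0, w e] (EFin \o (fun x => part i (- g e x))).
  by move=> eS; have [_ _ /real_L2_integrable] := dP e i eS.
have cf1 e i : sub_edges La e -> {within `[0, w e], continuous (fun x => part i (f1 e x))}.
  move=> eS; have [_ p1 _] := dP e i eS.
  exact: (primitive_continuous (ih e i eS) p1 (ltW (w0 eS))).
(* The continuous representatives of f and f', pulled back to [0, 1]; the chain rule gives the
   factor [w e]. *)
pose F : test_pair R (tg_edge X) :=
  ((fun e i x => part i (f0 e (w e * x))), (fun e i x => w e * part i (f1 e (w e * x)))).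
have node_value e b : sub_edges La e -> boundary La (@node R X e b) -> f0 e (w e * b%:R) = 0.
  move=> eS bv; have vb : (sub_vertices La `&` boundary La) (node e b).
    by split => //; exact: node_in.
  have [i0 o0] := bd _ vb e eS.
  by case: b {bv vb} i0 o0 => i0 o0; [rewrite mulr1 i0|rewrite mulr0 o0].
have QF : Q F.
  split => /=.
  - move=> e /memS eS i; apply: withinM; first by move=> z; exact: cvg_cst.
    have cw : {within `[0, w e * 1], continuous (fun x => part i (f1 e x))}.
      by rewrite mulr1; exact: cf1.
    exact: (within_scale (w0 eS) cw).
  - move=> e i x /memS eS /andP[x0 x1]; have we := w0 eS; have [p0 _ _] := dP e i eS.
    rewrite p0; last by rewrite mulr_ge0 ?(ltW we)//= ler_piMr// ltW.
    rewrite mulr0; congr (_ + _).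
    have sub : `[0, w e * x]%classic `<=` `[0, w e]%classic.
      by apply: sub_itvcc => //; rewrite ler_piMr// ltW.
    have cx : {within `[0, w e * x], continuous (fun t => part i (f1 e t))}.
      exact: continuous_subspaceW (cf1 e i eS).
    rewrite (Rintegral_scale we x0 cx) RintegralZl//; apply: itv_cont_integrable.
    exact: within_scale cx.
  - move=> e e' b b' i /memS eS /memS e'S ee'.
    have [bv|nbv] := pselect (boundary La (@node R X e b)).
      by rewrite !node_value// -ee'.
    have vi : (sub_vertices La `\` boundary La) (node e b).
      by split => //; exact: node_in.
    have [[c [ci co]] _] := kir _ vi.
    have val e1 b1 : @node R X e1 b1 = node e b -> f0 e1 (w e1 * b1%:R) = c.
      by case: b1 => e1v; [rewrite mulr1 ci|rewrite mulr0 co].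
    by rewrite !val.
  - by move=> e b i /memS eS bv; rewrite node_value// part0.
have LJF := L2_stretch QF.
exists F; split => //.
- have LB := siB sL LJF Lf.
  rewrite real_ipE//; rewrite big_seq big1// => e /memS eS; rewrite big1// => i _.
  have [ae _] := (H2_derivativesP _ _ _ _ _).1 (d e eS).
  rewrite /Rintegral (ae_eq_integral (cst 0%E)) ?integral0//.
  + apply/measurable_EFinP; have [m _] := (L2P _).1 LB e i eS.
    exact: measurable_funM.
  + move: ae; apply: filterS; first exact: (ae_filter_ringOfSetsType leb).
    move=> x h /=; rewrite in_itv/= => x01.
    have -> : (stretch F - f) e x = 0.
      apply: part_ext => i'; rewrite part0 [LHS]partD partN part_stretch /=.
      by rewrite mulrA mulfV ?gt_eqF ?w0// mul1r -h// subrr.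
    by rewrite part0 mul0r.
move=> G QG; have LJG := L2_stretch QG; have [cG pG mG dG] := QG.
rewrite real_ipE//.
pose T e := \sum_(i : bool) (part i (f1 e (w e)) * G.1 e i 1 - part i (f1 e 0) * G.1 e i 0).
have edge e : sub_edges La e -> (w e)^-1 * kinetic F G e = T e +
    \sum_(i : bool) \int[leb]_(x in `[0, w e]) (part i (g e x) * part i (stretch G e x)).
  move=> eS; rewrite /kinetic /edge_pairing mulr_sumr -big_split/=; apply: eq_bigr => i _.
  have [_ p1 _] := dP e i eS.
  rewrite (edge_green (w0 eS) (ih e i eS) p1 (cG e (Smem eS) i) (fun x => pG e i x (Smem eS))).
  congr (_ + _); rewrite -mulN1r -RintegralZl; last 2 first.
  - exact: measurable_itv.
  - have [_ _ hL2] := dP e i eS.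
    apply: (real_L2M _ hL2); first exact: measurable_itv.
    exact: itv_cont_real_L2 (cont_stretch QG eS).
  by apply: eq_Rintegral => x _; rewrite partN part_stretch; ring.
have -> : energy S w F G = \sum_(e <- S) (T e +
    \sum_(i : bool) \int[leb]_(x in `[0, w e]) (part i (g e x) * part i (stretch G e x))).
  by apply: eq_big_seq => e /memS; exact: edge.
rewrite big_split/= [X in X + _](_ : _ = 0) ?add0r//.
rewrite /T exchange_big/= big1// => i _.
pose a e (b : bool) := part i (f1 e (if b then w e else 0)).
pose Gv e (b : bool) := G.1 e i b%:R.
apply: (@vertex_sum a Gv).
- by move=> e e' b b' eS e'S ee'; exact: mG.
- by move=> e b eS be; exact: dG.
- move=> v vi; have [_ k] := kir v vi.
  by rewrite /a -part_sum_in// -part_sum_out// -partN -partD k part0.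
Qed.

End laplacian_on_lengths.

(** * Bound of the trace and conclusion *)

Lemma neg_dim_scale (R : realType) (T : lmodType R) (Q : set T) (q q' : T -> R)
    (k : R) n : lin_closed Q -> 0 < k -> (forall F, Q F -> q' F = k * q F) ->
  neg_dim Q q n -> neg_dim Q q' n.
Proof.
move=> Qlin k0 qq' [v [Qv neg]]; exists v; split=> // c c0.
by rewrite qq' ?pmulr_rlt0 ?neg//; exact: lin_closed_sum.
Qed.

Lemma length_formE (R : realType) (E : choiceType) (S : seq E) (w : E -> R) (c : R)
    (F : test_pair R E) : (forall e, e \in S -> 0 < w e) -> 0 < c ->
  length_form S (fun e => w e * c) F = c^-1 * (energy S w F F - c ^+ 2 * inner S w F F).
Proof.
move=> w0 c0; rewrite /length_form /energy /inner [in RHS]mulr_sumr -sumrB mulr_sumr.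
apply: eq_big_seq => e /w0 we; have cn : c != 0 by rewrite gt_eqF.
have wn : w e != 0 by rewrite gt_eqF.
by field; rewrite cn wn.
Qed.

(* The integral of a nonnegative function is a supremum over the simple functions
   below it, whence no measurability is needed. *)
Lemma ge0_le_integral_nonmeas d (T : measurableType d) (R : realType)
    (mu : {measure set T -> \bar R}) (D : set T) (f g : T -> \bar R) :
  (forall x, 0 <= f x)%E -> (forall x, 0 <= g x)%E ->
  (forall x, D x -> f x <= g x)%E ->
  (\int[mu]_(x in D) f x <= \int[mu]_x g x)%E.
Proof.
move=> f0 g0 fg; rewrite !ge0_integralE//.
apply: ge_ereal_sup => _ [h /= hf <-]; apply: ereal_sup_ubound; exists h => //= x.
rewrite patch_setT (le_trans (hf x))// patchE; case: ifPn => // /set_mem; exact: fg.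
Qed.

Section trace_bound.
Variables (R : realType) (X : topological_graph R) (La : set X).
Variables (w : length_space R (tg_edge X)).
Hypothesis finS : finite_set (sub_edges La).
Hypothesis w0 : forall e, 0 < w e.
Hypothesis subLa : subgraph La.
Let S : seq (tg_edge X) := enum_fset (fset_set (sub_edges La)).
Local Notation many := (@many_eigenvalues R _ S X (@node R X) (boundary La)).

Lemma trace_ge0 (I : set R) : (0 <= trace_spectral_projection La w I)%E.
Proof.
rewrite /trace_spectral_projection /trace /esum; apply: ereal_sup_ubound.
by exists set0; [exact: fsets_set0|rewrite fsbig_set0].
Qed.

Lemma trace_le_count (a b c t : R) (M : nat) : (0 < M)%N -> 0 < c -> c ^+ 2 = a ->
  0 < t -> a <= b -> b < (c * t) ^+ 2 -> (forall e, w e * (c * t) <= M%:R) ->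
  (trace_spectral_projection La w `[a, b]%classic <=
   \sum_(n < size S * M.+1.*2)
     ((\1_(many (fun=> c * t)%R n `\` many (fun=> c) n) w)%:E : \bar R))%E.
Proof.
move=> M0 c0 ca t0 ab bct wM.
set K := (size S * _)%N.
have sum_ge0 : (0 <= \sum_(n < K)
     ((\1_(many (fun=> c * t)%R n `\` many (fun=> c) n) w)%:E : \bar R))%E.
  by apply: sume_ge0 => n _; rewrite lee_fin.
have sL := @L2_semi_inner R X La w finS.
rewrite /trace_spectral_projection /trace.
case: xgetP => [B _ [BL B1 B0 _]|_]; last by rewrite esum_set0.
rewrite /spectral_projection; case: xgetP => [E _ res|_]; last first.
  rewrite esum1// => phi /BL Lphi.
  by congr EFin; exact: (s0l sL Lphi).
set V := realified (tg_edge X -> R -> R[i]^o).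
have w0S e : sub_edges La e -> 0 < w e by [].
have [mu rr] := real_resolution_of sL (@laplacian_L2 _ _ _ _)
  (@laplacian_lin _ _ _ _ finS w0S subLa) res.
have Qlin := @test_functions_lin R _ S X (@node R X) (boundary La).
have w0' e : e \in S -> 0 < w e by [].
have pQ := @energy_semi_inner R _ S X (@node R X) (boundary La) w w0'.
pose no k n := @neg_open R _ S X (@node R X) (boundary La) (fun e => w e * k) n.
have ct0 : 0 < c * t by rewrite mulr_gt0.
have no0 : exists m, `[< no c m >].
  by exists 0%N; apply/asboolP; apply: neg_open0 => e _; rewrite mulr_gt0.
have noK k n : 0 < k -> k <= c * t -> no k n -> (n <= K)%N.
  move=> k0 kct; apply: neg_open_size => // e _.
  by rewrite (le_trans _ (wM e))// ler_pM2l.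
have ba : c ^+ 2 < (c * t) ^+ 2 by rewrite ca (le_lt_trans ab).
have cct : c <= c * t.
  by rewrite -(@ler_pXn2r _ 2)// ?nnegrE ltW.
have nobd m : `[< no c m >] -> (m <= K)%N by move=> /asboolP; exact: noK.
(* [m] plays the role of the number of eigenvalues below [a]; its maximality makes the events of
   index at least [m] fail before the stretching. *)
have [m /asboolP noc mmax] := ex_maxnP no0 nobd.
apply: ge_ereal_sup => _ [B' [finB' B'B] <-].
rewrite fsbig_finite// sumEFin.
set r : seq V := enum_fset (fset_set B').
have rB x : x \in r -> B x.
  by move=> xr; apply: B'B; apply: set_mem; rewrite -in_fset_set.
(* Two strict gaps are needed: above [b] for [spectral_subspace_dim], and below (c t)^2 because
   [neg_open] asks for strictly smaller lengths. *)
pose d := (b + (c * t) ^+ 2) / 2.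
have bd : b < d by rewrite /d; lra.
have dct : d < (c * t) ^+ 2 by rewrite /d; lra.
have d0 : 0 < d by rewrite (lt_trans _ bd)// (lt_le_trans _ ab)// -ca exprn_gt0.
pose k := Num.sqrt d; have k0 : 0 < k by rewrite sqrtr_gt0.
have kd : k ^+ 2 = d by rewrite sqr_sqrtr// ltW.
have kct : k < c * t by rewrite -(@ltr_pXn2r _ 2)// ?nnegrE ?kd// ltW.
have form h F : 0 < h -> @test_functions R _ S X (@node R X) (boundary La) F ->
    length_form S (fun e => w e * h) F = h^-1 *
    (energy S w F F - h ^+ 2 * real_ip (L2_inner La w) (stretch w F) (stretch w F)).
  by move=> h0 QF; rewrite length_formE// (inner_stretch finS w0S QF QF).
have negA : neg_dim (@test_functions R _ S X (@node R X) (boundary La))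
    (fun F => energy S w F F - a * real_ip (L2_inner La w) (stretch w F) (stretch w F)) m.
  apply: (neg_dim_scale Qlin c0 _ (neg_open_dim noc)) => F QF.
  by rewrite form// mulrA divff ?gt_eqF// mul1r ca.
have a0 : 0 < a by rewrite -ca exprn_gt0.
have rL x : x \in r -> L2 La w x by move=> /rB; exact: BL.
have ur : uniq r by exact: fset_uniq.
have r1 x : x \in r -> real_ip (L2_inner La w) x x = 1.
  by move=> /rB /B1; rewrite /real_ip => ->.
have r0 x y : x \in r -> y \in r -> x <> y -> real_ip (L2_inner La w) x y = 0.
  by move=> /rB Bx /rB By /(B0 _ _ Bx By); rewrite /real_ip => ->.
have [n [trn negn]] := spectral_subspace_dim sL rr (J := stretch w) pQ
  (L2_stretch finS w0S) (laplacian_weak_form finS w0S subLa) a0 ab bd rL ur r1 r0 negA.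
have noct : no (c * t) (m + n)%N.
  apply: (@neg_openI _ _ _ _ _ _ _ (fun e => w e * k)).
    by move=> e _; rewrite mulr_gt0//= ltr_pM2l.
  have ik0 : 0 < k^-1 by rewrite invr_gt0.
  by apply: (neg_dim_scale Qlin ik0 _ negn) => F QF; rewrite form// kd.
have mnK := noK _ _ ct0 (lexx _) noct.
apply: (@le_trans _ _ n%:R%:E); first by rewrite lee_fin.
rewrite sumEFin lee_fin.
pose x i : R := \1_(many (fun=> c * t) i `\` many (fun=> c) i) w.
rewrite -(big_mkord xpredT x) (big_cat_nat (n := (m + n)%N))//=.
rewrite (big_cat_nat (n := m) (p := (m + n)%N)) ?leq_addr//=.
have x0 i : 0 <= x i by [].
(* For these [i] the count i + 1 is reached after stretching, being at most m + n, but not before,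
   as it exceeds [m]. *)
have mid : \sum_(m <= i < m + n) x i = n%:R.
  rewrite big_nat; under eq_bigr => i /andP[mi imn].
    rewrite /x indicE mem_set; first over.
    split; first exact: neg_open_leq imn noct.
    move=> nco; have := mmax i.+1 (introT (asboolP _) nco).
    by rewrite ltnNge mi.
  by rewrite -big_nat sumr_const_nat addKn.
by rewrite mid -addrA addrCA lerDl addr_ge0// sumr_ge0.
Qed.
End trace_bound.

Theorem theorem2p9 (R : realType) (u : R) (dmax : nat) (lmin lmax Ch : R)
    (hu : 1 < u) (hlmin : 0 < lmin) (hlmax : lmin <= lmax) (hCh : 0 < Ch) :
  exists C : R, 0 < C /\
    forall (X : topological_graph R)
      (law : tg_edge X -> probability (measurableTypeR R) R)
      (h : tg_edge X -> R -> R)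
      (P : probability (length_space R (tg_edge X)) R),
    (forall v : X, tg_vertex v -> degree_le dmax v) ->
    random_lengths lmin lmax Ch law h P ->
    forall (La : set X) (a b : R),
    subgraph La -> compact La ->
    a <= b -> `[a, b] `<=` `[u^-1, u] ->
    (\int[P]_(w in @admissible_lengths R (tg_edge X) lmin lmax)
        trace_spectral_projection La w `[a, b]
     <= C%:E * @lebesgue_measure R `[a, b]
        * (#|` fset_set (sub_edges La)|%:R)%:E)%E.
Proof.
have u0 : 0 < u by lra.
have lmax0 : 0 < lmax by rewrite (lt_le_trans hlmin).
(* An upper bound for all rescaled lengths: the square root c of a is at most u, and the stretching
   t is at most u^2 + 1. *)
pose M := (Num.bound (lmax * (u * (u ^+ 2 + 1)))).+1.
pose J := jump_constant lmax Ch M.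
have J0 : 0 < J by rewrite /J /jump_constant !mulr_gt0// ltr0n double_gt0.
(* Each edge costs J (t - 1), where t - 1 is (b - a) / a up to a small term, and 1 / a <= u. *)
exists (J * u); split; first exact: mulr_gt0.
move=> X law h P _ rl La a b subLa cLa ab abu.
have finS := finite_sub_edges cLa.
pose S : seq (tg_edge X) := enum_fset (fset_set (sub_edges La)).
have [ua _] : u^-1 <= a /\ a <= u.
  by have := abu a; rewrite /= !in_itv/= lexx ab => /(_ isT)/andP[].
have [_ bu] : u^-1 <= b /\ b <= u.
  by have := abu b; rewrite /= !in_itv/= lexx ab => /(_ isT)/andP[].
have a0 : 0 < a by rewrite (lt_le_trans _ ua)// invr_gt0.
have au : a^-1 <= u by rewrite -[u]invrK lef_pV2 ?posrE ?invr_gt0.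
have leb_ab : @lebesgue_measure R `[a, b]%classic = (b - a)%:E.
  rewrite lebesgue_measure_itv/= lte_fin; case: ltgtP ab => //= -> _.
  by rewrite subrr.
rewrite leb_ab -!EFinM; apply/lee_addgt0Pr => e e0.
pose m : R := (size S)%:R.
have m0 : 0 <= m by rewrite ler0n.
(* The excess [eps] makes b < (c t)^2 strict, even when a = b. It costs m J eps <= e, while eps <= 1
   keeps [M] independent of [e]. *)
pose eps := Num.min 1 (e / (m * J + 1)).
have mJ : 0 < m * J + 1 by rewrite ltr_wpDl// mulr_ge0// ltW.
have eps0 : 0 < eps by rewrite lt_min ltr01 divr_gt0.
have eps1 : eps <= 1 by rewrite ge_min lexx.
have epsJ : m * (J * eps) <= e.
  rewrite mulrA (le_trans (_ : _ <= (m * J) * (e / (m * J + 1))))//.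
    apply: ler_wpM2l; first by rewrite mulr_ge0// ltW.
    by rewrite /eps ge_min lexx orbT.
  by rewrite mulrCA ler_piMr ?(ltW e0)// ler_pdivrMr// mul1r lerDl.
pose t := b / a + eps; pose c := Num.sqrt a.
have ba1 : 1 <= b / a by rewrite ler_pdivlMr// mul1r.
have t1 : 1 <= t by rewrite /t (le_trans ba1)// lerDl ltW.
have t0 : 0 < t by rewrite (lt_le_trans _ t1).
have c0 : 0 < c by rewrite sqrtr_gt0.
have ca : c ^+ 2 = a by rewrite sqr_sqrtr// ltW.
(* A dilation by b / a instead of its square root is more than enough, since t >= 1 gives t^2 >= t;
   it still has t - 1 proportional to b - a up to [eps]. *)
have ct : b < (c * t) ^+ 2.
  rewrite exprMn ca; apply: (@lt_le_trans _ _ (a * t)).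
    by rewrite mulrDr mulrC divfK ?gt_eqF// ltrDl mulr_gt0.
  by rewrite ler_wpM2l ?(ltW a0)// expr2 ler_peMr// ltW.
have tu : t <= u ^+ 2 + 1.
  rewrite lerD// expr2; apply: ler_pM => //; last by rewrite invr_ge0 ltW.
  by rewrite (le_trans _ ab)// ltW.
have cu : c <= u.
  rewrite -(@ler_pXn2r _ 2)// ?nnegrE ?(ltW c0) ?(ltW u0)// ca.
  rewrite (le_trans ab)// (le_trans bu)// expr2 ler_peMr ?(ltW u0)//; exact: ltW.
have M0 : (0 < M)%N by [].
have ctM : lmax * (c * t) <= M%:R.
  apply: (@le_trans _ _ (lmax * (u * (u ^+ 2 + 1)))).
    by rewrite ler_pM2l//; apply: ler_pM => //; exact: ltW.
  rewrite ltW// (lt_trans (archi_boundP _)) ?ltr_nat//.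
  by rewrite !mulr_ge0 ?addr_ge0 ?exprn_ge0 ?ltW.
pose many := @many_eigenvalues R _ S X (@node R X) (boundary La).
pose K := (size S * M.+1.*2)%N.
apply: (@le_trans _ _ (\int[P]_w (\sum_(n < K)
    ((\1_(many (fun=> c * t)%R n `\` many (fun=> c) n) w)%:E : \bar R)))%E).
  apply: ge0_le_integral_nonmeas.
  - by move=> w; exact: trace_ge0.
  - by move=> w; apply: sume_ge0 => n _; rewrite lee_fin.
  move=> w adm; apply: trace_le_count => //.
  - by move=> e'; have /andP[le _] := adm e'; exact: lt_le_trans le.
  - move=> e'; have /andP[_ le] := adm e'; apply: le_trans ctM.
    by rewrite ler_pM2r// mulr_gt0.
have uS : uniq S by exact: fset_uniq.
apply: (le_trans (expected_new_eigenvalues hlmin hlmax hCh rl (@node R X)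
  (boundary La) uS M0 K c0 t1 ctM)).
rewrite -EFinD lee_fin -/J -/m /t.
have -> : m * (J * (b / a + eps - 1)) = m * (J * ((b - a) * a^-1)) + m * (J * eps).
  by rewrite mulrBl divff ?gt_eqF//; ring.
apply: lerD => //.
have -> : m * (J * ((b - a) * a^-1)) = (m * J * (b - a)) * a^-1 by ring.
have -> : J * u * (b - a) * m = (m * J * (b - a)) * u by ring.
by apply: ler_wpM2l => //; rewrite !mulr_ge0 ?subr_ge0// ltW.
Qed.
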